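(* Let $\mathbb{P}$ and $\mathbb{O}$ be finite quantum spaces and let $T\colon C(\mathbb{O})\otimes C(\mathbb{O})\to C(\mathbb{P})\otimes C(\mathbb{P})$ be a $(\mathbb{P},\mathbb{O})$-correlation. Then the following conditions are equivalent: (1) there exist a Hilbert space $H$, a pair of unital completely positive maps $\varphi_1,\varphi_2\colon C(\mathbb{O})\to C(\mathbb{P})\otimes B(H)$ satisfying $\varphi_1(x)_{13}\varphi_2(y)_{23}=\varphi_2(y)_{23}\varphi_1(x)_{13}$ for all $x,y\in C(\mathbb{O})$, and a norm-one vector $\xi\in H$ such that $T(x\otimes y)=(\mathrm{id}\otimes\mathrm{id}\otimes\omega_\xi)\bigl(\varphi_1(x)_{13}\varphi_2(y)_{23}\bigr)$ for all $x,y\in C(\mathbb{O})$; (2) there exist a Hilbert space $H$, a pair of unital $*$-homomorphisms $\Phi_1,\Phi_2\colon C(\mathbb{O})\to C(\mathbb{P})\otimes B(H)$ satisfying $\Phi_1(x)_{13}\Phi_2(y)_{23}=\Phi_2(y)_{23}\Phi_1(x)_{13}$ for all $x,y\in C(\mathbb{O})$, and a norm-one vector $\xi\in H$ such that $T(x\otimes y)=(\mathrm{id}\otimes\mathrm{id}\otimes\omega_\xi)\bigl(\Phi_1(x)_{13}\Phi_2(y)_{23}\bigr)$ for all $x,y\in C(\mathbb{O})$; (3) there exists a state $\sigma$ on $C(\mathbb{M}_{\mathbb{P},\mathbb{O}})\otimes_{\max}C(\mathbb{M}_{\mathbb{P},\mathbb{O}})$ such that $T(x\otimes y)=(\mathrm{id}\otimes\mathrm{id}\otimes\sigma)\bigl(\boldsymbol{\Phi}_{\mathbb{P},\mathbb{O}}(x)_{13}\boldsymbol{\Phi}_{\mathbb{P},\mathbb{O}}(y)_{24}\bigr)$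 for all $x,y\in C(\mathbb{O})$; (4) there exists a state $\sigma$ on $\mathbb{S}_{\mathbb{P},\mathbb{O}}\otimes_{\mathrm{c}}\mathbb{S}_{\mathbb{P},\mathbb{O}}$ such that $T(x\otimes y)=(\mathrm{id}\otimes\mathrm{id}\otimes\sigma)\bigl(\boldsymbol{\varphi}_{\mathbb{P},\mathbb{O}}(x)_{13}\boldsymbol{\varphi}_{\mathbb{P},\mathbb{O}}(y)_{24}\bigr)$ for all $x,y\in C(\mathbb{O})$.
   Context: A quantum space $\mathbb{X}$ is an object of the category dual to the category of C*-algebras; the corresponding C*-algebra is denoted $C_0(\mathbb{X})$, or $C(\mathbb{X})$ when it is unital. $\mathbb{X}$ is compact if $C(\mathbb{X})$ is unital and finite if $C(\mathbb{X})$ is finite-dimensional. For C*-algebras $A,B$, $\mathrm{Mor}(A,B)$ is the set of non-degenerate $*$-homomorphisms from $A$ to the multiplier algebra $M(B)$ (unital $*$-homomorphisms $A\to B$ if both are unital). $\otimes$ is the minimal tensor product. For $\mathbb{P}$ finite and $\mathbb{O}$ compact, $(C(\mathbb{M}_{\mathbb{P},\mathbb{O}}),\boldsymbol{\Phi}_{\mathbb{P},\mathbb{O}})$ denotes the (existing, unique up to isomorphism) pair consisting of a unital C*-algebra and a unital $*$-homomorphism $\boldsymbol{\Phi}_{\mathbb{P},\mathbb{O}}\colon C(\mathbb{O})\to C(\mathbb{P})\otimes C(\mathbb{M}_{\mathbb{P},\mathbb{O}})$ with the universal property: for every quantum space $\mathbb{X}$ and every $\Psi\in\mathrm{Mor}(C(\mathbb{O}),C(\mathbb{P})\otimes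 C_0(\mathbb{X}))$ there is a unique $\Lambda\in\mathrm{Mor}(C(\mathbb{M}_{\mathbb{P},\mathbb{O}}),C_0(\mathbb{X}))$ with $\Psi=(\mathrm{id}\otimes\Lambda)\circ\boldsymbol{\Phi}_{\mathbb{P},\mathbb{O}}$. The C*-algebra $C(\mathbb{M}_{\mathbb{P},\mathbb{O}})$ is generated by the slices $(\omega\otimes\mathrm{id})\boldsymbol{\Phi}_{\mathbb{P},\mathbb{O}}(a)$, $a\in C(\mathbb{O})$, $\omega\in C(\mathbb{P})^*$. $\mathbb{S}_{\mathbb{P},\mathbb{O}}\subset C(\mathbb{M}_{\mathbb{P},\mathbb{O}})$ is the operator system defined as the closed linear span of these slices, and $\boldsymbol{\varphi}_{\mathbb{P},\mathbb{O}}\colon C(\mathbb{O})\to C(\mathbb{P})\otimes\mathbb{S}_{\mathbb{P},\mathbb{O}}$ is $\boldsymbol{\Phi}_{\mathbb{P},\mathbb{O}}$ viewed as a (unital completely positive) map into $C(\mathbb{P})\otimes\mathbb{S}_{\mathbb{P},\mathbb{O}}$. A $(\mathbb{P},\mathbb{O})$-correlation is a unital completely positive map $C(\mathbb{O})\otimes C(\mathbb{O})\to C(\mathbb{P})\otimes C(\mathbb{P})$. Leg numbering: for $z=\sum a\otimes b\in C(\mathbb{P})\otimes B(H)$, $z_{13}=\sum a\otimes\mathbb{1}\otimes b$ and $z_{23}=\sum\mathbb{1}\otimes a\otimes b$ in $C(\mathbb{P})\otimes C(\mathbb{P})\otimes B(H)$. If $z=\sum_i a_i\otimes s_i$ and $w=\sum_j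 b_j\otimes t_j$ are in $C(\mathbb{P})\otimes C(\mathbb{M}_{\mathbb{P},\mathbb{O}})$ (or in $C(\mathbb{P})\otimes\mathbb{S}_{\mathbb{P},\mathbb{O}}$), then $z_{13}w_{24}=\sum_{i,j}a_i\otimes b_j\otimes(s_i\otimes t_j)$. $\omega_\xi$ is the vector state $a\mapsto\langle\xi,a\xi\rangle$ on $B(H)$. $\otimes_{\max}$ is the maximal C*-tensor product. For operator systems $S,R$ the commuting tensor product $S\otimes_{\mathrm{c}}R$ is the algebraic tensor product with unit $\mathbb{1}\otimes\mathbb{1}$ and matrix order in which a self-adjoint $u\in M_n(S\otimes R)$ is positive iff $(\mathrm{id}_{M_n}\otimes(\phi\cdot\psi))(u)\geq0$ for all Hilbert spaces $K$ and all completely positive $\phi\colon S\to B(K)$, $\psi\colon R\to B(K)$ with commuting ranges, where $(\phi\cdot\psi)(s\otimes r)=\phi(s)\psi(r)$. A state on an operator system is a unital positive functional. *)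

(* Defs.v *)
From HB Require Import structures.
From mathcomp Require Import all_boot all_order all_algebra generic_quotient.
From mathcomp Require Import mathcomp_extra boolp classical_sets topology.
From mathcomp Require Import normedtype.

Set Implicit Arguments.
Unset Strict Implicit.
Unset Printing Implicit Defensive.

Import Order.TTheory GRing.Theory Num.Theory.
Import numFieldNormedType.Exports.

Local Open Scope classical_set_scope.
Local Open Scope ring_scope.
Local Open Scope quotient_scope.

(* The algebraic tensor product: finite families of pairs, read as formal sums
   of simple tensors, modulo the congruence generated by the bilinearity
   relations, i.e. two formal sums are identified iff every bilinear map (with
   values in any space) agrees on them. *)

Section TensorQuotient.
Context {C : fieldType} {U V : lmodType C}.

Definition formal_eval (W : lmodType C) (b : U -> V -> W) (s : seq (U * V)) : W :=
  \sum_(p <- s) b p.1 p.2.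

Definition tensor_rel (s t : seq (U * V)) : bool :=
  `[< forall (W : lmodType C) (b : {bilinear U -> V -> W}),
        formal_eval b s = formal_eval b t >].

Lemma tensor_rel_refl : reflexive tensor_rel.
Proof. by move=> s; apply/asboolP. Qed.

Lemma tensor_rel_sym : symmetric tensor_rel.
Proof. by move=> s t; apply/asboolP/asboolP => h W b. Qed.

Lemma tensor_rel_trans : transitive tensor_rel.
Proof.
by move=> t s u /asboolP h /asboolP k; apply/asboolP => W b; rewrite h k.
Qed.

Canonical tensor_equiv :=
  EquivRel tensor_rel tensor_rel_refl tensor_rel_sym tensor_rel_trans.

Definition tensor_quot := {eq_quot tensor_equiv}.
End TensorQuotient.

Definition tensor {C : fieldType} (U V : lmodType C) : Type :=
  @tensor_quot C U V.

Section Tensor.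
Context {C : fieldType} {U V : lmodType C}.
Local Notation tensor := (tensor U V).

HB.instance Definition _ := Choice.copy tensor (@tensor_quot C U V).

Definition tclass (s : seq (U * V)) : tensor := \pi_(@tensor_quot C U V) s.
Definition trepr (x : tensor) : seq (U * V) := repr (x : @tensor_quot C U V).

Definition tlift (W : lmodType C) (b : U -> V -> W) (x : tensor) : W :=
  formal_eval b (trepr x).

Lemma tlift_class (W : lmodType C) (b : {bilinear U -> V -> W}) s :
  tlift b (tclass s) = formal_eval b s.
Proof.
rewrite /tlift; have /eqmodP/asboolP -> // :
  trepr (tclass s) = s %[mod_eq (@tensor_equiv C U V)].
by rewrite reprK.
Qed.

Lemma tensor_ext (x y : tensor) :
  (forall (W : lmodType C) (b : {bilinear U -> V -> W}), tlift b x = tlift b y) ->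
  x = y.
Proof.
move=> h; rewrite -[x]reprK -[y]reprK; apply/eqmodP/asboolP => W b.
exact: h.
Qed.

Definition tpair (u : U) (v : V) : tensor := tclass [:: (u, v)].

Lemma tlift_pair (W : lmodType C) (b : {bilinear U -> V -> W}) u v :
  tlift b (tpair u v) = b u v.
Proof. by rewrite tlift_class /formal_eval big_seq1. Qed.

Definition tadd (x y : tensor) : tensor := tclass (trepr x ++ trepr y).
Definition tscale (a : C) (x : tensor) : tensor :=
  tclass [seq (a *: p.1, p.2) | p <- trepr x].

Lemma tlift_add (W : lmodType C) (b : {bilinear U -> V -> W}) x y :
  tlift b (tadd x y) = tlift b x + tlift b y.
Proof. by rewrite tlift_class /formal_eval big_cat. Qed.

Lemma tlift_scale (W : lmodType C) (b : {bilinear U -> V -> W}) a x :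
  tlift b (tscale a x) = a *: tlift b x.
Proof.
rewrite tlift_class /formal_eval big_map scaler_sumr.
by apply: eq_bigr => p _; rewrite linearZl_LR.
Qed.

Lemma tlift_zero (W : lmodType C) (b : {bilinear U -> V -> W}) :
  tlift b (tclass [::]) = 0.
Proof. by rewrite tlift_class /formal_eval big_nil. Qed.

Fact taddA : associative tadd.
Proof. by move=> x y z; apply: tensor_ext => W b; rewrite !tlift_add addrA. Qed.
Fact taddC : commutative tadd.
Proof. by move=> x y; apply: tensor_ext => W b; rewrite !tlift_add addrC. Qed.
Fact tadd0 : left_id (tclass [::]) tadd.
Proof.
by move=> x; apply: tensor_ext => W b; rewrite tlift_add tlift_zero add0r.
Qed.
Fact taddN : left_inverse (tclass [::]) (tscale (-1)) tadd.
Proof.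
move=> x; apply: tensor_ext => W b.
by rewrite tlift_add tlift_scale tlift_zero scaleN1r addNr.
Qed.

HB.instance Definition _ := GRing.isZmodule.Build tensor taddA taddC tadd0 taddN.

Fact tscaleA a c x : tscale a (tscale c x) = tscale (a * c) x.
Proof. by apply: tensor_ext => W b; rewrite !tlift_scale scalerA. Qed.
Fact tscale1 : left_id 1 tscale.
Proof. by move=> x; apply: tensor_ext => W b; rewrite tlift_scale scale1r. Qed.
Fact tscaleDr : right_distributive tscale +%R.
Proof.
move=> a x y; apply: tensor_ext => W b.
by rewrite tlift_scale !tlift_add !tlift_scale scalerDr.
Qed.
Fact tscaleDl x : {morph tscale^~ x : a c / a + c}.
Proof.
move=> a c; apply: tensor_ext => W b.
by rewrite tlift_scale tlift_add !tlift_scale scalerDl.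
Qed.

HB.instance Definition _ :=
  GRing.Zmodule_isLmodule.Build C tensor tscaleA tscale1 tscaleDr tscaleDl.

Fact tlift_is_linear (W : lmodType C) (b : {bilinear U -> V -> W}) :
  linear (tlift b).
Proof. by move=> a x y; rewrite [LHS]tlift_add tlift_scale. Qed.

HB.instance Definition _ (W : lmodType C) (b : {bilinear U -> V -> W}) :=
  GRing.isLinear.Build C tensor W _ (tlift b) (tlift_is_linear b).

Fact tpair_bilinear : bilinear_for
  (GRing.Scale.Law.clone _ _ *:%R _) (GRing.Scale.Law.clone _ _ *:%R _) tpair.
Proof.
split=> [v|u] a x y; apply: tensor_ext => W b;
  rewrite linearP /= !tlift_pair.
- exact: linearPl.
- exact: linearPr.
Qed.
HB.instance Definition _ :=
  bilinear_isBilinear.Build C U V tensor _ _ tpair tpair_bilinear.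

Lemma tensor_sum (x : tensor) : x = \sum_(p <- trepr x) tpair p.1 p.2.
Proof.
apply: tensor_ext => W b; rewrite [RHS]linear_sum.
by apply: eq_bigr => p _ /=; rewrite tlift_pair.
Qed.

Lemma tensor_ind (Q : tensor -> Prop) :
  Q 0 -> (forall u v, Q (tpair u v)) -> (forall x y, Q x -> Q y -> Q (x + y)) ->
  forall x, Q x.
Proof. by move=> Q0 Qp QD x; rewrite [x]tensor_sum; apply: big_ind. Qed.

End Tensor.

Arguments tpair {C U V} u v : simpl never.
Notation "u \ot v" := (tpair u v) (at level 40, left associativity) : ring_scope.

Notation is_bilinear f := (bilinear_for
  (GRing.Scale.Law.clone _ _ *:%R _) (GRing.Scale.Law.clone _ _ *:%R _) f).

Section TensorMaps.
Context {C : fieldType}.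
Implicit Types U V W : lmodType C.

Section Map.
Context {U V U' V' : lmodType C} (f : {linear U -> U'}) (g : {linear V -> V'}).

Definition tmap_fun u v := f u \ot g v.
Fact tmap_fun_bilinear : is_bilinear tmap_fun.
Proof.
by split=> [v|u] a x y; rewrite /tmap_fun linearP ?linearPl ?linearPr.
Qed.
HB.instance Definition _ :=
  bilinear_isBilinear.Build C U V _ _ _ tmap_fun tmap_fun_bilinear.

Definition tmap : tensor U V -> tensor U' V' := tlift tmap_fun.
HB.instance Definition _ := GRing.Linear.on tmap.

Lemma tmap_pair u v : tmap (u \ot v) = f u \ot g v.
Proof. exact: tlift_pair. Qed.
End Map.

Section Slice.
Context {V W : lmodType C}.

Definition slicel_fun (w : {scalar V}) v (x : W) := w v *: x.
Fact slicel_fun_bilinear w : is_bilinear (slicel_fun w).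
Proof.
split=> [v|u] a x y; rewrite /slicel_fun.
  by rewrite linearP /= scalerDl scalerA.
by rewrite /= scalerDr !scalerA mulrC.
Qed.
HB.instance Definition _ w :=
  bilinear_isBilinear.Build C V W _ _ _ (slicel_fun w) (slicel_fun_bilinear w).

Definition slicer_fun (w : {scalar W}) (v : V) x := w x *: v.
Fact slicer_fun_bilinear w : is_bilinear (slicer_fun w).
Proof.
split=> [v|u] a x y; rewrite /slicer_fun.
  by rewrite /= scalerDr !scalerA mulrC.
by rewrite linearP /= scalerDl scalerA.
Qed.
HB.instance Definition _ w :=
  bilinear_isBilinear.Build C V W _ _ _ (slicer_fun w) (slicer_fun_bilinear w).

(* slicel w is w \ot id, slicer w is id \ot w. *)
Definition slicel (w : {scalar V}) : tensor V W -> W := tlift (slicel_fun w).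
Definition slicer (w : {scalar W}) : tensor V W -> V := tlift (slicer_fun w).
HB.instance Definition _ w := GRing.Linear.on (slicel w).
HB.instance Definition _ w := GRing.Linear.on (slicer w).

Lemma slicel_pair w v x : slicel w (v \ot x) = w v *: x.
Proof. exact: tlift_pair. Qed.
Lemma slicer_pair w v x : slicer w (v \ot x) = w x *: v.
Proof. exact: tlift_pair. Qed.
End Slice.

Section Interchange.
Context {U V U' V' : lmodType C}.
Local Notation T4 := (tensor (tensor U U') (tensor V V')).

Definition tinter_in (u : U) (v : V) (u' : U') (v' : V') : T4 :=
  (u \ot u') \ot (v \ot v').
Fact tinter_in_bilinear u v : is_bilinear (tinter_in u v).
Proof.
split=> [v'|u'] a x y; rewrite /tinter_in.
  by rewrite linearPr linearPl.
by rewrite linearPr linearPr.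
Qed.
HB.instance Definition _ u v :=
  bilinear_isBilinear.Build C _ _ _ _ _ (tinter_in u v) (tinter_in_bilinear u v).

Definition tinter_out (y : tensor U' V') (u : U) (v : V) : T4 :=
  tlift (tinter_in u v) y.
Fact tinter_out_bilinear y : is_bilinear (tinter_out y).
Proof.
split=> [v|u] a x z; rewrite /tinter_out; move: y;
  apply: tensor_ind => [|p q|p q hp hq] /=.
- by rewrite !linear0 ?scaler0 /= ?addr0.
- by rewrite !tlift_pair /= /tinter_in !linearPl.
- by rewrite !linearD /= hp hq /= addrACA.
- by rewrite !linear0 ?scaler0 /= ?addr0.
- by rewrite !tlift_pair /= /tinter_in linearPl linearPr.
- by rewrite !linearD /= hp hq /= addrACA.
Qed.
HB.instance Definition _ y :=
  bilinear_isBilinear.Build C _ _ _ _ _ (tinter_out y) (tinter_out_bilinear y).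

(* (u \ot v, u' \ot v') |-> (u \ot u') \ot (v \ot v'), which is z_13 w_24 in
   leg numbering *)
Definition tinter (z : tensor U V) (w : tensor U' V') : T4 :=
  tlift (tinter_out w) z.

Lemma tinter_pair u v u' v' :
  tinter (u \ot v) (u' \ot v') = (u \ot u') \ot (v \ot v').
Proof. by rewrite /tinter tlift_pair /= /tinter_out tlift_pair. Qed.

Fact tinter_bilinear : is_bilinear tinter.
Proof.
split=> [w|z] a x y; rewrite /tinter; first by rewrite linearP.
move: z; apply: tensor_ind => [|p q|p q hp hq] /=.
- by rewrite !linear0 ?scaler0 /= ?addr0.
- by rewrite !tlift_pair /= /tinter_out linearP.
- by rewrite !linearD /= hp hq /= addrACA.
Qed.
HB.instance Definition _ :=
  bilinear_isBilinear.Build C _ _ _ _ _ tinter tinter_bilinear.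
End Interchange.
End TensorMaps.

Arguments tmap : simpl never.
Arguments slicel : simpl never.
Arguments slicer : simpl never.
Arguments tinter : simpl never.
Arguments tlift : simpl never.

(* Involutive algebras, not necessarily unital and possibly zero; this is why
   the product is not taken from the algebra hierarchy of MathComp, whose
   members are unital and nonzero. *)

HB.mixin Record isStarAlg (C : numClosedFieldType) A of GRing.Lmodule C A := {
  smul : A -> A -> A;
  star : A -> A;
  smulA : associative smul;
  smulDl : left_distributive smul +%R;
  smulDr : right_distributive smul +%R;
  smulZl : forall (k : C) (x y : A), k *: smul x y = smul (k *: x) y;
  smulZr : forall (k : C) (x y : A), k *: smul x y = smul x (k *: y);
  starK : involutive star;
  starD : {morph star : x y / x + y};
  starZ : forall (k : C) (x : A), star (k *: x) = k^* *: star x;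
  starM : forall x y : A, star (smul x y) = smul (star y) (star x)
}.
#[short(type="starAlgType")]
HB.structure Definition StarAlg (C : numClosedFieldType) :=
  {A of GRing.Lmodule C A & isStarAlg C A}.

Notation "x ** y" := (smul x y) (at level 40, left associativity) : ring_scope.

HB.mixin Record hasUnit (C : numClosedFieldType) A of StarAlg C A := {
  uone : A;
  smul1l : left_id uone smul;
  smul1r : right_id uone smul
}.
#[short(type="ustarAlgType")]
HB.structure Definition UStarAlg (C : numClosedFieldType) :=
  {A of StarAlg C A & hasUnit C A}.

Section StarAlgTheory.
Context {C : numClosedFieldType}.

Lemma star_one (A : ustarAlgType C) : star (uone : A) = uone.
Proof. by rewrite -[LHS]smul1l -{1}(starK uone) -starM smul1l starK. Qed.

Context {A : starAlgType C}.
Implicit Types x y : A.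

Lemma star_zero : star (0 : A) = 0.
Proof. by apply: (addrI (star 0)); rewrite -starD !addr0. Qed.

Fact smul_bilinear : is_bilinear (@smul C A).
Proof.
split=> [y|x] a u v /=; first by rewrite smulDl smulZl.
by rewrite smulDr smulZr.
Qed.
HB.instance Definition _ :=
  bilinear_isBilinear.Build C A A A _ _ (@smul C A) smul_bilinear.
End StarAlgTheory.

(* The conjugate vector space, used to see antilinear maps as linear ones. *)
Definition conjmod {C : numClosedFieldType} (V : lmodType C) : Type := V.
Section ConjMod.
Context {C : numClosedFieldType} {V : lmodType C}.
HB.instance Definition _ := GRing.Zmodule.on (conjmod V).
Definition conj_scale (a : C) (v : conjmod V) : conjmod V := a^* *: (v : V).
Fact conj_scaleA a b v : conj_scale a (conj_scale b v) = conj_scale (a * b) v.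
Proof. by rewrite /conj_scale scalerA rmorphM. Qed.
Fact conj_scale1 : left_id 1 conj_scale.
Proof. by move=> v; rewrite /conj_scale rmorph1 scale1r. Qed.
Fact conj_scaleDr : right_distributive conj_scale +%R.
Proof. by move=> a u v; rewrite /conj_scale -scalerDr. Qed.
Fact conj_scaleDl v : {morph conj_scale^~ v : a b / a + b}.
Proof. by move=> a b; rewrite /conj_scale rmorphD scalerDl. Qed.
HB.instance Definition _ := GRing.Zmodule_isLmodule.Build C (conjmod V)
  conj_scaleA conj_scale1 conj_scaleDr conj_scaleDl.
End ConjMod.

Section TensorStarAlg.
Context {C : numClosedFieldType} {A B : starAlgType C}.
Implicit Types x y z : tensor A B.

Definition tmul x y : tensor A B :=
  tmap (tlift (@smul C A)) (tlift (@smul C B)) (tinter x y).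

Lemma tmul_pair (a a' : A) (b b' : B) :
  tmul (a \ot b) (a' \ot b') = (a ** a') \ot (b ** b').
Proof. by rewrite /tmul tinter_pair tmap_pair /= !tlift_pair. Qed.

Fact tmulDl : left_distributive tmul +%R.
Proof. by move=> x y z; rewrite /tmul linearDl linearD. Qed.
Fact tmulDr : right_distributive tmul +%R.
Proof. by move=> x y z; rewrite /tmul linearDr linearD. Qed.
Fact tmul0l y : tmul 0 y = 0.
Proof. by rewrite /tmul linear0l linear0. Qed.
Fact tmul0r x : tmul x 0 = 0.
Proof. by rewrite /tmul linear0r linear0. Qed.
Fact tmulZl k x y : k *: tmul x y = tmul (k *: x) y.
Proof. by rewrite /tmul linearZl_LR linearZ. Qed.
Fact tmulZr k x y : k *: tmul x y = tmul x (k *: y).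
Proof. by rewrite /tmul linearZr_LR linearZ. Qed.

Fact tmulA : associative tmul.
Proof.
move=> x y z; move: x; apply: tensor_ind => [|a b|x x' hx hx'].
- by rewrite !tmul0l.
- move: y; apply: tensor_ind => [|a' b'|y y' hy hy'].
  + by rewrite !(tmul0l, tmul0r).
  + move: z; apply: tensor_ind => [|a'' b''|z z' hz hz'].
    * by rewrite !tmul0r.
    * by rewrite !tmul_pair !smulA.
    * by rewrite !tmulDr hz hz'.
  + by rewrite !(tmulDl, tmulDr) hy hy'.
- by rewrite !tmulDl hx hx'.
Qed.
Definition tstar_fun (a : A) (b : B) : conjmod (tensor A B) :=
  star a \ot star b.
Fact tstar_fun_bilinear : is_bilinear tstar_fun.
Proof.
split=> [b|a] k x y; rewrite /tstar_fun /=.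
  by rewrite starD starZ linearPl.
by rewrite starD starZ linearPr.
Qed.
HB.instance Definition _ :=
  bilinear_isBilinear.Build C A B _ _ _ tstar_fun tstar_fun_bilinear.

Definition tstar x : tensor A B := tlift tstar_fun x.

Lemma tstar_pair (a : A) (b : B) : tstar (a \ot b) = star a \ot star b.
Proof. by rewrite /tstar tlift_pair. Qed.

Fact tstarD : {morph tstar : x y / x + y}.
Proof. by move=> x y; rewrite /tstar linearD. Qed.
Fact tstarZ k x : tstar (k *: x) = k^* *: tstar x.
Proof. by rewrite /tstar linearZ. Qed.
Fact tstar0 : tstar 0 = 0.
Proof. by rewrite /tstar linear0. Qed.
Fact tstarK : involutive tstar.
Proof.
apply: tensor_ind => [|a b|x y hx hy]; first by rewrite !tstar0.
  by rewrite !tstar_pair !starK.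
by rewrite !tstarD hx hy.
Qed.
Fact tstarM x y : tstar (tmul x y) = tmul (tstar y) (tstar x).
Proof.
move: x; apply: tensor_ind => [|a b|x x' hx hx'].
- by rewrite tmul0l tstar0 tmul0r.
- move: y; apply: tensor_ind => [|a' b'|y y' hy hy'].
  + by rewrite tmul0r tstar0 tmul0l.
  + by rewrite tmul_pair !tstar_pair tmul_pair !starM.
  + by rewrite tmulDr !tstarD tmulDl hy hy'.
- by rewrite tmulDl !tstarD tmulDr hx hx'.
Qed.

HB.instance Definition _ := isStarAlg.Build C (tensor A B)
  tmulA tmulDl tmulDr tmulZl tmulZr tstarK tstarD tstarZ tstarM.

Lemma tensorM (a a' : A) (b b' : B) :
  (a \ot b) ** (a' \ot b') = (a ** a') \ot (b ** b').
Proof. exact: tmul_pair. Qed.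
Lemma tensor_star (a : A) (b : B) : star (a \ot b) = star a \ot star b.
Proof. exact: tstar_pair. Qed.
End TensorStarAlg.

Section TensorUnit.
Context {C : numClosedFieldType} {A B : ustarAlgType C}.

Fact tensor_mul1l : left_id (uone \ot uone) (@smul C (tensor A B)).
Proof.
apply: tensor_ind => [|a b|x y hx hy]; first exact: tmul0r.
  by rewrite tensorM !smul1l.
by rewrite smulDr hx hy.
Qed.
Fact tensor_mul1r : right_id (uone \ot uone) (@smul C (tensor A B)).
Proof.
apply: tensor_ind => [|a b|x y hx hy]; first exact: tmul0l.
  by rewrite tensorM !smul1r.
by rewrite smulDl hx hy.
Qed.
HB.instance Definition _ :=
  hasUnit.Build C (tensor A B) tensor_mul1l tensor_mul1r.

Lemma tensor_one : uone = uone \ot uone :> tensor A B.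
Proof. by []. Qed.
End TensorUnit.

Section StarMaps.
Context {C : numClosedFieldType}.

(* X = Y^* Y in M_n(A).  These are the positive elements when M_n(A) is a
   C*-algebra, which is the case for all the algebras A this is applied to:
   C*-algebras, B(H), and algebraic tensor products of these with
   finite-dimensional C*-algebras. *)
Definition mxpos (A : starAlgType C) n (X : 'M[A]_n) : Prop :=
  exists Y : 'M[A]_n, X = \matrix_(i, j) \sum_k star (Y k i) ** Y k j.

Definition is_starhom (A B : ustarAlgType C) (f : {linear A -> B}) : Prop :=
  [/\ f uone = uone, {morph f : x y / x ** y} & {morph f : x / star x}].

Definition is_ucp (A B : ustarAlgType C) (f : {linear A -> B}) : Prop :=
  f uone = uone /\
  forall n (X : 'M[A]_n), mxpos X -> mxpos (map_mx f X).

Definition is_state (A : ustarAlgType C) (s : {scalar A}) : Prop :=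
  s uone = 1 /\ forall x, 0 <= s (star x ** x).
End StarMaps.

Section Adjointable.
Context {C : numClosedFieldType} {V : normedModType C} {W : zmodType}
  {s : C -> W -> W} (p : {bilinear V -> V -> W | s & Num.conj \; s}).

(* Bounded operators together with their adjoint with respect to the
   sesquilinear form p.  For the forms used below (the inner product of a
   Hilbert space, and (x, y) |-> y^* x on a C*-algebra) the adjoint is
   determined by the operator, and on a Hilbert space every bounded operator
   has one by the Riesz representation theorem. *)
Record adjop := Adjop {
  op :> V -> V;
  adj : V -> V;
  op_linear : linear op;
  adj_linear : linear adj;
  op_bounded : exists M : C, forall x, `|op x| <= M * `|x|;
  adj_bounded : exists M : C, forall x, `|adj x| <= M * `|x|;
  op_adj : forall x y, p (op x) y = p x (adj y);
  adj_op : forall x y, p (adj x) y = p x (op y)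
}.

HB.instance Definition _ := gen_eqMixin adjop.
HB.instance Definition _ := gen_choiceMixin adjop.

Lemma adjop_ext (f g : adjop) : op f =1 op g -> adj f =1 adj g -> f = g.
Proof.
case: f g => [f f' ? ? ? ? ? ?] [g g' ? ? ? ? ? ?] /= /funext e /funext e'.
by subst g g'; congr Adjop; exact: Prop_irrelevance.
Qed.

Let blin (f : V -> V) := linear f /\ exists M : C, forall x, `|f x| <= M * `|x|.

Let opP (f : adjop) : blin f. Proof. by split; case: f. Qed.
Let adjP (f : adjop) : blin (adj f). Proof. by split; case: f. Qed.

Let blin0 : blin (fun=> 0).
Proof.
split; first by move=> a x y; rewrite scaler0 addr0.
by exists 0 => x; rewrite normr0 mul0r.
Qed.

Let blinD f g : blin f -> blin g -> blin (fun x => f x + g x).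
Proof.
move=> [lf [M hM]] [lg [N hN]]; split.
  by move=> a x y; rewrite lf lg scalerDr addrACA.
exists (M + N) => x; rewrite mulrDl (le_trans (ler_normD _ _)) //.
exact: lerD.
Qed.

Let blinZ a f : blin f -> blin (fun x => a *: f x).
Proof.
move=> [lf [M hM]]; split.
  by move=> b x y; rewrite lf scalerDr !scalerA mulrC.
exists (`|a| * M) => x; rewrite normrZ -mulrA.
exact: ler_wpM2l.
Qed.

Let blin_comp f g : blin f -> blin g -> blin (fun x => f (g x)).
Proof.
move=> [lf [M hM]] [lg [N hN]]; split; first by move=> a x y; rewrite lg lf.
exists (`|M| * N) => x; apply: (le_trans (hM _)).
rewrite -mulrA; apply: (@le_trans _ _ (`|M| * `|g x|)); last exact: ler_wpM2l.
have [->|gx0] := eqVneq (g x) 0; first by rewrite normr0 !mulr0.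
rewrite ler_pM2r ?normr_gt0 // real_ler_norm //.
rewrite realE; apply/orP; left.
by rewrite -(pmulr_lge0 _ (_ : 0 < `|g x|)) ?normr_gt0 // (le_trans _ (hM _)).
Qed.

Let blin_id : blin id.
Proof. by split=> //; exists 1 => x; rewrite mul1r. Qed.

Local Notation mk hf hg e e' :=
  (@Adjop _ _ (proj1 hf) (proj1 hg) (proj2 hf) (proj2 hg) e e').

Program Definition adjop0 : adjop := mk blin0 blin0 _ _.
Next Obligation. by move=> * /=; rewrite linear0l linear0r. Qed.
Next Obligation. by move=> * /=; rewrite linear0l linear0r. Qed.

Program Definition adjop1 : adjop := mk blin_id blin_id _ _.
Next Obligation. by []. Qed.
Next Obligation. by []. Qed.

Program Definition adjop_add (f g : adjop) : adjop :=
  mk (blinD (opP f) (opP g)) (blinD (adjP f) (adjP g)) _ _.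
Next Obligation. by move=> * /=; rewrite linearDl linearDr !op_adj. Qed.
Next Obligation. by move=> * /=; rewrite linearDl linearDr !adj_op. Qed.

Program Definition adjop_scale (a : C) (f : adjop) : adjop :=
  mk (blinZ a (opP f)) (blinZ a^* (adjP f)) _ _.
Next Obligation. by move=> * /=; rewrite linearZl_LR linearZr_LR /= conjCK op_adj. Qed.
Next Obligation. by move=> * /=; rewrite linearZl_LR linearZr_LR /= adj_op. Qed.

Program Definition adjop_mul (f g : adjop) : adjop :=
  mk (blin_comp (opP f) (opP g)) (blin_comp (adjP g) (adjP f)) _ _.
Next Obligation. by move=> * /=; rewrite !op_adj. Qed.
Next Obligation. by move=> * /=; rewrite !adj_op. Qed.

Definition adjop_star (f : adjop) : adjop :=
  mk (adjP f) (opP f) (@adj_op f) (@op_adj f).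

Fact adjop_addA : associative adjop_add.
Proof. by move=> f g h; apply: adjop_ext => x /=; rewrite addrA. Qed.
Fact adjop_addC : commutative adjop_add.
Proof. by move=> f g; apply: adjop_ext => x /=; rewrite addrC. Qed.
Fact adjop_add0 : left_id adjop0 adjop_add.
Proof. by move=> f; apply: adjop_ext => x /=; rewrite add0r. Qed.
Fact adjop_addN : left_inverse adjop0 (adjop_scale (-1)) adjop_add.
Proof.
move=> f; apply: adjop_ext => x /=; rewrite ?rmorphN ?rmorph1;
by rewrite scaleN1r addNr.
Qed.
HB.instance Definition _ := GRing.isZmodule.Build adjop
  adjop_addA adjop_addC adjop_add0 adjop_addN.

Fact adjop_scaleA a b f : adjop_scale a (adjop_scale b f) = adjop_scale (a * b) f.
Proof. by apply: adjop_ext => x /=; rewrite scalerA ?rmorphM. Qed.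
Fact adjop_scale1 : left_id 1 adjop_scale.
Proof. by move=> f; apply: adjop_ext => x /=; rewrite ?rmorph1 scale1r. Qed.
Fact adjop_scaleDr : right_distributive adjop_scale +%R.
Proof. by move=> a f g; apply: adjop_ext => x /=; rewrite scalerDr. Qed.
Fact adjop_scaleDl f : {morph adjop_scale^~ f : a b / a + b}.
Proof. by move=> a b; apply: adjop_ext => x /=; rewrite ?rmorphD scalerDl. Qed.
HB.instance Definition _ := GRing.Zmodule_isLmodule.Build C adjop
  adjop_scaleA adjop_scale1 adjop_scaleDr adjop_scaleDl.

Let opD (f : adjop) x y : f (x + y) = f x + f y.
Proof. by rewrite -[x]scale1r (op_linear f) !scale1r. Qed.
Let adjD (f : adjop) x y : adj f (x + y) = adj f x + adj f y.
Proof. by rewrite -[x]scale1r (adj_linear f) !scale1r. Qed.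
Let opZ (f : adjop) a x : f (a *: x) = a *: f x.
Proof.
have f0 : f 0 = 0 by apply: (addrI (f 0)); rewrite -opD !addr0.
by rewrite -[a *: x]addr0 (op_linear f) f0 addr0.
Qed.
Let adjZ (f : adjop) a x : adj f (a *: x) = a *: adj f x.
Proof. exact: (opZ (adjop_star f)). Qed.

Fact adjop_mulA : associative adjop_mul.
Proof. by move=> f g h; apply: adjop_ext. Qed.
Fact adjop_mulDl : left_distributive adjop_mul +%R.
Proof. by move=> f g h; apply: adjop_ext => x //=; rewrite adjD. Qed.
Fact adjop_mulDr : right_distributive adjop_mul +%R.
Proof. by move=> f g h; apply: adjop_ext => x //=; rewrite opD. Qed.
Fact adjop_mulZl a f g : a *: adjop_mul f g = adjop_mul (a *: f) g.
Proof. by apply: adjop_ext => x //=; rewrite adjZ. Qed.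
Fact adjop_mulZr a f g : a *: adjop_mul f g = adjop_mul f (a *: g).
Proof. by apply: adjop_ext => x //=; rewrite opZ. Qed.
Fact adjop_starK : involutive adjop_star.
Proof. by move=> f; apply: adjop_ext. Qed.
Fact adjop_starD : {morph adjop_star : f g / f + g}.
Proof. by move=> f g; apply: adjop_ext. Qed.
Fact adjop_starZ a f : adjop_star (a *: f) = a^* *: adjop_star f.
Proof. by apply: adjop_ext => x //=; rewrite conjCK. Qed.
Fact adjop_starM f g :
  adjop_star (adjop_mul f g) = adjop_mul (adjop_star g) (adjop_star f).
Proof. by apply: adjop_ext. Qed.
HB.instance Definition _ := isStarAlg.Build C adjop
  adjop_mulA adjop_mulDl adjop_mulDr adjop_mulZl adjop_mulZr
  adjop_starK adjop_starD adjop_starZ adjop_starM.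

Fact adjop_mul1l : left_id adjop1 adjop_mul.
Proof. by move=> f; apply: adjop_ext. Qed.
Fact adjop_mul1r : right_id adjop1 adjop_mul.
Proof. by move=> f; apply: adjop_ext. Qed.
HB.instance Definition _ := hasUnit.Build C adjop adjop_mul1l adjop_mul1r.

End Adjointable.

(* As everywhere in MathComp, inner products are linear in the first variable,
   so <x, y> of the physics convention is [hdot y x]. *)
HB.mixin Record isHilbert (C : numClosedFieldType) H
    of CompleteNormedModule C H := {
  hdot : {dot H for Num.conj};
  hnormE : forall x : H, `|x| ^+ 2 = hdot x x
}.
#[short(type="hilbertType")]
HB.structure Definition Hilbert (C : numClosedFieldType) :=
  {H of CompleteNormedModule C H & isHilbert C H}.

Definition bop {C : numClosedFieldType} (H : hilbertType C) : Type :=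
  adjop (@hdot C H).
HB.instance Definition _ (C : numClosedFieldType) (H : hilbertType C) :=
  UStarAlg.on (bop H).

Section VectorState.
Context {C : numClosedFieldType} {H : hilbertType C} (xi : H).

Definition vector_state (T : bop H) : C := hdot (op T xi) xi.
Fact vector_state_scalar : scalar vector_state.
Proof. by move=> a S T; rewrite /vector_state /= linearPl. Qed.
HB.instance Definition _ :=
  GRing.isLinear.Build C (bop H) C _ vector_state vector_state_scalar.
End VectorState.

HB.mixin Record isCstar (C : numClosedFieldType) A
    of CompleteNormedModule C A & StarAlg C A := {
  norm_smul : forall x y : A, `|x ** y| <= `|x| * `|y|;
  norm_star_smul : forall x : A, `|star x ** x| = `|x| ^+ 2
}.
#[short(type="cstarType")]
HB.structure Definition Cstar (C : numClosedFieldType) :=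
  {A of CompleteNormedModule C A & StarAlg C A & isCstar C A}.
#[short(type="ucstarType")]
HB.structure Definition UCstar (C : numClosedFieldType) :=
  {A of Cstar C A & UStarAlg C A}.

Section Multiplier.
Context {C : numClosedFieldType} (A : cstarType C).

(* The A-valued inner product of A as a right Hilbert module over itself; the
   multiplier algebra M(A) is the algebra of its adjointable operators. *)
Definition mult_form (x y : A) : A := star y ** x.
Fact mult_form_bilinear : bilinear_for
  (GRing.Scale.Law.clone _ _ *:%R _)
  (GRing.Scale.Law.clone _ _ (Num.conj \; *:%R) _) mult_form.
Proof.
split=> [y|x] a u v; rewrite /mult_form /=.
  by rewrite smulDr smulZr.
by rewrite starD starZ smulDl smulZl.
Qed.
HB.instance Definition _ :=
  bilinear_isBilinear.Build C A A A _ _ mult_form mult_form_bilinear.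

Definition multiplier : Type := adjop mult_form.
HB.instance Definition _ := UStarAlg.on multiplier.
End Multiplier.

Section CstarTheory.
Context {C : numClosedFieldType} {A : cstarType C}.

Lemma norm_star (x : A) : `|star x| = `|x|.
Proof.
have le_star (y : A) : `|y| <= `|star y|.
  have [->|y0] := eqVneq y 0; first by rewrite normr0.
  by rewrite -(ler_pM2r (_ : 0 < `|y|)) ?normr_gt0 // -expr2 -norm_star_smul
    norm_smul.
by apply/le_anti; rewrite le_star andbT -[X in _ <= `|X|]starK le_star.
Qed.

Lemma star_continuous : continuous (@star C A).
Proof.
move=> x; apply/cvgrPdist_lt => e e0; near=> y.
rewrite -scaleN1r -[-1]conjCK rmorphN rmorph1 -starZ scaleN1r -starD norm_star.
by near: y; apply: cvgr_dist_lt.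
Unshelve. all: by end_near. Qed.
End CstarTheory.

(* The algebra C(P) of a (nonempty) finite quantum space P. *)
Record finQSpace (C : numClosedFieldType) := FinQSpace {
  fq_alg :> ucstarType C;
  fq_nonzero : uone != 0 :> fq_alg;
  fq_findim : exists n, inhabited (Vector.axiom n fq_alg)
}.

(* A pair (C(M_{P,O}), Phi_{P,O}) with its universal property.  As C(P) is
   finite-dimensional, its algebraic tensor products with C*-algebras are the
   minimal ones and M(C(P) \ot C_0(X)) = C(P) \ot M(C_0(X)); as C(O) and
   C(M_{P,O}) are unital, non-degenerate *-homomorphisms from them to a
   multiplier algebra are just the unital ones. *)
Record quantum_maps {C : numClosedFieldType} (P O : finQSpace C) := QuantumMaps {
  qm_alg :> ucstarType C;
  qm_Phi : {linear O -> tensor P qm_alg};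
  qm_starhom : is_starhom qm_Phi;
  qm_universal : forall (X : cstarType C)
      (Psi : {linear O -> tensor P (multiplier X)}), is_starhom Psi ->
    exists L : {linear qm_alg -> multiplier X},
      [/\ is_starhom L, forall a, Psi a = tmap idfun L (qm_Phi a)
        & forall L' : {linear qm_alg -> multiplier X}, is_starhom L' ->
            (forall a, Psi a = tmap idfun L' (qm_Phi a)) -> L' =1 L]
}.

Section OperatorSystems.
Context {C : numClosedFieldType}.

Definition is_subspace (V : lmodType C) (S : set V) : Prop :=
  S 0 /\ forall (k : C) x y, S x -> S y -> S (k *: x + y).

Definition closed_span (V : normedModType C) (X : set V) : set V :=
  smallest [set S | closed S /\ is_subspace S] X.

Record opSystem (A : ucstarType C) := OpSystem {
  os_set : set A;
  os_closed : closed os_set;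
  os_subspace : is_subspace os_set;
  os_set1 : os_set uone;
  os_set_star : forall x, os_set x -> os_set (star x)
}.

Section Space.
Context {A : ucstarType C} (S : opSystem A).

Definition os_pred (x : A) : bool := x \in os_set S.
Fact os_pred_submod : subsemimod_closed os_pred.
Proof.
have [S0 SD] := os_subspace S; split; [split|]; rewrite /os_pred.
- exact/mem_set.
- move=> x y /set_mem Sx /set_mem Sy; apply/mem_set.
  by rewrite -[x]scale1r; apply: SD.
- move=> k x /set_mem Sx; apply/mem_set.
  by rewrite -[_ *: _]addr0; apply: SD.
Qed.
HB.instance Definition _ := GRing.isSubmodClosed.Build C A os_pred os_pred_submod.

Record os_space : Type := OsSpace { os_val : A; os_valP : os_pred os_val }.
HB.instance Definition _ := [isSub for os_val].
HB.instance Definition _ := [Choice of os_space by <:].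
HB.instance Definition _ := [SubChoice_isSubLmodule of os_space by <:].

Fact os_val_linear : linear os_val.
Proof. by []. Qed.
HB.instance Definition _ :=
  GRing.isLinear.Build C os_space A _ os_val os_val_linear.

Definition os_one : os_space := OsSpace (mem_set (os_set1 S)).
Definition os_star (x : os_space) : os_space :=
  OsSpace (mem_set (os_set_star (set_mem (os_valP x)))).

(* The positive elements of M_n(S) are those of M_n(A). *)
Definition is_cp (B : starAlgType C) (f : {linear os_space -> B}) : Prop :=
  forall n (X : 'M[os_space]_n), mxpos (map_mx os_val X) -> mxpos (map_mx f X).
End Space.
End OperatorSystems.

Section CommutingTensor.
Context {C : numClosedFieldType} {A B : ucstarType C}.
Context (S : opSystem A) (R : opSystem B).
Local Notation SR := (tensor (os_space S) (os_space R)).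

Definition os_tstar_fun (s : os_space S) (r : os_space R) : conjmod SR :=
  os_star s \ot os_star r.
Fact os_tstar_fun_bilinear : is_bilinear os_tstar_fun.
Proof.
have osP (D : ucstarType C) (Q : opSystem D) a (x y : os_space Q) :
    os_star (a *: x + y) = a^* *: os_star x + os_star y.
  by apply: val_inj; rewrite /= starD starZ.
by split=> [r|s] k x y; rewrite /os_tstar_fun osP /= ?linearPl ?linearPr.
Qed.
HB.instance Definition _ := bilinear_isBilinear.Build C _ _ _ _ _
  os_tstar_fun os_tstar_fun_bilinear.

Definition os_tstar : SR -> SR := tlift os_tstar_fun.

Section Product.
Context {D : starAlgType C}.
Context (f : {linear os_space S -> D}) (g : {linear os_space R -> D}).
Definition os_mul_fun s r : D := f s ** g r.
Fact os_mul_fun_bilinear : is_bilinear os_mul_fun.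
Proof.
by split=> [r|s] k x y; rewrite /os_mul_fun linearP ?linearPl ?linearPr.
Qed.
HB.instance Definition _ := bilinear_isBilinear.Build C _ _ _ _ _
  os_mul_fun os_mul_fun_bilinear.
Definition os_mul : SR -> D := tlift os_mul_fun.
End Product.

Definition commuting_mxpos n (U : 'M[SR]_n) : Prop :=
  (forall i j, U i j = os_tstar (U j i)) /\
  forall (K : hilbertType C) (f : {linear os_space S -> bop K})
      (g : {linear os_space R -> bop K}),
    is_cp f -> is_cp g -> (forall s r, f s ** g r = g r ** f s) ->
    mxpos (map_mx (os_mul f g) U).

Definition is_commuting_state (s : {scalar SR}) : Prop :=
  s (os_one S \ot os_one R) = 1 /\
  forall u, commuting_mxpos (const_mx u : 'M[SR]_1) -> 0 <= s u.
End CommutingTensor.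

(* A unital C*-algebra containing the algebraic tensor product densely, with
   |u|_max the supremum of |pi u| over the *-representations pi. *)
Record max_tensor {C : numClosedFieldType} (A B : ucstarType C) := MaxTensor {
  mt_alg :> ucstarType C;
  mt_in : {linear tensor A B -> mt_alg};
  mt_starhom : is_starhom mt_in;
  mt_dense : dense (range mt_in);
  mt_norm : forall (u : tensor A B) (c : C), 0 <= c ->
    (`|mt_in u| <= c <->
     forall (K : hilbertType C) (pi : {linear tensor A B -> bop K}),
       is_starhom pi -> forall x, `|op (pi u) x| <= c * `|x|)
}.

Lemma closed_span_closed (C : numClosedFieldType) (V : normedModType C)
  (X : set V) : closed (closed_span X).
Proof. by apply: closed_bigI => S [[]]. Qed.

Lemma closed_span_subspace (C : numClosedFieldType) (V : normedModType C)
  (X : set V) : is_subspace (closed_span X).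
Proof.
split; first by move=> S [[_ []]].
by move=> k x y hx hy S hS; case: (hS) => -[_ [_ SD]] _; apply: SD; [apply: hx|apply: hy].
Qed.

Definition mk_linear (K : pzRingType) (U V : lmodType K) (f : U -> V)
    (lf : linear f) : {linear U -> V} :=
  HB.pack f (GRing.isLinear.Build K U V _ f lf).
Definition mk_scalar (K : comNzRingType) (U : lmodType K) (f : U -> K)
    (lf : scalar f) : {scalar U} :=
  HB.pack f (GRing.isLinear.Build K U K _ f lf).

Lemma findim_basis (C : numClosedFieldType) (P : finQSpace C) :
  exists n (e : 'I_n -> P) (w : 'I_n -> {scalar P}),
    forall x, x = \sum_i w i x *: e i.
Proof.
have [n [[f lf [g fK gK]]]] := fq_findim P.
have lw i : scalar (fun x => f x 0 i) by move=> k x y; rewrite lf !mxE.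
exists n, (fun i => g (delta_mx 0 i)).
exists (fun i => mk_scalar (lw i)) => x; apply: (can_inj fK).
have E y : f y = mk_linear lf y by [].
rewrite [RHS]E linear_sum [LHS]row_sum_delta.
by apply: eq_bigr => i _; rewrite linearZ /= gK.
Qed.

Section SliceSystem.
Context {C : numClosedFieldType} {P O : finQSpace C} (M : quantum_maps P O).

(* S_{P,O} is the closed span of these; C(P) being finite-dimensional, C(P)^*
   consists of all linear functionals. *)
Definition slices : set M :=
  [set s | exists (w : {scalar P}) (a : O), s = slicel w (qm_Phi M a)].

Fact slices1 : slices uone.
Proof.
have [n [e [w ew]]] := findim_basis P.
have [i wi] : exists i, w i uone != 0.
  apply: contrapT => /forallNP h; move/eqP: (fq_nonzero P); apply.
  rewrite [LHS]ew big1 // => i _.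
  by move/negP/negPn/eqP: (h i) => ->; rewrite scale0r.
have lw : scalar (fun x => (w i uone)^-1 * w i x).
  by move=> k x y; rewrite linearP /= mulrDr mulrCA.
exists (mk_scalar lw), uone.
have [-> _ _] := qm_starhom M.
by rewrite slicel_pair /= mulVf // scale1r.
Qed.

Fact slices_star x : slices x -> slices (star x).
Proof.
move=> [w [a ->]].
have lw : scalar (fun x => (w (star x))^*).
  move=> k u v; rewrite starD starZ linearP /= rmorphD rmorphM.
  by rewrite /= conjCK.
exists (mk_scalar lw), (star a).
have [_ _ ->] := qm_starhom M.
move: (qm_Phi M a); apply: tensor_ind => [|p m|u v hu hv].
- by rewrite star_zero !linear0 star_zero.
- by rewrite tensor_star !slicel_pair /= starK starZ.
- by rewrite starD !linearD /= starD hu hv.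
Qed.

Fact slice_span_star x : closed_span slices x -> closed_span slices (star x).
Proof.
move=> hx; apply: (hx [set y | closed_span slices (star y)]); split; last first.
  by move=> y /slices_star hy S [_]; apply.
split.
  apply: (closed_comp (f := @star C M)); last exact: closed_span_closed.
  by move=> y _; exact: star_continuous.
have [S0 SD] := closed_span_subspace slices; split=> /=.
  by rewrite star_zero.
by move=> k u v hu hv; rewrite starD starZ; apply: SD.
Qed.

Fact slice_span1 : closed_span slices uone.
Proof. by move=> S [_]; apply; exact: slices1. Qed.

Definition slice_system : opSystem M :=
  OpSystem (@closed_span_closed C M slices) (@closed_span_subspace C M slices)
    slice_span1 slice_span_star.

Lemma slice_corestriction (a : O) :
  exists u : tensor P (os_space slice_system),
    tmap idfun (@os_val C M slice_system) u = qm_Phi M a.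
Proof.
have [n [e [w ew]]] := findim_basis P.
have hS i : os_pred slice_system (slicel (w i) (qm_Phi M a)).
  by apply/mem_set => S [_]; apply; exists (w i), a.
exists (\sum_i e i \ot OsSpace (hS i)); rewrite linear_sum /=.
under eq_bigr do rewrite tmap_pair /=.
move: (qm_Phi M a) => z; move: z {hS}; apply: tensor_ind => [|p m|u v hu hv].
- by rewrite big1 // => i _; rewrite linear0 linear0r.
- under eq_bigr do rewrite slicel_pair linearZr_LR -linearZl_LR.
  by rewrite -linear_sumlz -ew.
- by under eq_bigr do rewrite linearD linearDr; rewrite big_split /= hu hv.
Qed.

(* Phi_{P,O} viewed as a map into C(P) \ot S_{P,O}; the lift along the
   injective map id \ot (inclusion) is unique. *)
Definition slice_phi (a : O) : tensor P (os_space slice_system) :=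
  projT1 (cid (slice_corestriction a)).

Lemma slice_phiE a :
  tmap idfun (@os_val C M slice_system) (slice_phi a) = qm_Phi M a.
Proof. exact: projT2 (cid (slice_corestriction a)). Qed.
End SliceSystem.

Section Legs.
Context {C : numClosedFieldType} {P : ustarAlgType C} {V : lmodType C}.

Definition in_leg1 (a : P) : tensor P P := a \ot uone.
Definition in_leg2 (a : P) : tensor P P := uone \ot a.
Fact in_leg1_linear : linear in_leg1.
Proof. by move=> k x y; rewrite /in_leg1 linearPl. Qed.
Fact in_leg2_linear : linear in_leg2.
Proof. by move=> k x y; rewrite /in_leg2 linearPr. Qed.
HB.instance Definition _ :=
  GRing.isLinear.Build C P (tensor P P) _ in_leg1 in_leg1_linear.
HB.instance Definition _ :=
  GRing.isLinear.Build C P (tensor P P) _ in_leg2 in_leg2_linear.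

(* z_13 and z_23; the product z_13 w_24 is [tinter z w]. *)
Definition leg13 : tensor P V -> tensor (tensor P P) V := tmap in_leg1 idfun.
Definition leg23 : tensor P V -> tensor (tensor P P) V := tmap in_leg2 idfun.
End Legs.

(* Main.v *)
Require Import Defs.
From HB Require Import structures.
From mathcomp Require Import all_boot all_order all_algebra.
From mathcomp Require Import mathcomp_extra boolp classical_sets functions reals topology normedtype.
From mathcomp Require Import complex ring.

Set Implicit Arguments.
Unset Strict Implicit.
Unset Printing Implicit Defensive.

Import Order.TTheory GRing.Theory Num.Theory.
Import numFieldNormedType.Exports.
Local Open Scope classical_set_scope.
Local Open Scope ring_scope.

(* Writing C(P) inside a matrix algebra by means of coordinate functionals j a b, a map
   C(O) -> C(P) (x) B is the matrix of its slices, and all conditions become statements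
   about slices.
   (1) => (2): a unital completely positive map is dilated through a Gram factorisation of
   the positive operator matrix of its slices on the units (c i)^* (c k); the factor lies in
   the bicommutant of the entries, so the dilation of the first map can be chosen to commute
   with the second one, which is then dilated in turn.
   (2) => (3): the universal property, applied to the commutant of the other leg, turns the
   two *-homomorphisms into one of the algebraic tensor product, whose vector state is
   bounded by the maximal norm and extends by density.
   (3) => (4): by the GNS construction the state is a vector state of a product of two
   commuting *-homomorphisms, whose restrictions to the slice system are completely positive.
   (4) => (1): on sums of tensors of slices, positivity in all *-representations implies
   positivity for all commuting completely positive pairs, since such pairs, perturbed to be
   normalisable, dilate.  Riesz' extension theorem then extends the functional to a positive
   one on the whole algebraic tensor product, and its GNS representation proves (2). *)

(** * Semi-inner products and completeness *)

Section Semidot.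
Context {C : numClosedFieldType} {V : lmodType C}.

(** Positivity is algebraic here: a positive matrix is one with a Gram factorisation, so every
    positivity claim has to produce a factor. Operators get theirs from square roots of positive
    forms. The units [star (c a) ** c b] are convenient because their matrix is visibly a Gram
    matrix, so that complete positivity is tested on it alone, as in Choi's theorem, for any
    finite-dimensional C*-algebra and without splitting it into matrix blocks. The obstacle in (1)
    => (2) is that a dilation of one map may lose commutation with the other. It survives because
    the dilation is assembled from matrix units, scalars and a factor in the bicommutant of the
    slices: whatever commutes with the slices commutes, once amplified, with the dilation. In (4) =>
    (1) the slice system is a closure, whereas dilation needs a map defined on C(O). Only finite
    sums of tensors of slices enter, and on a slice a map of the slice system is a slice of a map on
    C(O). The extended functional lives on the algebraic tensor product, where the maximal norm
    supplies the bounds for the GNS operators. *)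

Definition is_semidot (p : V -> V -> C) : Prop :=
  [/\ forall k x y z, p (k *: x + y) z = k * p x z + p y z,
      forall x y, p x y = (p y x)^* & forall x, 0 <= p x x].

Section Theory.
Variables (p : V -> V -> C) (hp : is_semidot p).

Lemma semidotC x y : p x y = (p y x)^*. Proof. by case: hp. Qed.
Lemma semidot_ge0 x : 0 <= p x x. Proof. by case: hp. Qed.
Lemma semidotPl k x y z : p (k *: x + y) z = k * p x z + p y z.
Proof. by case: hp. Qed.
Lemma semidotPr k x y z : p z (k *: x + y) = k^* * p z x + p z y.
Proof.
by rewrite [LHS]semidotC semidotPl rmorphD rmorphM (semidotC z x) (semidotC z y).
Qed.
Lemma semidot0l z : p 0 z = 0.
Proof.
have := semidotPl 1 0 0 z; rewrite scaler0 addr0 mul1r => /(congr1 (fun t => t - p 0 z)).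
by rewrite subrr addrK => <-.
Qed.
Lemma semidot0r z : p z 0 = 0. Proof. by rewrite [LHS]semidotC semidot0l conjC0. Qed.
Lemma semidotDl x y z : p (x + y) z = p x z + p y z.
Proof. by have := semidotPl 1 x y z; rewrite scale1r mul1r. Qed.
Lemma semidotDr x y z : p z (x + y) = p z x + p z y.
Proof. by have := semidotPr 1 x y z; rewrite scale1r conjC1 mul1r. Qed.
Lemma semidotZl k x z : p (k *: x) z = k * p x z.
Proof. by have := semidotPl k x 0 z; rewrite addr0 semidot0l addr0. Qed.
Lemma semidotZr k x z : p z (k *: x) = k^* * p z x.
Proof. by have := semidotPr k x 0 z; rewrite addr0 semidot0r addr0. Qed.
Lemma semidotNl x z : p (- x) z = - p x z.
Proof. by rewrite -scaleN1r semidotZl mulN1r. Qed.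
Lemma semidotNr x z : p z (- x) = - p z x.
Proof. by rewrite [LHS]semidotC semidotNl rmorphN (semidotC z x). Qed.
Lemma semidotBl x y z : p (x - y) z = p x z - p y z.
Proof. by rewrite semidotDl semidotNl. Qed.
Lemma semidotBr x y z : p z (x - y) = p z x - p z y.
Proof. by rewrite semidotDr semidotNr. Qed.

Lemma semidot_CS x y : `|p x y| ^+ 2 <= p x x * p y y.
Proof.
have q (t : C) : 0 <= p x x - (t^* * p x y + t * p y x) + `|t| ^+ 2 * p y y.
  have := semidot_ge0 (x - t *: y); rewrite semidotBl !semidotBr !semidotZl !semidotZr.
  by rewrite normCK; congr (_ <= _); ring.
have [y0|y0] := eqVneq (p y y) 0.
  rewrite y0 mulr0.
  have x0 := semidot_ge0 x.
  have [->|xy0] := eqVneq (p x y) 0; first by rewrite normr0 expr0n.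
  (* When [p y y = 0] the bound [q] is affine along multiples of [p x y]; this multiple brings its
     value down to [- (p x x + 2)], a contradiction. *)
  pose k := (p x x + 1) / `|p x y| ^+ 2.
  have n0 : `|p x y| ^+ 2 != 0 by rewrite expf_neq0 // normr_eq0.
  have k0 : k^* = k by rewrite /k geC0_conj // divr_ge0 ?addr_ge0 ?exprn_ge0.
  have kE : k * `|p x y| ^+ 2 = p x x + 1 by rewrite /k divfK.
  have := q (k * p x y); rewrite y0 mulr0 addr0 (semidotC y x) [(_ * _)^*]rmorphM /= k0.
  rewrite (_ : _ - _ = p x x - (k * `|p x y| ^+ 2) *+ 2); last by rewrite normCK; ring.
  rewrite kE (_ : _ - _ = - (p x x + 2%:R)); last by ring.
  rewrite oppr_ge0 => h; have : (0 : C) < p x x + 2%:R by rewrite ltr_wpDl.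
  by move/lt_le_trans/(_ h); rewrite ltxx.
have y1 : 0 < p y y by rewrite lt_def y0 semidot_ge0.
have := q (p x y / p y y).
have cy : (p y y)^* = p y y by rewrite geC0_conj // ltW.
rewrite (semidotC y x) rmorphM fmorphV /= cy normrM normfV (ger0_norm (ltW y1)).
rewrite (_ : _ + _ = p x x - `|p x y| ^+ 2 / p y y).
  by rewrite subr_ge0 ler_pdivrMr.
by rewrite normCK exprMn normCK; field; apply: y0.
Qed.

End Theory.

Lemma dot_semidot (f : {dot V for Num.conj}) : is_semidot f.
Proof.
split=> [k x y z|x y|x]; first by rewrite linearPl.
  by rewrite (hermC f) expr0 mul1r.
exact: dnorm_ge0.
Qed.

End Semidot.

Section StarAlgebra.
Context {C : numClosedFieldType} {A : starAlgType C}.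
Implicit Types x y : A.

Lemma smul0l y : 0 ** y = 0 :> A. Proof. exact: (linear0l (@smul C A)). Qed.
Lemma smul0r x : x ** 0 = 0 :> A. Proof. exact: (linear0r (@smul C A)). Qed.
Lemma smulNl x y : (- x) ** y = - (x ** y).
Proof. by rewrite -scaleN1r -smulZl scaleN1r. Qed.
Lemma smulNr x y : x ** (- y) = - (x ** y).
Proof. by rewrite -[- y]scaleN1r -smulZr scaleN1r. Qed.
Lemma smulBl x y z : (x - y) ** z = x ** z - y ** z.
Proof. by rewrite smulDl smulNl. Qed.
Lemma smulBr x y z : z ** (x - y) = z ** x - z ** y.
Proof. by rewrite smulDr smulNr. Qed.
Lemma smul_suml I (r : seq I) (P : pred I) (F : I -> A) y :
  (\sum_(i <- r | P i) F i) ** y = \sum_(i <- r | P i) F i ** y.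
Proof. by apply: (big_morph (fun x => x ** y)) => [x z|]; rewrite ?smulDl ?smul0l. Qed.
Lemma smul_sumr I (r : seq I) (P : pred I) (F : I -> A) x :
  x ** (\sum_(i <- r | P i) F i) = \sum_(i <- r | P i) x ** F i.
Proof. by apply: (big_morph (fun y => x ** y)) => [y z|]; rewrite ?smulDr ?smul0r. Qed.
Lemma starN x : star (- x) = - star x.
Proof. by rewrite -scaleN1r starZ rmorphN rmorph1 scaleN1r. Qed.
Lemma starB x y : star (x - y) = star x - star y.
Proof. by rewrite starD starN. Qed.
Lemma star_sum I (r : seq I) (P : pred I) (F : I -> A) :
  star (\sum_(i <- r | P i) F i) = \sum_(i <- r | P i) star (F i).
Proof. by apply: (big_morph star) => [x y|]; rewrite ?starD ?star_zero. Qed.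
End StarAlgebra.

(** One small term is enough, since [e n] always bounds either a fixed quantity or the distance to
    all later terms. *)
Definition vanishing (K : numFieldType) (e : nat -> K) : Prop :=
  forall eps, 0 < eps -> exists n, e n < eps.

Lemma complete_seq (K : numFieldType) (V : completeNormedModType K) (x : nat -> V)
    (e : nat -> K) :
  vanishing e -> (forall n m, (n <= m)%N -> `|x n - x m| <= e n) ->
  exists l, forall n, `|x n - l| <= e n.
Proof.
move=> ve hx.
have cx : cvg (x @ \oo).
  apply: cauchy_cvg; apply: cauchy_exP => eps e0.
  have [n hn] := ve _ e0; exists (x n); exists n => // m /= nm.
  by rewrite -ball_normE /=; apply: le_lt_trans hn; apply: hx.
exists (lim (x @ \oo)) => n.
apply/ler_addgt0Pr => d d0.
have /cvgrPdist_lt/(_ _ d0)[N _ hN] := cx.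
rewrite -[x n](subrK (x (maxn n N))) -addrA (le_trans (ler_normD _ _)) // lerD ?hx ?leq_maxl //.
by rewrite distrC ltW // hN //= leq_maxr.
Qed.

Lemma eq_of_vanishing (K : numFieldType) (V : normedZmodType K) (e : nat -> K)
    (x y : V) (c : K) :
  vanishing e -> (forall n, 0 <= e n) -> 0 <= c -> (forall n, `|x - y| <= e n * c) -> x = y.
Proof.
move=> ve e0 c0 h; apply/eqP; rewrite -subr_eq0 -normr_eq0; apply/eqP/le_anti.
rewrite normr_ge0 andbT; apply/ler_addgt0Pr => d d0; rewrite add0r.
have c1 : 0 < c + 1 by rewrite ltr_wpDl.
have [n hn] := ve (d / (c + 1)) (divr_gt0 d0 c1).
rewrite ltr_pdivlMr // in hn; apply: le_trans (ltW hn); apply: (le_trans (h n)).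
by rewrite ler_wpM2l // lerDl.
Qed.

(** * Completeness over the complex numbers *)

Section ComplexSequences.
Context {R : realType}.
Local Notation C := R[i].

Lemma gtC0_Re (e : C) : 0 < e -> 0 < complex.Re e /\ e = (complex.Re e)%:C%C.
Proof.
by case: e => a b; rewrite ltcE /= => /andP[/eqP -> a0].
Qed.

Lemma half_vanishing : vanishing (fun n => 2%:R ^- n : C).
Proof.
move=> e /gtC0_Re[e0 ->]; have [n hn] : exists n : nat, (complex.Re e)^-1 < n%:R.
  by exists (Num.truncn (complex.Re e)^-1).+1; exact: truncnS_gt.
exists n; rewrite (_ : 2%:R ^- n = (2%:R ^- n : R)%:C%C); last first.
  by rewrite fmorphV rmorphXn /= rmorph_nat.
rewrite ltcR -[X in _ < X]invrK ltf_pV2 ?posrE ?exprn_gt0 ?invr_gt0 //.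
by apply: (lt_le_trans hn); rewrite -natrX ler_nat ltnW // ltn_expl.
Qed.

(** A Cauchy filter contains a ball of radius [2 ^- n.+1] for every [n]. With this shifted index the
    centres from [n] on lie within [2 ^- n] of the [n]-th one, so completeness for sequences with an
    explicit rate suffices. *)
Lemma seq_complete (V : normedModType C) :
  (forall x : nat -> V,
     (forall n m, (n <= m)%N -> `|x n - x m| <= 2%:R ^- n) ->
     exists l, forall eps : C, 0 < eps -> exists N, forall n, (N <= n)%N -> `|x n - l| < eps) ->
  forall F : set_system V, ProperFilter F -> cauchy F -> cvg F.
Proof.
move=> hV F FF /cauchyP cF.
pose h n : C := 2%:R ^- n.
have h0 n : 0 < h n by rewrite invr_gt0 exprn_gt0.
have hS n : h n = h n.+1 + h n.+1.
  by rewrite /h exprS; field; rewrite expf_neq0 // pnatr_eq0.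
have hle n m : (n <= m)%N -> h m <= h n.
  by move=> nm; rewrite lef_pV2 ?posrE ?exprn_gt0 // ler_eXn2l ?ltr1n.
have ex n : exists y, F (ball y (h n)) by apply: cF; exact: h0.
pose x n := projT1 (cid (ex n.+1)).
have xP n : F (ball (x n) (h n.+1)) by rewrite /x; case: cid.
have [n m nm|l hl] := hV x.
  have [z [hn hm]] := filter_ex (filterI (xP n) (xP m)).
  move: hn hm; rewrite -ball_normE /= => hn hm.
  rewrite -[x n](subrK z) -addrA (le_trans (ler_normD _ _)) // -[X in _ <= X]/(h n) hS lerD //.
    exact: ltW.
  by rewrite distrC ltW // (lt_le_trans hm) // hle.
apply/cvg_ex; exists l; apply/cvgrPdist_lt => /= eps e0.
have [n hn] := half_vanishing (divr_gt0 e0 (ltr0n C 4)).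
have [N hN] := hl _ (divr_gt0 e0 (ltr0n C 4)).
pose m := maxn n N; near=> z.
have xz : `|z - x m| < h m.+1.
  near: z; move: (xP m); rewrite -ball_normE /= => /filterS; apply => z /=.
  by rewrite distrC.
rewrite -[l](subrK (x m)) -addrA (le_lt_trans (ler_normD _ _)) //.
rewrite [eps](_ : _ = eps / 4 + (eps / 4 + eps / 2)); last by field.
apply: ltrD; first by rewrite distrC hN // leq_maxr.
rewrite distrC (lt_trans xz) // (le_lt_trans (hle _ _ (leq_trans (leq_maxl n N) (leqnSn m)))) //.
by rewrite (lt_trans hn) // ltrDl divr_gt0.
Unshelve. all: by end_near. Qed.

(** The rate is nonnegative, hence real, and dominates the increments of the real and of the
    imaginary part, to each of which completeness of [R] applies. *)
Lemma complex_seq_complete (c : nat -> C) (e : nat -> C) :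
  vanishing e -> (forall n m, (n <= m)%N -> `|c n - c m| <= e n) ->
  exists l : C, forall eps : C, 0 < eps ->
    exists N, forall n, (N <= n)%N -> `|c n - l| < eps.
Proof.
move=> ve hc.
have e0 n : 0 <= e n by rewrite (le_trans _ (hc n n _)).
have eR n : e n = (complex.Re (e n))%:C%C by rewrite RRe_real // ger0_real.
have vR : vanishing (fun n => complex.Re (e n)).
  move=> eps eps0; have [|n] := ve eps%:C%C; first by rewrite ltcR.
  by rewrite eR ltcR; exists n.
have [n m nm|a ha] := @complete_seq R R^o (fun n => complex.Re (c n)) _ vR.
  rewrite -lecR -eR; apply: le_trans (hc _ _ nm).
  by have := normc_ge_Re (c n - c m); rewrite raddfB.
have [n m nm|b hb] := @complete_seq R R^o (fun n => complex.Im (c n)) _ vR.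
  rewrite -lecR -eR; apply: le_trans (hc _ _ nm).
  have := normc_ge_Re ((c n - c m) * 'i%C).
  by rewrite ReiNIm normrN normrM complexiE normCi mulr1 raddfB.
exists (a +i* b)%C => eps eps0.
have [|N hN] := ve (eps / 4); first by rewrite divr_gt0.
have le_e n : (N <= n)%N -> `|c n - c N| <= eps / 4.
  by move=> Nn; rewrite distrC (le_trans (hc _ _ Nn)) // ltW.
have le_N : `|c N - (a +i* b)%C| <= eps / 4 + eps / 4.
  rewrite [_ - _]complexE (le_trans (ler_normD _ _)) // lerD //.
    rewrite normc_def /= expr0n addr0 sqrtr_sqr (le_trans _ (ltW hN)) // eR lecR.
    by rewrite raddfB ha.
  rewrite normrM complexiE normCi mul1r.
  rewrite normc_def /= expr0n addr0 sqrtr_sqr (le_trans _ (ltW hN)) // eR lecR.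
  by rewrite raddfB hb.
exists N => n /le_e Nn; rewrite -[c n](subrK (c N)) -addrA.
rewrite (le_lt_trans (ler_normD _ _)) // (le_lt_trans (lerD Nn le_N)) //.
rewrite (_ : _ + _ = eps - eps / 4); last by field.
by rewrite gtrBl divr_gt0.
Qed.

Lemma nneg_real (c : C) : 0 <= c -> c = (complex.Re c)%:C%C.
Proof. by move=> c0; rewrite RRe_real // ger0_real. Qed.

(** All terms are comparable with 0 and therefore real, so the supremum is taken in [R]. The defect
    [rho - r n] then is a rate for any sequence whose increments are dominated by those of [r]. *)
Lemma bounded_monotone_rate (r : nat -> C) (q : C) :
  0 <= r 0 -> (forall n, r n <= r n.+1) -> (forall n, r n <= q) ->
  exists rho, (forall n, r n <= rho) /\ vanishing (fun n => rho - r n).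
Proof.
move=> r0 rS rq; have rle n m : (n <= m)%N -> r n <= r m.
  move=> /subnK <-; elim: (m - n)%N => [|k IH]; first by rewrite add0n.
  by rewrite addSn (le_trans IH).
have rR n : r n = (complex.Re (r n))%:C%C by rewrite -nneg_real // (le_trans r0) ?rle.
have qR : q = (complex.Re q)%:C%C by rewrite -nneg_real // (le_trans _ (rq 0)).
have hs : has_sup (range (fun n => complex.Re (r n))).
  split; first by exists (complex.Re (r 0)); exists 0.
  by exists (complex.Re q) => _ [n _ <-]; rewrite -lecR -rR -qR.
exists (sup (range (fun n => complex.Re (r n))))%:C%C; split=> [n|eps /gtC0_Re[e0 ->]].
  by rewrite rR lecR; apply: (sup_upper_bound hs); exists n.
have [_ [n _ <-] hn] := sup_adherent e0 hs; exists n.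
by rewrite rR -raddfB ltcR ltrBlDr addrC -ltrBlDr.
Qed.

End ComplexSequences.

(** * Hilbert spaces from definite semi-inner products *)

Section Spaces.
Context {R : realType}.
Local Notation C := R[i].

Definition is_norm (V : lmodType C) (N : V -> C) : Prop :=
  [/\ forall x y, N (x + y) <= N x + N y, forall k x, N (k *: x) = `|k| * N x
    & forall x, N x = 0 -> x = 0].

Definition seq_complete_for (V : lmodType C) (N : V -> C) : Prop :=
  forall x : nat -> V, (forall n m, (n <= m)%N -> N (x n - x m) <= 2%:R ^- n) ->
  exists l, forall eps, 0 < eps -> exists n0, forall n, (n0 <= n)%N -> N (x n - l) < eps.

Definition nspace (V : lmodType C) (N : V -> C) (hN : is_norm N)
  (cN : seq_complete_for N) : Type := V.

Section NSpace.
Context {V : lmodType C} {N : V -> C} (hN : is_norm N) (cN : seq_complete_for N).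
Local Notation W := (nspace hN cN).
HB.instance Definition _ := GRing.Lmodule.on W.
Let ND (x y : W) : N (x + y) <= N x + N y. Proof. by case: hN. Qed.
Let NZ (k : C) (x : W) : N (k *: (x : W)) = `|k| * N x. Proof. by case: hN. Qed.
Let N0 (x : W) : N x = 0 -> x = 0. Proof. by have [_ _] := hN; apply. Qed.
HB.instance Definition _ := Lmodule_isNormed.Build C W ND NZ N0.
HB.instance Definition _ := Uniform_isComplete.Build W (@seq_complete R W cN).
End NSpace.

Section Hilb.
Context {V : lmodType C} {p : V -> V -> C}.
Hypotheses (hp : is_semidot p) (dp : forall x, p x x = 0 -> x = 0).

Definition dnorm (x : V) : C := sqrtC (p x x).

Lemma dnorm_sq x : dnorm x ^+ 2 = p x x. Proof. exact: sqrtCK. Qed.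

Lemma dnorm_nneg x : 0 <= dnorm x.
Proof. by rewrite sqrtC_ge0 (semidot_ge0 hp). Qed.

Lemma le_dot_dnorm x y : `|p x y| <= dnorm x * dnorm y.
Proof.
rewrite -(@ler_pXn2r _ 2) ?nnegrE ?mulr_ge0 ?dnorm_nneg //.
by rewrite exprMn !dnorm_sq (semidot_CS hp).
Qed.

Lemma dnorm_triangle x y : dnorm (x + y) <= dnorm x + dnorm y.
Proof.
rewrite -(@ler_pXn2r _ 2) ?nnegrE ?addr_ge0 ?dnorm_nneg //.
rewrite sqrrD !dnorm_sq (semidotDl hp) !(semidotDr hp) (semidotC hp y x).
rewrite (_ : _ + _ = p x x + p y y + (p x y + (p x y)^*)); last by ring.
rewrite [leRHS]addrAC lerD2l.
apply: le_trans (_ : `|p x y + (p x y)^*| <= _).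
  by rewrite real_ler_norm // CrealE rmorphD /= conjCK addrC.
by rewrite (le_trans (ler_normD _ _)) // norm_conjC mulr2n lerD // le_dot_dnorm.
Qed.

Lemma dnorm_is_norm : is_norm dnorm.
Proof.
split=> [x y|k x|x]; first exact: dnorm_triangle.
  rewrite /dnorm (semidotZl hp) (semidotZr hp) mulrA -normCK.
  by rewrite rootCMl ?exprn_ge0 // sqrCK.
by move/eqP; rewrite sqrtC_eq0 => /eqP; exact: dp.
Qed.

Definition hilb (cp : seq_complete_for dnorm) : Type := nspace dnorm_is_norm cp.

Section Instance.
Variable cp : seq_complete_for dnorm.
HB.instance Definition _ := CompleteNormedModule.on (hilb cp).
Definition hilb_dot : hilb cp -> hilb cp -> C := p.
Fact hilb_dot_bilinear : bilinear_for
  (GRing.Scale.Law.clone _ _ *%R _)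
  (GRing.Scale.Law.clone _ _ (Num.conj \; *%R) _) hilb_dot.
Proof.
split=> [z|z] k x y; first exact: (semidotPl hp).
exact: (semidotPr hp).
Qed.
HB.instance Definition _ :=
  bilinear_isBilinear.Build C _ _ _ _ _ hilb_dot hilb_dot_bilinear.
Fact hilb_dot_herm (x y : hilb cp) :
  hilb_dot x y = (-1) ^+ false * Num.conj (hilb_dot y x).
Proof. by rewrite expr0 mul1r; exact: (semidotC hp). Qed.
HB.instance Definition _ :=
  isHermitianSesquilinear.Build C _ false Num.conj hilb_dot hilb_dot_herm.
Fact hilb_dot_gt0 (x : hilb cp) : x != 0 -> 0 < hilb_dot x x.
Proof.
move=> x0; rewrite lt_def (semidot_ge0 hp) andbT.
by apply: contra_neq x0; exact: dp.
Qed.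
HB.instance Definition _ := isDotProduct.Build C _ hilb_dot hilb_dot_gt0.
Fact hilb_normE (x : hilb cp) : `|x| ^+ 2 = hilb_dot x x.
Proof. exact: sqrtCK. Qed.
HB.instance Definition _ := isHilbert.Build C (hilb cp) hilb_normE.
End Instance.
End Hilb.
End Spaces.

(** * Bounded operators *)

Section HilbertOperators.
Context {R : realType}.
Local Notation C := R[i].

Section Operators.
Context {H : hilbertType C}.
Implicit Types (x y : H) (S T : bop H).

Lemma hdot_semidot : is_semidot (@hdot C H).
Proof. exact: dot_semidot. Qed.

Lemma hnorm_sq x : `|x| ^+ 2 = hdot x x. Proof. exact: hnormE. Qed.

Lemma hdot_CS x y : `|hdot x y| <= `|x| * `|y|.
Proof.
rewrite -(@ler_pXn2r _ 2) ?nnegrE ?mulr_ge0 //.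
by rewrite exprMn !hnorm_sq (semidot_CS hdot_semidot).
Qed.

Lemma hdot_ext x y : (forall z, hdot x z = hdot y z) -> x = y.
Proof.
move=> h; apply/eqP; rewrite -subr_eq0 -normr_eq0 -sqrf_eq0 hnorm_sq.
by rewrite (semidotBl hdot_semidot) h subrr.
Qed.

Lemma bop_ext S T : op S =1 op T -> S = T.
Proof.
move=> h; apply: adjop_ext => // x; apply: hdot_ext => z.
by rewrite !adj_op h.
Qed.

Lemma opMx S T x : op (S ** T) x = op S (op T x). Proof. by []. Qed.
Lemma opDx S T x : op (S + T) x = op S x + op T x. Proof. by []. Qed.
Lemma opZx k T x : op (k *: T) x = k *: op T x. Proof. by []. Qed.
Lemma op0x x : op (0 : bop H) x = 0. Proof. by []. Qed.
Lemma op1x x : op (uone : bop H) x = x. Proof. by []. Qed.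
Lemma opNx T x : op (- T) x = - op T x.
Proof. by rewrite -scaleN1r opZx scaleN1r. Qed.
Lemma opBx S T x : op (S - T) x = op S x - op T x.
Proof. by rewrite opDx opNx. Qed.
Lemma op_starE T x y : hdot (op (star T) x) y = hdot x (op T y).
Proof. exact: adj_op. Qed.
Lemma op_starEr T x y : hdot (op T x) y = hdot x (op (star T) y).
Proof. exact: op_adj. Qed.

Lemma opPx T k x y : op T (k *: x + y) = k *: op T x + op T y.
Proof. exact: op_linear. Qed.
Lemma opxD T x y : op T (x + y) = op T x + op T y.
Proof. by rewrite -[x]scale1r opPx !scale1r. Qed.
Lemma opx0 T : op T 0 = 0.
Proof. by apply: (addrI (op T 0)); rewrite -opxD !addr0. Qed.
Lemma opxZ T k x : op T (k *: x) = k *: op T x.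
Proof. by rewrite -[k *: x]addr0 opPx opx0 addr0. Qed.
Lemma op_sum (J : Type) (r : seq J) (Q : pred J) (F : J -> bop H) x :
  op (\sum_(i <- r | Q i) F i) x = \sum_(i <- r | Q i) op (F i) x.
Proof. exact: (big_morph (fun T : bop H => op T x)). Qed.

Lemma opx_sum T (J : Type) (r : seq J) (Q : pred J) (F : J -> H) :
  op T (\sum_(i <- r | Q i) F i) = \sum_(i <- r | Q i) op T (F i).
Proof. exact: (linear_sum (mk_linear (op_linear T))). Qed.

Definition opnorm T : C :=
  (sup [set r : R | exists x : H, `|x| <= 1 /\ r%:C%C = `|op T x| ])%:C%C.

Lemma opnorm_has_sup T :
  has_sup [set r : R | exists x : H, `|x| <= 1 /\ r%:C%C = `|op T x| ].
Proof.
split; first by exists 0; exists 0; rewrite normr0 opx0 normr0.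
have [M hM] := op_bounded T.
exists (complex.Re `|M|) => r [x [x1 rE]]; rewrite -lecR rE -nneg_real //.
apply: (le_trans (hM x)).
have [->|x0] := eqVneq `|x| 0; first by rewrite mulr0.
have x_gt0 : 0 < `|x| by rewrite lt_def x0 normr_ge0.
have M0 : 0 <= M by rewrite -(pmulr_lge0 _ x_gt0) (le_trans _ (hM x)).
by rewrite ger0_norm // ler_piMr.
Qed.

Lemma le_opnorm T x : `|op T x| <= opnorm T * `|x|.
Proof.
have [->|x0] := eqVneq x 0; first by rewrite opx0 !normr0 mulr0.
have x_gt0 : 0 < `|x| by rewrite normr_gt0.
pose u := `|x|^-1 *: x.
have u1 : `|u| = 1 by rewrite normrZ normfV normr_id mulVf // gt_eqF.
have -> : `|op T x| = `|op T u| * `|x|.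
  by rewrite opxZ normrZ normfV normr_id mulrAC mulVf ?mul1r // gt_eqF.
rewrite ler_pM2r // [`|op T u|]nneg_real // lecR.
apply: (sup_upper_bound (opnorm_has_sup T)) => /=.
by exists u; rewrite u1 -nneg_real.
Qed.

Lemma opnorm_le T (c : C) : 0 <= c -> (forall x, `|op T x| <= c * `|x|) -> opnorm T <= c.
Proof.
move=> c0 h; rewrite (nneg_real c0) lecR.
apply: ge_sup; first by have [] := opnorm_has_sup T.
move=> r [x [x1 rE]]; rewrite -lecR rE -nneg_real //.
by rewrite (le_trans (h x)) // ler_piMr.
Qed.

Lemma opnorm_ge0 T : 0 <= opnorm T.
Proof.
rewrite ler0c; apply: (sup_upper_bound (opnorm_has_sup T)) => /=.
by exists 0; rewrite normr0 opx0 normr0.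
Qed.

Lemma opnormD S T : opnorm (S + T) <= opnorm S + opnorm T.
Proof.
apply: opnorm_le => [|x]; first by rewrite addr_ge0 ?opnorm_ge0.
by rewrite opDx (le_trans (ler_normD _ _)) // mulrDl lerD ?le_opnorm.
Qed.

Lemma opnormZ k T : opnorm (k *: T) = `|k| * opnorm T.
Proof.
have le k' T' : opnorm (k' *: T') <= `|k'| * opnorm T'.
  apply: opnorm_le => [|x]; first by rewrite mulr_ge0 ?opnorm_ge0.
  by rewrite opZx normrZ -mulrA ler_wpM2l ?le_opnorm.
have [->|k0] := eqVneq k 0.
  rewrite scale0r normr0 mul0r; apply/le_anti; rewrite opnorm_ge0 andbT.
  by apply: opnorm_le => // x; rewrite op0x normr0 mul0r.
apply/le_anti; rewrite le /= -{1}[T]scale1r -(mulVf k0) -scalerA.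
by rewrite -ler_pdivlMl ?normr_gt0 // -normfV le.
Qed.

Lemma opnorm0_eq0 T : opnorm T = 0 -> T = 0.
Proof.
move=> T0; apply: bop_ext => x; apply/eqP; rewrite op0x -normr_eq0.
by have := le_opnorm T x; rewrite T0 mul0r normr_le0 normr_eq0.
Qed.

Lemma opnormM S T : opnorm (S ** T) <= opnorm S * opnorm T.
Proof.
apply: opnorm_le => [|x]; first by rewrite mulr_ge0 ?opnorm_ge0.
by rewrite opMx (le_trans (le_opnorm _ _)) // -mulrA ler_wpM2l ?opnorm_ge0 ?le_opnorm.
Qed.

(** Cauchy-Schwarz applied to [|T x|^2], read as the product of [x] with [star T (T x)], leaves a
    factor [|T x|] to cancel. *)
Lemma opnorm_le_star T : opnorm T <= opnorm (star T).
Proof.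
apply: opnorm_le => [|x]; first exact: opnorm_ge0.
have [->|x0] := eqVneq `|op T x| 0; first by rewrite mulr_ge0 ?opnorm_ge0.
have Tx0 : 0 < `|op T x| by rewrite lt_def x0 normr_ge0.
rewrite -(ler_pM2r Tx0) -expr2 hnorm_sq op_starEr.
rewrite -[leLHS]ger0_norm; last by rewrite -op_starEr -hnorm_sq exprn_ge0.
rewrite (le_trans (hdot_CS _ _)) // mulrAC mulrC ler_wpM2r //.
exact: le_opnorm.
Qed.

Lemma opnorm_star T : opnorm (star T) = opnorm T.
Proof.
apply/le_anti; rewrite (opnorm_le_star T) andbT.
by have := opnorm_le_star (star T); rewrite starK.
Qed.

Lemma opnorm_starM T : opnorm (star T ** T) = opnorm T ^+ 2.
Proof.
apply/le_anti; rewrite (le_trans (opnormM _ _)) ?opnorm_star ?expr2 //=.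
rewrite -expr2 -[leRHS]sqrtCK ler_pXn2r ?nnegrE ?sqrtC_ge0 ?opnorm_ge0 //.
apply: opnorm_le => [|x]; first by rewrite sqrtC_ge0 opnorm_ge0.
rewrite -(@ler_pXn2r _ 2) ?nnegrE ?mulr_ge0 ?sqrtC_ge0 ?opnorm_ge0 //.
rewrite exprMn sqrtCK hnorm_sq op_starEr -opMx.
rewrite -[leLHS]ger0_norm; last by rewrite opMx -op_starEr -hnorm_sq exprn_ge0.
by rewrite (le_trans (hdot_CS _ _)) // mulrC expr2 mulrA ler_wpM2r ?le_opnorm.
Qed.

(* A pointwise limit of operators, uniform on the unit ball, has an adjoint
   because the sequence of adjoints converges at the same rate. *)
Lemma bop_seq_complete (T : nat -> bop H) (e : nat -> C) :
  vanishing e -> (forall n m, (n <= m)%N -> opnorm (T n - T m) <= e n) ->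
  exists L, forall n, opnorm (T n - L) <= e n.
Proof.
move=> ve hT.
have e0 n : 0 <= e n by rewrite (le_trans _ (hT n n _)) // opnorm_ge0.
have ex (F : nat -> bop H) : (forall n m, (n <= m)%N -> opnorm (F n - F m) <= e n) ->
    forall x, exists l, forall n, `|op (F n) x - l| <= e n * `|x|.
  move=> hF x; apply: complete_seq => [eps eps0|n m nm].
    have [n hn] := ve (eps / (`|x| + 1)) (divr_gt0 eps0 (ltr_wpDl (normr_ge0 x) ltr01)).
    exists n; have x1 : 0 < `|x| + 1 by rewrite ltr_wpDl.
    rewrite ltr_pdivlMr // in hn; apply: le_lt_trans hn.
    by rewrite ler_wpM2l // lerDl.
  by rewrite -opBx (le_trans (le_opnorm _ _)) // ler_wpM2r // hF.
have hTs n m : (n <= m)%N -> opnorm (star (T n) - star (T m)) <= e n.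
  move=> nm; rewrite (_ : _ - _ = star (T n - T m)) ?opnorm_star ?hT //.
  by rewrite starB.
pose L x := projT1 (cid (ex T hT x)).
have LP x n : `|op (T n) x - L x| <= e n * `|x| by rewrite /L; case: cid.
pose L' x := projT1 (cid (ex _ hTs x)).
have L'P x n : `|op (star (T n)) x - L' x| <= e n * `|x| by rewrite /L'; case: cid.
have lin (F : nat -> bop H) (L0 : H -> H) :
    (forall x n, `|op (F n) x - L0 x| <= e n * `|x|) -> linear L0.
  move=> hL k x y.
  apply: (@eq_of_vanishing _ _ e _ _ (`|k *: x + y| + (`|k| * `|x| + `|y|))) => // [|n].
    by rewrite !addr_ge0 ?mulr_ge0.
  have -> : L0 (k *: x + y) - (k *: L0 x + L0 y) =
    - (op (F n) (k *: x + y) - L0 (k *: x + y)) +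
    (k *: (op (F n) x - L0 x) + (op (F n) y - L0 y)).
    rewrite opPx scalerBr opprB (addrACA (k *: op (F n) x)) -opprD.
    by rewrite [in RHS]addrA subrK.
  rewrite mulrDr.
  rewrite (le_trans (ler_normD _ _)) // lerD ?normrN ?hL //.
  rewrite (le_trans (ler_normD _ _)) // mulrDr lerD ?hL // normrZ mulrCA.
  by rewrite ler_wpM2l.
have bnd (F : nat -> bop H) (L0 : H -> H) :
    (forall x n, `|op (F n) x - L0 x| <= e n * `|x|) ->
    exists M : C, forall x, `|L0 x| <= M * `|x|.
  move=> hL; exists (opnorm (F 0%N) + e 0%N) => x.
  rewrite -[L0 x](subrK (op (F 0%N) x)) addrC (le_trans (ler_normD _ _)) //.
  by rewrite mulrDl lerD ?le_opnorm // distrC.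
have LL' x y : hdot (L x) y = hdot x (L' y).
  apply: (@eq_of_vanishing _ _ e _ _ (`|x| * `|y| *+ 2)) => // [|n]; first by rewrite mulrn_wge0 ?mulr_ge0.
  rewrite [_ - _](_ : _ = hdot x (op (star (T n)) y - L' y) - hdot (op (T n) x - L x) y).
    rewrite (le_trans (ler_normB _ _)) // mulr2n mulrDr lerD //.
      by rewrite (le_trans (hdot_CS _ _)) // mulrCA ler_wpM2l ?L'P.
    by rewrite (le_trans (hdot_CS _ _)) // mulrA ler_wpM2r ?LP.
  rewrite (semidotBl hdot_semidot) (semidotBr hdot_semidot) op_starEr.
  by ring.
have L'L x y : hdot (L' x) y = hdot x (L y).
  by rewrite (semidotC hdot_semidot) -LL' -(semidotC hdot_semidot).
have LPn x n : `|op (T n) x - L x| <= e n * `|x| by exact: LP.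
exists (Adjop (lin T L LP) (lin _ L' L'P) (bnd T L LP) (bnd _ L' L'P) LL' L'L) => n.
by apply: opnorm_le => // x; rewrite opBx; exact: LP.
Qed.

End Operators.

(** * Commutants as C*-algebras *)

Section Commutant.
Context {H : hilbertType C}.
Variable G : set (bop H).

(** Commutation with [star g] makes the commutant of an arbitrary set [G] closed under adjoints. It
    serves twice: as a target for the universal property and, with [G] empty, to view all of B(H) as
    a C*-algebra. *)
Definition commutant_pred (T : bop H) : bool :=
  `[< forall g, G g -> T ** g = g ** T /\ T ** star g = star g ** T >].

Fact commutant_submod : subsemimod_closed commutant_pred.
Proof.
split; [split|].
- by apply/asboolP => g _; rewrite !smul0l !smul0r.
- move=> S T /asboolP hS /asboolP hT; apply/asboolP => g Gg.
  have [[eS eS'] [eT eT']] := (hS g Gg, hT g Gg).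
  by rewrite !smulDl !smulDr eS eS' eT eT'.
- move=> k T /asboolP hT; apply/asboolP => g Gg; have [e e'] := hT g Gg.
  by rewrite -!smulZl -!smulZr e e'.
Qed.
HB.instance Definition _ :=
  GRing.isSubmodClosed.Build C (bop H) commutant_pred commutant_submod.

Record commutant : Type :=
  Commutant { cmt_val : bop H; cmt_valP : commutant_pred cmt_val }.
HB.instance Definition _ := [isSub for cmt_val].
HB.instance Definition _ := [Choice of commutant by <:].
HB.instance Definition _ := [SubChoice_isSubLmodule of commutant by <:].
Implicit Types S T : commutant.

Lemma cmt_comm T g : G g -> cmt_val T ** g = g ** cmt_val T.
Proof. by case: T => T /= /asboolP h Gg; case: (h g Gg). Qed.
Lemma cmt_comm_star T g : G g -> cmt_val T ** star g = star g ** cmt_val T.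
Proof. by case: T => T /= /asboolP h Gg; case: (h g Gg). Qed.

Fact cmt_mul_subproof S T : commutant_pred (cmt_val S ** cmt_val T).
Proof.
apply/asboolP => g Gg; rewrite -!smulA (cmt_comm T Gg) (cmt_comm_star T Gg).
by rewrite !smulA (cmt_comm S Gg) (cmt_comm_star S Gg).
Qed.
Fact cmt_star_subproof T : commutant_pred (star (cmt_val T)).
Proof.
apply/asboolP => g Gg; split; last by rewrite -!starM (cmt_comm T Gg).
by rewrite -{1 2}[g]starK -!starM (cmt_comm_star T Gg).
Qed.
Fact cmt_one_subproof : commutant_pred uone.
Proof. by apply/asboolP => g _; rewrite !smul1l !smul1r. Qed.

Definition cmt_mul S T := Commutant (cmt_mul_subproof S T).
Definition cmt_star T := Commutant (cmt_star_subproof T).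
Definition cmt_one := Commutant cmt_one_subproof.

Fact cmt_mulA : associative cmt_mul.
Proof. by move=> ? ? ?; apply: val_inj; rewrite /= smulA. Qed.
Fact cmt_mulDl : left_distributive cmt_mul +%R.
Proof. by move=> ? ? ?; apply: val_inj; rewrite /= smulDl. Qed.
Fact cmt_mulDr : right_distributive cmt_mul +%R.
Proof. by move=> ? ? ?; apply: val_inj; rewrite /= smulDr. Qed.
Fact cmt_mulZl (k : C) S T : k *: cmt_mul S T = cmt_mul (k *: S) T.
Proof. by apply: val_inj; rewrite /= smulZl. Qed.
Fact cmt_mulZr (k : C) S T : k *: cmt_mul S T = cmt_mul S (k *: T).
Proof. by apply: val_inj; rewrite /= smulZr. Qed.
Fact cmt_starK : involutive cmt_star.
Proof. by move=> ?; apply: val_inj; rewrite /= starK. Qed.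
Fact cmt_starD : {morph cmt_star : S T / S + T}.
Proof. by move=> ? ?; apply: val_inj; rewrite /= starD. Qed.
Fact cmt_starZ (k : C) T : cmt_star (k *: T) = k^* *: cmt_star T.
Proof. by apply: val_inj; rewrite /= starZ. Qed.
Fact cmt_starM S T : cmt_star (cmt_mul S T) = cmt_mul (cmt_star T) (cmt_star S).
Proof. by apply: val_inj; rewrite /= starM. Qed.
Fact cmt_mul1l : left_id cmt_one cmt_mul.
Proof. by move=> ?; apply: val_inj; rewrite /= smul1l. Qed.
Fact cmt_mul1r : right_id cmt_one cmt_mul.
Proof. by move=> ?; apply: val_inj; rewrite /= smul1r. Qed.

Definition cmt_norm (T : commutant) : C := opnorm (cmt_val T).
Fact cmt_normD S T : cmt_norm (S + T) <= cmt_norm S + cmt_norm T.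
Proof. exact: opnormD. Qed.
Fact cmt_normZ (k : C) T : cmt_norm (k *: T) = `|k| * cmt_norm T.
Proof. exact: opnormZ. Qed.
Fact cmt_norm0_eq0 T : cmt_norm T = 0 -> T = 0.
Proof. by move=> /opnorm0_eq0 h; apply: val_inj. Qed.

HB.instance Definition _ :=
  Lmodule_isNormed.Build C commutant cmt_normD cmt_normZ cmt_norm0_eq0.

Fact cmt_seq_complete : seq_complete_for cmt_norm.
Proof.
move=> T hT; have [|L hL] := @bop_seq_complete H (fun n => cmt_val (T n)) _ _ hT.
  exact: half_vanishing.
have cL g : (forall T : commutant, cmt_val T ** g = g ** cmt_val T) -> L ** g = g ** L.
  move=> Gg; apply/eqP; rewrite -subr_eq0; apply/eqP/opnorm0_eq0.
  apply/le_anti; rewrite opnorm_ge0 andbT; apply/ler_addgt0Pr => d d0; rewrite add0r.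
  have c1 : 0 < opnorm g + opnorm g + 1 by rewrite ltr_wpDl ?addr_ge0 ?opnorm_ge0.
  have [n hn] := half_vanishing (divr_gt0 d0 c1).
  rewrite ltr_pdivlMr // in hn; apply: le_trans (ltW hn).
  (* As each [T n] commutes with [g], the commutator of the limit only involves [T n - L], and its
     norm is at most twice [opnorm g] times the rate. *)
  rewrite (_ : _ - _ = g ** (cmt_val (T n) - L) - (cmt_val (T n) - L) ** g); last first.
    by rewrite smulBl smulBr Gg opprB [RHS]addrC addrA subrK.
  rewrite (le_trans (opnormD _ _)) // -[- (_ ** _)]scaleN1r opnormZ normrN1 mul1r.
  rewrite mulrDr mulr1 mulrDr -addrA lerD // ?(le_trans (opnormM _ _)) //.
    by rewrite mulrC ler_wpM2r ?opnorm_ge0.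
  rewrite ler_wpDr ?invr_ge0 ?exprn_ge0 //.
  by rewrite ler_wpM2r ?opnorm_ge0.
have {}cL : commutant_pred L.
  by apply/asboolP => g Gg; split; apply: cL => S; [exact: cmt_comm|exact: cmt_comm_star].
exists (Commutant cL) => eps eps0.
have [N hN] := half_vanishing eps0; exists N => n Nn.
apply: le_lt_trans (hL n) _; apply: le_lt_trans hN.
by rewrite lef_pV2 ?posrE ?exprn_gt0 // ler_eXn2l ?ltr1n.
Qed.
HB.instance Definition _ := Uniform_isComplete.Build commutant (@seq_complete R commutant cmt_seq_complete).
HB.instance Definition _ := isStarAlg.Build C commutant
  cmt_mulA cmt_mulDl cmt_mulDr cmt_mulZl cmt_mulZr cmt_starK cmt_starD cmt_starZ cmt_starM.
HB.instance Definition _ := hasUnit.Build C commutant cmt_mul1l cmt_mul1r.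

Fact cmt_normM (S T : commutant) : `|S ** T| <= `|S| * `|T|.
Proof. exact: opnormM. Qed.
Fact cmt_norm_star (T : commutant) : `|star T ** T| = `|T| ^+ 2.
Proof. exact: opnorm_starM. Qed.
HB.instance Definition _ := isCstar.Build C commutant cmt_normM cmt_norm_star.

End Commutant.
End HilbertOperators.

(** * Square roots and inverses in C*-algebras *)

Section CstarCalculus.
Context {R : realType}.
Local Notation C := R[i].
Context {A : ucstarType C}.
Implicit Types a b h x y z : A.

(** The C*-identity makes the norm of the unit idempotent; the value 0 remains possible, as the
    algebra may be zero. *)
Lemma norm_uone : `|uone : A| <= 1.
Proof.
have := @norm_star_smul C A uone; rewrite smul1r star_one => e.
have [->|n0] := eqVneq `|uone : A| 0; first exact: ler01.
by move/eqP: e; rewrite expr2 -{1}[`|_|]mulr1 (inj_eq (mulfI n0)) => /eqP <-.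
Qed.

(* The sum of a series sum_k c_k h^k with nonnegative coefficients, approximated by polynomials
   [w n] dominated by the real sequence [r]. *)
Lemma dominated_limit (w : nat -> A) (r : nat -> C) (q : C) :
  0 <= r 0 -> (forall n, r n <= r n.+1) -> (forall n, r n <= q) ->
  (forall n, `|w n.+1 - w n| <= r n.+1 - r n) ->
  exists y e, [/\ vanishing e, forall n, 0 <= e n, forall n, e n.+1 <= e n
    & forall n, `|w n - y| <= e n].
Proof.
move=> r0 rS rq wr; have [rho [hr ve]] := bounded_monotone_rate r0 rS rq.
have wm n m : (n <= m)%N -> `|w n - w m| <= r m - r n.
  move=> /subnK <-; elim: (m - n)%N => [|k IH]; first by rewrite add0n !subrr normr0.
  rewrite addSn -[w n](subrK (w (k + n)%N)) -addrA (le_trans (ler_normD _ _)) //.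
  rewrite (_ : r _ - r n = (r (k + n)%N - r n) + (r (k + n).+1 - r (k + n)%N)); last by ring.
  by rewrite lerD // distrC.
have [n m nm|y hy] := @complete_seq _ A w (fun n => rho - r n) ve.
  by rewrite (le_trans (wm _ _ nm)) // lerD2r.
by exists y, (fun n => rho - r n); split=> // n; rewrite ?subr_ge0 ?lerD2l ?lerN2.
Qed.

Lemma limit_commutes (w : nat -> A) (e : nat -> C) y a :
  vanishing e -> (forall n, 0 <= e n) -> (forall n, `|w n - y| <= e n) ->
  (forall n, a ** w n = w n ** a) -> a ** y = y ** a.
Proof.
move=> ve e0 hy aw.
apply: (@eq_of_vanishing _ _ e _ _ (`|a| *+ 2)) => // [|n]; first by rewrite mulrn_wge0.
rewrite (_ : _ - _ = (w n - y) ** a - a ** (w n - y)); last first.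
  by rewrite smulBl smulBr aw opprB [RHS]addrC addrA subrK.
rewrite (le_trans (ler_normB _ _)) // mulr2n mulrDr lerD //.
  by rewrite (le_trans (norm_smul _ _)) // ler_wpM2r.
by rewrite (le_trans (norm_smul _ _)) // mulrC ler_wpM2r.
Qed.

Lemma limit_star (w : nat -> A) (e : nat -> C) y :
  vanishing e -> (forall n, 0 <= e n) -> (forall n, `|w n - y| <= e n) ->
  (forall n, star (w n) = w n) -> star y = y.
Proof.
move=> ve e0 hy sw.
apply: (@eq_of_vanishing _ _ e _ _ 2%:R) => // n.
rewrite (_ : _ - _ = (w n - y) - star (w n - y)); last first.
  by rewrite starB sw opprB [RHS]addrC addrA subrK.
by rewrite (le_trans (ler_normB _ _)) // norm_star mulr_natr mulr2n lerD.
Qed.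

Lemma limit_norm (w : nat -> A) (e : nat -> C) y (c : C) :
  vanishing e -> (forall n, `|w n - y| <= e n) -> (forall n, `|w n| <= c) -> `|y| <= c.
Proof.
move=> ve hy hc; apply/ler_addgt0Pr => d /ve[n hn].
rewrite -[y](subrK (w n)) addrC (le_trans (ler_normD _ _)) // lerD //.
by rewrite distrC ltW // (le_lt_trans (hy n)).
Qed.

(** A fixed point [y] satisfies [2 y = h + y^2], that is [(1 - y)^2 = 1 - h]. The same iteration on
    the number [|h|] dominates the iterates and their increments, and it stays below [|h|] when
    [|h| <= 1]. *)
Fixpoint sqrt_iter h n : A :=
  if n is n'.+1 then 2^-1 *: (h + sqrt_iter h n' ** sqrt_iter h n') else 0.
Fixpoint sqrt_rate (q : C) n : C :=
  if n is n'.+1 then 2^-1 * (q + sqrt_rate q n' ^+ 2) else 0.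

Lemma sqrt_rateP (q : C) n : 0 <= q <= 1 ->
  [/\ 0 <= sqrt_rate q n, sqrt_rate q n <= q & sqrt_rate q n <= sqrt_rate q n.+1].
Proof.
move=> /andP[q0 q1].
have h2 : (0 : C) <= 2^-1 by rewrite invr_ge0.
have B m : 0 <= sqrt_rate q m <= q.
  elim: m => [|m /andP[r0 rq]]; first by rewrite /= lexx.
  rewrite /= mulr_ge0 ?addr_ge0 ?exprn_ge0 //=.
  rewrite mulrC ler_pdivrMr // mulr_natr mulr2n lerD2l.
  by rewrite expr2 (le_trans (ler_pM _ _ rq (le_trans rq q1))) ?mulr1.
have /andP[-> ->] := B n; split=> //.
elim: n => [|n IH]; first by rewrite /= mulr_ge0 ?addr_ge0 ?exprn_ge0.
rewrite [leRHS]/= [leLHS]/= ler_wpM2l // lerD2l ler_pXn2r ?nnegrE //.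
  by have /andP[] := B n.
by have /andP[] := B n.+1.
Qed.

(** The extra conclusions are used later: [|y| <= |h|] makes [1 - y] invertible when [|h| < 1], and
    the commutation clause puts square roots in the bicommutant. *)
Lemma cstar_sqrt h : star h = h -> `|h| <= 1 ->
  exists y, [/\ star y = y, `|y| <= `|h|, (uone - y) ** (uone - y) = uone - h
    & forall a, a ** h = h ** a -> a ** y = y ** a].
Proof.
move=> sh h1; set q := `|h|; have q01 : 0 <= q <= 1 by rewrite normr_ge0.
pose w := sqrt_iter h; pose r := sqrt_rate q.
have wE n : w n.+1 = 2^-1 *: (h + w n ** w n) by [].
have rE n : r n.+1 = 2^-1 * (q + r n ^+ 2) by [].
have hr n := sqrt_rateP n q01.
have r0 n : 0 <= r n by case: (hr n).
have rS n : r n <= r n.+1 by case: (hr n).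
have rq n : r n <= q by case: (hr n).
have h2 : (0 : C) < 2^-1 by rewrite invr_gt0.
have wr n : `|w n| <= r n.
  elim: n => [|n IH]; first by rewrite normr0.
  rewrite wE rE normrZ gtr0_norm // ler_wpM2l ?(ltW h2) // (le_trans (ler_normD _ _)) //.
  by rewrite lerD2l (le_trans (norm_smul _ _)) // expr2 ler_pM.
have wd n : `|w n.+1 - w n| <= r n.+1 - r n.
  elim: n => [|n IH]; first by rewrite wE rE !subr0 smul0l addr0 expr0n addr0 normrZ gtr0_norm.
  (* The difference of squares [u^2 - v^2 = u (u - v) + (u - v) v] holds without commutativity. *)
  have -> : w n.+2 - w n.+1 =
      2^-1 *: (w n.+1 ** (w n.+1 - w n) + (w n.+1 - w n) ** w n).
    rewrite (wE n.+1) {2}(wE n) -scalerBr; congr (_ *: _).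
    rewrite smulBl smulBr addrA subrK opprD addrACA subrr add0r.
    by [].
  have -> : r n.+2 - r n.+1 = 2^-1 * (r n.+1 * (r n.+1 - r n) + (r n.+1 - r n) * r n).
    by rewrite (rE n.+1) {2}(rE n); ring.
  rewrite normrZ gtr0_norm // ler_wpM2l ?(ltW h2) // (le_trans (ler_normD _ _)) // lerD //.
    by rewrite (le_trans (norm_smul _ _)) // ler_pM.
  by rewrite (le_trans (norm_smul _ _)) // ler_pM.
have [y [e [ve e0 eS hy]]] := dominated_limit (r0 0) rS rq wd.
have w_q n : `|w n| <= q by rewrite (le_trans (wr n)).
have yq : `|y| <= q by exact: limit_norm ve hy w_q.
exists y; split=> //.
- apply: limit_star ve e0 hy _; elim=> [|n IH]; first exact: star_zero.
  by rewrite wE starZ starD sh starM IH (geC0_conj (ltW h2)).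
- suff e2 : 2%:R *: y = h + y ** y.
    rewrite smulBl smul1l smulBr smul1r -addrA -opprD; congr (_ - _).
    by rewrite addrA -mulr2n -scaler_nat e2 addrK.
  apply: (@eq_of_vanishing _ _ e _ _ 4%:R) => // n.
  rewrite (_ : _ - _ = - (2%:R *: (w n.+1 - y)) + (w n ** (w n - y) + (w n - y) ** y)).
    rewrite (_ : 4%:R = 2%:R + (1 + 1)) ?(mulrDr (e n) 2%:R); last by ring.
    rewrite (le_trans (ler_normD _ _)) // normrN normrZ lerD //.
      by rewrite ger0_norm // mulrC ler_wpM2r // (le_trans (hy _)).
    have [q0 q1] := andP q01.
    rewrite mulrDr mulr1 (le_trans (ler_normD _ _)) // lerD //.
      rewrite (le_trans (norm_smul _ _)) // -[leRHS]mul1r ler_pM //.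
      by rewrite (le_trans (w_q n)).
    by rewrite (le_trans (norm_smul _ _)) // -[leRHS]mulr1 ler_pM // (le_trans yq).
  have -> : w n ** (w n - y) + (w n - y) ** y = w n ** w n - y ** y.
    by rewrite smulBl smulBr addrA subrK.
  have -> : 2%:R *: (w n.+1 - y) = (h + w n ** w n) - 2%:R *: y.
    by rewrite scalerBr wE scalerA mulfV ?scale1r // pnatr_eq0.
  by rewrite [in RHS]opprB -[RHS]addrA; congr (_ + _); rewrite !opprD addrA subrK.
- by move=> a ah; apply: limit_commutes ve e0 hy _; elim=> [|n IH];
    rewrite ?wE ?smul0l ?smul0r // -smulZl -smulZr smulDl smulDr ah -smulA -IH !smulA IH.
Qed.

Fixpoint inv_iter y n : A := if n is n'.+1 then uone + y ** inv_iter y n' else 0.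
Fixpoint inv_rate (q : C) n : C := if n is n'.+1 then 1 + q * inv_rate q n' else 0.

Lemma cstar_inv y : `|y| < 1 ->
  exists z, [/\ (uone - y) ** z = uone, z ** (uone - y) = uone
    & forall a, a ** y = y ** a -> a ** z = z ** a].
Proof.
move=> y1; set q := `|y|; have q1 : 0 < 1 - q by rewrite subr_gt0.
have q0 : 0 <= q by exact: normr_ge0.
pose w := inv_iter y; pose r := inv_rate q.
have wE n : w n.+1 = uone + y ** w n by [].
have rE n : r n.+1 = 1 + q * r n by [].
have rS n : 0 <= r n <= r n.+1.
  elim: n => [|n /andP[IH IH']]; first by rewrite rE mulr0 addr0 ler01 lexx.
  apply/andP; split; first by rewrite rE addr_ge0 ?mulr_ge0.
  by rewrite (rE n.+1) {1}(rE n) lerD2l ler_wpM2l.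
have rq n : r n <= (1 - q)^-1.
  elim: n => [|n IH]; first by rewrite invr_ge0 ltW.
  rewrite (_ : (1 - q)^-1 = 1 + q * (1 - q)^-1); first by rewrite rE lerD2l ler_wpM2l.
  by field; rewrite gt_eqF.
have wd n : `|w n.+1 - w n| <= r n.+1 - r n.
  elim: n => [|n IH]; first by rewrite wE rE smul0r addr0 !subr0 mulr0 addr0 norm_uone.
  have -> : w n.+2 - w n.+1 = y ** (w n.+1 - w n).
    by rewrite smulBr (wE n.+1) {2}(wE n) opprD addrACA subrr add0r.
  have -> : r n.+2 - r n.+1 = q * (r n.+1 - r n) by rewrite (rE n.+1) {2}(rE n); ring.
  by rewrite (le_trans (norm_smul _ _)) // ler_wpM2l.
have r0 : 0 <= r 0 by rewrite /r /=.
have rS' n : r n <= r n.+1 by case/andP: (rS n).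
have [z [e [ve e0 eS hz]]] := dominated_limit r0 rS' rq wd.
have wc a n : a ** y = y ** a -> a ** w n = w n ** a.
  move=> ay; elim: n => [|n IH]; first by rewrite smul0l smul0r.
  by rewrite wE smulDl smulDr smul1l smul1r smulA ay -!smulA IH.
have zc a : a ** y = y ** a -> a ** z = z ** a.
  by move=> ay; apply: limit_commutes ve e0 hz _ => n; exact: wc.
have yz : (uone - y) ** z = uone.
  rewrite smulBl smul1l; apply: (@eq_of_vanishing _ _ e _ _ 2%:R) => // n.
  rewrite (_ : _ - _ = y ** (w n - z) - (w n.+1 - z)).
    rewrite mulr_natr mulr2n (le_trans (ler_normB _ _)) // lerD //; last first.
      exact: (le_trans (hz _)).
    rewrite (le_trans (norm_smul _ _)) // -[leRHS]mul1r ler_pM // ltW //.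
  rewrite smulBr wE opprB (addrC uone) opprD addrA addrA; congr (_ - _).
  by rewrite (addrC (_ - _) z) addrA [RHS]addrAC addrK.
exists z; split=> //; have := zc y erefl.
by rewrite smulBr smul1r => <-; rewrite -{1}[z]smul1l -smulBl.
Qed.

(** For [a] nonzero, [star a ** a] divided by [|a|^2] has norm one, so [1] minus it has a square
    root, which is rescaled by [|a|]. This is the order inequality between [star a ** a] and
    [|a|^2], in Gram form. *)
Lemma cstar_norm_sq a : exists b, star b ** b = `|a| ^+ 2 *: uone - star a ** a.
Proof.
have [a0|a0] := eqVneq (`|a|) 0.
  move/eqP: a0; rewrite normr_eq0 => /eqP ->; exists 0.
  by rewrite !smul0r normr0 expr0n scale0r subrr.
have aa0 : 0 < `|a| ^+ 2 by rewrite exprn_gt0 // lt_def a0 normr_ge0.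
have cr : ((`|a| ^+ 2)^-1)^* = (`|a| ^+ 2)^-1 by rewrite geC0_conj // invr_ge0 ltW.
have [||y [sy _ yE _]] := @cstar_sqrt ((`|a| ^+ 2)^-1 *: (star a ** a)).
- by rewrite starZ starM starK cr.
- by rewrite normrZ norm_star_smul normfV normrX normr_id mulVf // gt_eqF.
exists (`|a| *: (uone - y)).
rewrite starZ geC0_conj // starB sy star_one -smulZl -smulZr scalerA -expr2 yE.
by rewrite scalerBr scalerA mulfV ?scale1r // gt_eqF.
Qed.

End CstarCalculus.

(** * Finite-dimensional C*-algebras *)

Section OrthonormalBasis.
Context {C : numClosedFieldType} {V : lmodType C} {p : V -> V -> C}.
Hypotheses (hp : is_semidot p) (dp : forall x, p x x = 0 -> x = 0).

Definition orthonormal_seq (s : seq V) : Prop :=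
  uniq s /\ {in s &, forall x y, p x y = (x == y)%:R}.

Let proj (s : seq V) x := \sum_(b <- s) p x b *: b.

Let projP s k x y : proj s (k *: x + y) = k *: proj s x + proj s y.
Proof.
rewrite /proj scaler_sumr -big_split /=; apply: eq_bigr => b _.
by rewrite (semidotPl hp) scalerDl scalerA.
Qed.

Let dot_suml (s : seq V) F x : p (\sum_(b <- s) F b) x = \sum_(b <- s) p (F b) x.
Proof.
elim: s => [|b s IH]; first by rewrite !big_nil (semidot0l hp).
by rewrite !big_cons (semidotDl hp) IH.
Qed.

Lemma gram_schmidt (e : seq V) :
  exists s, orthonormal_seq s /\ {in e, forall x, x = \sum_(b <- s) p x b *: b}.
Proof.
elim: e => [|v e [s [os hs]]]; first by exists [::]; split; last by [].
pose r := v - proj s v.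
have rs b : b \in s -> p r b = 0.
  move=> bs; rewrite /r (semidotBl hp) dot_suml.
  rewrite -[X in X - _](_ : \sum_(c <- s) p v c * p c b = _).
    by apply/eqP; rewrite subr_eq0; apply/eqP/eq_bigr => c _; rewrite (semidotZl hp).
  have [us os'] := os.
  rewrite (big_rem b) //= (os' b b) // eqxx mulr1 big_seq big1 ?addr0 // => c cs.
  rewrite (os' c b) ?(mem_rem cs) //; case: eqP cs => [->|_ _]; last by rewrite mulr0.
  by rewrite mem_rem_uniq // inE eqxx.
have [r0|r0] := eqVneq r 0.
  exists s; split=> // x; rewrite inE => /orP[/eqP ->|/hs //].
  by apply/eqP; rewrite -subr_eq0 -/(proj s v) -/r r0.
have rr : 0 < p r r.
  rewrite lt_def (semidot_ge0 hp) andbT; apply: contra_neq r0; exact: dp.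
pose n := sqrtC (p r r); have n0 : 0 < n by rewrite sqrtC_gt0.
have nn : n^* = n by rewrite geC0_conj // ltW.
pose u := n^-1 *: r.
have uu : p u u = 1.
  rewrite /u (semidotZl hp) (semidotZr hp) fmorphV /= nn mulrA -invfM -expr2 sqrtCK.
  by rewrite mulVf // gt_eqF.
have us b : b \in s -> p u b = 0.
  by move=> bs; rewrite /u (semidotZl hp) rs // mulr0.
have su b : b \in s -> p b u = 0 by move=> bs; rewrite (semidotC hp) us ?conjC0.
have uNs : u \notin s.
  by apply/negP => /us; rewrite uu => /eqP; rewrite oner_eq0.
have [us' os'] := os.
exists (u :: s); split.
  split=> [|x y]; first by rewrite /= uNs.
  rewrite !inE => /orP[/eqP ->|xs] /orP[/eqP ->|ys].
  - by rewrite eqxx.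
  - by rewrite us //; case: eqP ys uNs => // -> ->.
  - by rewrite su //; case: eqP xs uNs => // -> ->.
  - exact: os'.
move=> x; rewrite inE big_cons => /orP[/eqP ->|xe].
  have vE : v = n *: u + proj s v by rewrite /u scalerA mulfV ?gt_eqF // scale1r /r subrK.
  rewrite -/(proj s v); suff -> : p v u = n by [].
  rewrite vE (semidotDl hp) (semidotZl hp) uu mulr1 dot_suml big_seq big1 ?addr0 // => b bs.
  by rewrite (semidotZl hp) su ?mulr0.
rewrite [X in _ + X](_ : _ = x); last by rewrite -hs.
rewrite {2}(hs x xe) dot_suml big_seq big1 ?scale0r ?add0r // => b bs.
by rewrite (semidotZl hp) su ?mulr0.
Qed.

Lemma orthonormal_basis n (e : 'I_n -> V) (w : 'I_n -> {scalar V}) :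
  (forall x, x = \sum_i w i x *: e i) ->
  exists N (b : 'I_N -> V), (forall i j, p (b i) (b j) = (i == j)%:R) /\
    forall x, x = \sum_i p x (b i) *: b i.
Proof.
move=> ew; have [s [[us os] hs]] := gram_schmidt [seq e i | i : 'I_n].
exists (size s), (fun i => s`_i); split=> [i j|x].
  by rewrite os ?mem_nth // nth_uniq.
rewrite -(big_mkord xpredT (fun i => p x s`_i *: s`_i)) -(big_nth 0 xpredT (fun b => p x b *: b)).
rewrite -/(proj s x) (ew x).
elim: (index_enum _) => [|i l IH]; rewrite ?big_nil ?big_cons.
  by rewrite /proj big1 // => b _; rewrite (semidot0l hp) scale0r.
rewrite projP -IH; congr (_ *: _ + _).
by apply: hs; apply/mapP; exists i; rewrite ?mem_enum.
Qed.

End OrthonormalBasis.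

(** * Traces of matrices with real spectrum *)

Section Spectrum.
Context {C : numClosedFieldType}.

Lemma char_poly_roots n (M : 'M[C]_n) :
  exists s : seq C, char_poly M = \prod_(z <- s) ('X - z%:P) /\ \tr M = \sum_(z <- s) z.
Proof.
have [s sE] := closed_field_poly_normal (char_poly M).
rewrite (monicP (char_poly_monic M)) scale1r in sE; exists s; split=> //.
case: n M sE => [|n] M sE.
  rewrite /mxtrace big_ord0; move: (congr1 (fun q : {poly C} => size q) sE).
  by rewrite size_char_poly size_prod_XsubC => -[] /esym/size0nil ->; rewrite big_nil.
have ss : size s = n.+1.
  by move: (congr1 (fun q : {poly C} => size q) sE); rewrite size_char_poly size_prod_XsubC => -[].
apply: oppr_inj; rewrite -char_poly_trace // sE.
by rewrite -coefPn_prod_XsubC ss.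
Qed.

Lemma real_spectrum_trace n (M : 'M[C]_n) :
  (forall a, eigenvalue M a -> a \is Num.real) -> \tr M \is Num.real.
Proof.
move=> h; have [s [sE ->]] := char_poly_roots M.
rewrite big_seq; apply: rpred_sum => z zs; apply: h.
by rewrite eigenvalue_root_char sE root_prod_XsubC.
Qed.

(** If [k^2] is an eigenvalue of [M *m M], then factoring through [M - k] and [M + k] shows that [k]
    or [- k] is one of [M], hence real. A vanishing sum of such squares leaves only zero roots, and
    Cayley-Hamilton gives nilpotency; iterating on row vectors states it also for [n = 0], where
    matrices form no ring with a nonzero unit. *)
Lemma real_spectrum_trace_sq n (M : 'M[C]_n) :
  (forall a, eigenvalue M a -> a \is Num.real) ->
  0 <= \tr (M *m M) /\ (\tr (M *m M) = 0 -> exists k, forall v : 'rV_n,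
    iter k (fun u => u *m (M *m M)) v = 0).
Proof.
move=> h; have [s [sE ->]] := char_poly_roots (M *m M).
have s0 z : z \in s -> 0 <= z.
  move=> zs; have : eigenvalue (M *m M) z.
    by rewrite eigenvalue_root_char sE root_prod_XsubC.
  move=> /eigenvalueP[v vM v0]; pose k := sqrtC z.
  have e : (v *m (M - k%:M)) *m (M + k%:M) = 0.
    rewrite mulmxBr mulmxDr !mulmxBl -mulmxA vM !mul_mx_scalar -scalemxAl scalerA -expr2.
    by rewrite sqrtCK addrA subrK subrr.
  have [w0|w0] := eqVneq (v *m (M - k%:M)) 0.
    have /h : eigenvalue M k.
      apply/eigenvalueP; exists v => //; apply/eqP; rewrite -subr_eq0 -[k *: v]mul_mx_scalar.
      by rewrite -mulmxBr w0.
    by move=> kr; rewrite -(sqrtCK z) real_exprn_even_ge0.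
  have /h : eigenvalue M (- k).
    apply/eigenvalueP; exists (v *m (M - k%:M)) => //; apply/eqP; rewrite -subr_eq0 scaleNr opprK.
    by rewrite -[k *: _]mul_mx_scalar -mulmxDr e.
  by rewrite realN => kr; rewrite -(sqrtCK z) real_exprn_even_ge0.
split; first by rewrite big_seq sumr_ge0.
move=> /eqP; rewrite big_seq psumr_eq0 // => /allP s00.
have sX : char_poly (M *m M) = 'X^(size s).
  rewrite sE (eq_big_seq (fun=> 'X)) ?big_const_seq ?count_predT ?iter_mulr_1 //.
  by move=> z zs; move: (s00 z zs); rewrite zs => /eqP ->; rewrite subr0.
exists (size s) => v.
case: n M v {h sE} sX => [|n] M v sX; first by rewrite thinmx0.
suff -> k : iter k (fun u => u *m (M *m M)) v = v *m (M * M) ^+ k.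
  have := Cayley_Hamilton (M *m M); rewrite sX rmorphXn /= horner_mx_X => ->.
  by rewrite mulmx0.
elim: k => [|k IH]; first by rewrite mulmx1.
by rewrite iterS IH exprSr -!mulmxE !mulmxA.
Qed.
End Spectrum.

(** * The trace of the left regular representation *)

Section RegularTrace.
Context {R : realType}.
Local Notation C := R[i].
Context {A : ucstarType C} (n : nat) (f : A -> 'rV[C]_n) (g : 'rV[C]_n -> A).
Hypotheses (lf : linear f) (fK : cancel f g) (gK : cancel g f).
Implicit Types x y a : A.

Let F : {linear A -> 'rV[C]_n} := mk_linear lf.
Let FE x : f x = F x. Proof. by []. Qed.
Let lg : linear g.
Proof. by move=> k u v; apply: (can_inj fK); rewrite gK lf !gK. Qed.
Let G : {linear 'rV[C]_n -> A} := mk_linear lg.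
Let GE v : g v = G v. Proof. by []. Qed.

Definition left_mx x : 'M[C]_n := \matrix_(i, j) f (x ** g (delta_mx 0 i)) 0 j.

Lemma left_mxP x v : v *m left_mx x = f (x ** g v).
Proof.
rewrite {2}(row_sum_delta v) GE linear_sum smul_sumr FE linear_sum.
rewrite mulmx_sum_row; apply: eq_bigr => i _.
rewrite linearZ -smulZr linearZ; congr (_ *: _).
by apply/rowP => j; rewrite !mxE.
Qed.

Lemma left_mxM x y : left_mx (x ** y) = left_mx y *m left_mx x.
Proof.
apply/row_matrixP => i; rewrite !rowE mulmxA !left_mxP fK smulA.
by [].
Qed.

Definition rtrace x : C := \tr (left_mx x).

Lemma rtrace_scalar : scalar rtrace.
Proof.
move=> k x y; rewrite /rtrace -mxtraceZ -mxtraceD; congr (\tr _).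
apply/row_matrixP => i; rewrite !rowE mulmxDr -scalemxAr !left_mxP.
by rewrite smulDl -smulZl lf.
Qed.

Lemma rtraceC x y : rtrace (x ** y) = rtrace (y ** x).
Proof. by rewrite /rtrace !left_mxM mxtrace_mulC. Qed.

(** If [a ** y = l *: y], then [star y ** a ** y] equals both [l] and the conjugate of [l] times
    [star y ** y], which is nonzero by the C*-identity. *)
Lemma left_mx_real a : star a = a -> forall l, eigenvalue (left_mx a) l -> l \is Num.real.
Proof.
move=> sa l /eigenvalueP[v]; rewrite left_mxP => vE v0.
pose y := g v; have yE : a ** y = l *: y.
  by apply: (can_inj fK); rewrite vE [RHS]FE linearZ -FE gK.
have y0 : y != 0.
  by apply: contra_neq v0 => y0; rewrite -(gK v) -/y y0 FE linear0.
have e : l^* *: (star y ** y) = l *: (star y ** y).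
  have ya : star y ** a = l^* *: star y by rewrite -[a]sa -starM yE starZ.
  by rewrite [RHS]smulZr -yE smulA ya smulZl.
have yy0 : star y ** y != 0 by rewrite -normr_eq0 norm_star_smul expf_eq0 normr_eq0.
by rewrite CrealE -subr_eq0; have /eqP := e; rewrite -subr_eq0 -scalerBl scaler_eq0 (negPf yy0) orbF.
Qed.

(** Trace zero makes left multiplication by [a ** a] nilpotent, so an even power of [a] vanishes.
    The C*-identity then removes one factor at a time: [a ** (a ** x) = 0] forces [a ** x = 0]. *)
Lemma rtrace_sq a : star a = a -> 0 <= rtrace (a ** a) /\ (rtrace (a ** a) = 0 -> a = 0).
Proof.
move=> sa; have [t0 tN] := real_spectrum_trace_sq (left_mx_real sa).
rewrite /rtrace left_mxM; split=> // /tN[k hk].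
have nil m : iter m (fun u => u *m (left_mx a *m left_mx a)) (f (uone)) =
    f (iter m (fun x => a ** (a ** x)) uone).
  by elim: m => [//|m IH]; rewrite !iterS IH mulmxA !left_mxP !fK.
have {nil hk}: iter k (fun x => a ** (a ** x)) uone = 0.
  by apply: (can_inj fK); rewrite -nil hk FE linear0.
have sq0 x : star x ** x = 0 -> x = 0.
  by move=> /(congr1 Num.norm) /eqP; rewrite norm_star_smul normr0 expf_eq0 normr_eq0 => /eqP.
have step x : a ** (a ** x) = 0 -> a ** x = 0.
  move=> e; apply: sq0.
  by rewrite starM sa -smulA e smul0r.
elim: k => [|k IH]; first by move=> /= u0; rewrite -[a]smul1r u0 smul0r.
move=> /step; case: k IH => [_ /=|k IH /step]; last exact: IH.
by rewrite smul1r.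
Qed.

Lemma cartesian x : exists a b, [/\ star a = a, star b = b & x = a + 'i *: b].
Proof.
have h2 : (2^-1)^* = 2^-1 :> C by rewrite geC0_conj // invr_ge0.
have i2 : 'i * (- 'i * 2^-1) = 2^-1 :> C by rewrite mulrA mulrN -expr2 sqrCi opprK mul1r.
exists (2^-1 *: (x + star x)), ((- 'i * 2^-1) *: (x - star x)); split.
- by rewrite starZ h2 starD starK addrC.
- rewrite starZ rmorphM rmorphN /= conjCi h2 opprK starB starK.
  by rewrite [in RHS]mulNr [RHS]scaleNr -[RHS]scalerN opprB.
- rewrite scalerA i2 -scalerDr addrACA subrr addr0 -mulr2n -(scaler_nat 2 x) scalerA.
  by rewrite mulVf ?scale1r // pnatr_eq0.
Qed.

Lemma rtrace_star x : rtrace (star x) = (rtrace x)^*.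
Proof.
have [a [b [sa sb ->]]] := cartesian x.
have rr c : star c = c -> (rtrace c)^* = rtrace c.
  by move=> sc; apply/eqP; rewrite -CrealE; apply: real_spectrum_trace; exact: left_mx_real.
have rP k u v : rtrace (u + k *: v) = rtrace u + k * rtrace v.
  by rewrite addrC rtrace_scalar addrC.
by rewrite starD starZ sa sb conjCi !rP rmorphD rmorphM /= conjCi !rr.
Qed.

(** With [x = a + 'i *: b] and [a], [b] self-adjoint, [star x ** x] is [a ** a + b ** b] up to a
    multiple of the commutator of [a] and [b], which the trace annihilates. *)
Lemma rtrace_pos x : 0 <= rtrace (star x ** x) /\ (rtrace (star x ** x) = 0 -> x = 0).
Proof.
have [a [b [sa sb xE]]] := cartesian x.
have [a0 aN] := rtrace_sq sa; have [b0 bN] := rtrace_sq sb.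
have rP k u v : rtrace (k *: u + v) = k * rtrace u + rtrace v by exact: rtrace_scalar.
have e : rtrace (star x ** x) = rtrace (a ** a) + rtrace (b ** b).
  have rT u : rtrace u = mk_scalar rtrace_scalar u by [].
  rewrite xE starD starZ sa sb conjCi scaleNr smulBl !smulDr -!smulZl -!smulZr.
  rewrite scalerA -expr2 sqrCi scaleN1r rT linearB !linearD linearN !linearZ /=.
  by rewrite (rtraceC b a) -['i *: _]/('i * _); ring.
split; first by rewrite e addr_ge0.
move=> /eqP; rewrite e paddr_eq0 // => /andP[/eqP /aN a00 /eqP /bN b00].
by rewrite xE a00 b00 scaler0 addr0.
Qed.
End RegularTrace.

(* [j a b] are the matrix coefficients of the left regular representation in a basis [b]
   orthonormal for the trace of that representation, and [c = star b]; the identity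
   sum_i b_i b_i^* = 1, which makes (c a)^* (c b) play the role of the matrix unit E_ab
   in [coordE], is where the choice of the trace matters. *)
Record coordinates (C : numClosedFieldType) (A : finQSpace C) (N : nat)
    (j : 'I_N -> 'I_N -> {scalar A}) (c : 'I_N -> A) : Prop := Coordinates {
  coord_gt0 : (0 < N)%N;
  coord1 : forall a b, j a b uone = (a == b)%:R;
  coordM : forall a b x y, j a b (x ** y) = \sum_k j a k x * j k b y;
  coord_star : forall a b x, j a b (star x) = (j b a x)^*;
  coordE : forall x, x = \sum_a \sum_b j a b x *: (star (c a) ** c b)
}.

Lemma findim_coordinates (R : realType) (P : finQSpace R[i]) :
  exists N (j : 'I_N -> 'I_N -> {scalar P}) (c : 'I_N -> P), coordinates j c.
Proof.
have [n [[f lf [g fK gK]]]] := fq_findim P.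
pose T := mk_scalar (rtrace_scalar lf fK gK).
pose p x y : R[i] := T (star y ** x).
have TE x : T x = rtrace f g x by [].
have hp : is_semidot p.
  split=> [k x y z|x y|x]; rewrite /p.
  - by rewrite smulDr -smulZr linearP.
  - by rewrite !TE -(rtrace_star lf fK gK) starM starK.
  - by rewrite TE; case: (rtrace_pos lf fK gK x).
have dp x : p x x = 0 -> x = 0 by rewrite /p TE; case: (rtrace_pos lf fK gK x).
have [m [e [w ew]]] := findim_basis P.
have [N [b [ob hb]]] := orthonormal_basis hp dp ew.
have js i k : scalar (fun x => p (x ** b k) (b i)).
  by move=> l x y; rewrite smulDl -smulZl (semidotPl hp).
exists N, (fun i k => mk_scalar (js i k)), (fun i => star (b i)).
have expand x : x = \sum_i p x (b i) *: b i by exact: hb.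
have sumT (I : Type) (r : seq I) (Q : pred I) (F : I -> P) y :
    p (\sum_(i <- r | Q i) F i) y = \sum_(i <- r | Q i) p (F i) y.
  apply: (big_morph (fun x => p x y)) => [u v|]; first exact: (semidotDl hp).
  exact: (semidot0l hp).
split=> [|i k|i k x y|i k x|x].
- rewrite lt0n; apply/negP => /eqP N0; move/eqP: (fq_nonzero P); apply.
  by rewrite [LHS]expand; apply: big1 => -[i hi] _; exfalso; move: hi; rewrite N0.
- by rewrite /= smul1l ob eq_sym.
- rewrite /= -smulA {1}(expand (y ** b k)) smul_sumr sumT.
  by apply: eq_bigr => l _; rewrite -smulZr (semidotZl hp) mulrC.
- by rewrite /= -(semidotC hp) /p starM smulA.
(* For the trace of the left regular representation, [T y] is the sum of the diagonal coefficients
   [p (y ** b i) (b i)], and by traciality this is [T (y ** \sum_i b i ** star (b i))]. Hence [d] is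
   orthogonal to everything, in particular to itself. *)
have sum_b : \sum_i b i ** star (b i) = uone.
  apply/eqP; rewrite -subr_eq0; apply/eqP; set d := _ - _.
  apply: dp; rewrite /p /d smulBr smul1r linearB smul_sumr linear_sum /=.
  apply/eqP; rewrite subr_eq0; apply/eqP; set y := star _.
  have traceE : rtrace f g y = \sum_i p (y ** b i) (b i).
    rewrite /rtrace /mxtrace.
    have fE v : f v = \sum_l p v (b l) *: f (b l).
      have Fl u : f u = mk_linear lf u by [].
      rewrite {1}(expand v) Fl linear_sum; apply: eq_bigr => l _.
      by rewrite linearZ.
    under eq_bigr do rewrite mxE fE summxE.
    rewrite exchange_big; apply: eq_bigr => l _ /=.
    have bE : b l = \sum_i f (b l) 0 i *: g (delta_mx 0 i).
      apply: (can_inj fK).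
      have Fl u : f u = mk_linear lf u by [].
      rewrite [RHS]Fl linear_sum /= [LHS]row_sum_delta; apply: eq_bigr => i _.
      by rewrite [RHS]Fl linearZ /= gK.
    rewrite [X in _ = p (y ** X) _]bE smul_sumr sumT; apply: eq_bigr => i _.
    by rewrite -smulZr (semidotZl hp) !mxE mulrC.
  rewrite traceE; apply: eq_bigr => i _.
  by rewrite smulA rtraceC.
(* For fixed [k] the sum over the first index rebuilds [x ** b k]; what remains is [x] times the sum
   of the [b k ** star (b k)]. *)
rewrite exchange_big /=.
under eq_bigr => k _.
  rewrite (eq_bigr (fun i => (p (x ** b k) (b i) *: b i) ** star (b k))); last first.
    by move=> i _; rewrite /= starK smulZl.
  rewrite -smul_suml -expand -smulA; over.
by rewrite -smul_sumr sum_b smul1r.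
Qed.

(** * Slices and legs *)

Lemma slicel_one (C : numClosedFieldType) (P A : ustarAlgType C) (w : {scalar P}) :
  slicel w (uone : tensor P A) = w uone *: uone.
Proof. exact: slicel_pair. Qed.

Section TensorCoordinates.
Context {C : numClosedFieldType} {P : finQSpace C} {N : nat}.
Context {j : 'I_N -> 'I_N -> {scalar P}} {c : 'I_N -> P}.
Hypothesis jc : coordinates j c.

Definition unit_elt (a b : 'I_N) : P := star (c a) ** c b.
Local Notation E := unit_elt.

Lemma slicel_tmap (V W : lmodType C) (L : {linear V -> W}) (w : {scalar P}) (y : tensor P V) :
  slicel w (tmap idfun L y) = L (slicel w y).
Proof.
move: y; apply: tensor_ind => [|p v|x y hx hy]; first by rewrite !linear0.
  by rewrite tmap_pair !slicel_pair linearZ.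
by rewrite !linearD /= hx hy.
Qed.

Lemma tensor_expand (V : lmodType C) (y : tensor P V) :
  y = \sum_a \sum_b E a b \ot slicel (j a b) y.
Proof.
move: y; apply: tensor_ind => [|p v|x y hx hy].
- by rewrite big1 // => a _; rewrite big1 // => b _; rewrite linear0 linear0r.
- rewrite {1}(coordE jc p) linear_sumlz; apply: eq_bigr => a _.
  rewrite linear_sumlz; apply: eq_bigr => b _.
  by rewrite slicel_pair linearZr_LR linearZl_LR.
- rewrite {1}hx {1}hy -big_split; apply: eq_bigr => a _ /=.
  by rewrite -big_split; apply: eq_bigr => b _ /=; rewrite linearD linearDr.
Qed.

Lemma tensor_slice_ext (V : lmodType C) (y z : tensor P V) :
  (forall a b, slicel (j a b) y = slicel (j a b) z) -> y = z.
Proof.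
move=> h; rewrite [y]tensor_expand [z]tensor_expand.
by apply: eq_bigr => a _; apply: eq_bigr => b _; rewrite h.
Qed.

Section StarAlg.
Context {B : starAlgType C}.
Implicit Types y z : tensor P B.

Lemma slicelM a b y z :
  slicel (j a b) (y ** z) = \sum_k slicel (j a k) y ** slicel (j k b) z.
Proof.
move: y; apply: tensor_ind => [|p s|x y hx hy].
- by rewrite smul0l linear0 big1 // => k _; rewrite linear0 smul0l.
- move: z; apply: tensor_ind => [|q t|x y hx hy].
  + by rewrite smul0r linear0 big1 // => k _; rewrite linear0 smul0r.
  + rewrite tensorM slicel_pair (coordM jc) scaler_suml; apply: eq_bigr => k _.
    by rewrite !slicel_pair -smulZl -smulZr scalerA.
  + by rewrite smulDr linearD /= hx hy -big_split; apply: eq_bigr => k _ /=; rewrite linearD smulDr.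
- by rewrite smulDl linearD /= hx hy -big_split; apply: eq_bigr => k _ /=; rewrite linearD smulDl.
Qed.

Lemma slicel_star a b y : slicel (j a b) (star y) = star (slicel (j b a) y).
Proof.
move: y; apply: tensor_ind => [|p s|x y hx hy].
- by rewrite star_zero !linear0 star_zero.
- by rewrite tensor_star !slicel_pair (coord_star jc) starZ.
- by rewrite starD !linearD /= hx hy starD.
Qed.

Lemma slicelMr (w : {scalar P}) y (g : B) :
  slicel w (y ** (uone \ot g)) = slicel w y ** g.
Proof.
move: y; apply: tensor_ind => [|p s|x y hx hy].
- by rewrite smul0l !linear0 smul0l.
- by rewrite tensorM !slicel_pair smul1r -smulZl.
- by rewrite smulDl !linearD /= hx hy smulDl.
Qed.

Lemma slicelMl (w : {scalar P}) y (g : B) :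
  slicel w ((uone \ot g) ** y) = g ** slicel w y.
Proof.
move: y; apply: tensor_ind => [|p s|x y hx hy].
- by rewrite smul0r !linear0 smul0r.
- by rewrite tensorM !slicel_pair smul1l -smulZr.
- by rewrite smulDr !linearD /= hx hy smulDr.
Qed.

Lemma tensor_leg13 (x : P) (s : B) : leg13 (x \ot s) = (x \ot uone) \ot s.
Proof. exact: tmap_pair. Qed.
Lemma tensor_leg23 (x : P) (s : B) : leg23 (x \ot s) = (uone \ot x) \ot s.
Proof. exact: tmap_pair. Qed.

Fact leg13_linear : linear (@leg13 C P B).
Proof. by move=> k x y; rewrite /leg13 linearP. Qed.
Fact leg23_linear : linear (@leg23 C P B).
Proof. by move=> k x y; rewrite /leg23 linearP. Qed.
HB.instance Definition _ := GRing.isLinear.Build C _ _ _ (@leg13 C P B) leg13_linear.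
HB.instance Definition _ := GRing.isLinear.Build C _ _ _ (@leg23 C P B) leg23_linear.

Lemma leg_mul_expand y z : leg13 y ** leg23 z =
  \sum_a \sum_b \sum_a' \sum_b'
     (E a b \ot E a' b') \ot (slicel (j a b) y ** slicel (j a' b') z).
Proof.
rewrite {1}(tensor_expand y) linear_sum smul_suml; apply: eq_bigr => a _.
rewrite linear_sum smul_suml; apply: eq_bigr => b _.
rewrite {1}(tensor_expand z) linear_sum smul_sumr; apply: eq_bigr => a' _.
rewrite linear_sum smul_sumr; apply: eq_bigr => b' _.
by rewrite /= tensor_leg13 tensor_leg23 !tensorM smul1l smul1r.
Qed.

Lemma leg_mul_expandr y z : leg23 z ** leg13 y =
  \sum_a \sum_b \sum_a' \sum_b'
     (E a b \ot E a' b') \ot (slicel (j a' b') z ** slicel (j a b) y).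
Proof.
rewrite {1}(tensor_expand y) linear_sum smul_sumr; apply: eq_bigr => a _.
rewrite linear_sum smul_sumr; apply: eq_bigr => b _.
rewrite {1}(tensor_expand z) linear_sum smul_suml; apply: eq_bigr => a' _.
rewrite linear_sum smul_suml; apply: eq_bigr => b' _.
by rewrite /= tensor_leg13 tensor_leg23 !tensorM smul1l smul1r.
Qed.

Lemma leg_commute y z :
  (forall a b a' b', slicel (j a b) y ** slicel (j a' b') z =
                     slicel (j a' b') z ** slicel (j a b) y) ->
  leg13 y ** leg23 z = leg23 z ** leg13 y.
Proof.
move=> h; rewrite leg_mul_expand leg_mul_expandr; do 4!(apply: eq_bigr => ? _).
by rewrite h.
Qed.

Let slice2 (w w' : {scalar P}) (x : tensor (tensor P P) B) : B :=
  slicel w' (tmap (slicel w) idfun x).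

(** Slicing the first leg by [w] and the second by [w'] turns the two products into the products of
    slices, in either order. *)
Lemma leg_commute_slices y z (w w' : {scalar P}) :
  leg13 y ** leg23 z = leg23 z ** leg13 y ->
  slicel w y ** slicel w' z = slicel w' z ** slicel w y.
Proof.
have s2D (x x' : tensor (tensor P P) B) : slice2 w w' (x + x') = slice2 w w' x + slice2 w w' x'.
  by rewrite /slice2 !linearD.
have s20 : slice2 w w' 0 = 0 by rewrite /slice2 !linear0.
have s2p p q s : slice2 w w' ((p \ot q) \ot s) = (w p * w' q) *: s.
  by rewrite /slice2 tmap_pair /= slicel_pair slicel_pair linearZ.
have e1 : slice2 w w' (leg13 y ** leg23 z) = slicel w y ** slicel w' z.
  move: y; apply: tensor_ind => [|p s|x x' hx hx'].
  - by rewrite !linear0 /= !smul0l s20.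
  - move: z; apply: tensor_ind => [|q t|x x' hx hx'].
    + by rewrite !linear0 /= !smul0r s20.
    + rewrite /= tensor_leg13 tensor_leg23 !tensorM smul1l smul1r s2p !slicel_pair.
      by rewrite -smulZl -smulZr scalerA.
    + by rewrite !linearD /= !smulDr s2D hx hx'.
  - by rewrite !linearD /= !smulDl s2D hx hx'.
have e2 : slice2 w w' (leg23 z ** leg13 y) = slicel w' z ** slicel w y.
  move: y {e1}; apply: tensor_ind => [|p s|x x' hx hx'].
  - by rewrite !linear0 /= !smul0r s20.
  - move: z; apply: tensor_ind => [|q t|x x' hx hx'].
    + by rewrite !linear0 /= !smul0l s20.
    + rewrite /= tensor_leg13 tensor_leg23 !tensorM smul1l smul1r s2p !slicel_pair.
      by rewrite -smulZl -smulZr scalerA mulrC.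
    + by rewrite !linearD /= !smulDl s2D hx hx'.
  - by rewrite !linearD /= !smulDr s2D hx hx'.
by move=> e; rewrite -e1 e e2.
Qed.

Lemma slicer_leg_mul (om : {scalar B}) y z : slicer om (leg13 y ** leg23 z) =
  \sum_a \sum_b \sum_a' \sum_b'
     om (slicel (j a b) y ** slicel (j a' b') z) *: (E a b \ot E a' b').
Proof.
rewrite leg_mul_expand !linear_sum; apply: eq_bigr => a _.
rewrite linear_sum; apply: eq_bigr => b _; rewrite linear_sum; apply: eq_bigr => a' _.
by rewrite linear_sum; apply: eq_bigr => b' _; rewrite /= slicer_pair.
Qed.
End StarAlg.

Lemma slicer_tinter (V : lmodType C) (om : {scalar tensor V V}) (y z : tensor P V) :
  slicer om (tinter y z) =
  \sum_a \sum_b \sum_a' \sum_b'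
     om (slicel (j a b) y \ot slicel (j a' b') z) *: (E a b \ot E a' b').
Proof.
rewrite {1}(tensor_expand y) linear_sumlz linear_sum; apply: eq_bigr => a _.
rewrite linear_sumlz linear_sum; apply: eq_bigr => b _.
rewrite {1}(tensor_expand z) linear_sumr linear_sum; apply: eq_bigr => a' _.
rewrite linear_sumr linear_sum; apply: eq_bigr => b' _.
by rewrite /= tinter_pair slicer_pair.
Qed.

Lemma tmap_unital (O A B : ustarAlgType C) (f : {linear O -> tensor P A}) (k : {linear A -> B}) :
  f uone = uone -> k uone = uone ->
  exists F : {linear O -> tensor P B}, F uone = uone /\
    forall w x, slicel w (F x) = k (slicel w (f x)).
Proof.
move=> f1 k1; pose F : {linear O -> tensor P B} := tmap idfun k \o f.
have FE w x : slicel w (F x) = k (slicel w (f x)) by exact: slicel_tmap.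
clearbody F; exists F; split=> //; apply: tensor_slice_ext => a b.
by rewrite FE f1 !slicel_one linearZ /= k1.
Qed.

Lemma starhom_tmap (O A B : ustarAlgType C) (f : {linear O -> tensor P A}) (k : {linear A -> B}) :
  is_starhom f -> is_starhom k ->
  exists F : {linear O -> tensor P B}, is_starhom F /\
    forall w x, slicel w (F x) = k (slicel w (f x)).
Proof.
move=> [f1 fM fs] [k1 kM ks]; have [F [F1 FE]] := tmap_unital f1 k1.
exists F; split=> //; split=> [//|x y|x]; apply: tensor_slice_ext => a b.
- rewrite FE fM !slicelM linear_sum; apply: eq_bigr => l _.
  by rewrite /= kM !FE.
- by rewrite FE fs !slicel_star ks FE.
Qed.

End TensorCoordinates.

(** * Hilbert space sums *)

Section HilbertSum.
Context {R : realType}.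
Local Notation C := R[i].
Variables (H : hilbertType C) (I : finType).
Local Notation V := {ffun I -> H}.

Definition sum_dot (F G : V) : C := \sum_i hdot (F i) (G i).

Lemma sum_dot_semidot : is_semidot sum_dot.
Proof.
have hs := @hdot_semidot R H.
split=> [k F G K|F G|F]; rewrite /sum_dot.
- rewrite mulr_sumr -big_split /=; apply: eq_bigr => i _.
  by rewrite !ffunE (semidotPl hs).
- by rewrite rmorph_sum; apply: eq_bigr => i _; exact: (semidotC hs).
- by apply: sumr_ge0 => i _; exact: (semidot_ge0 hs).
Qed.

Lemma sum_dot_definite F : sum_dot F F = 0 -> F = 0.
Proof.
move/eqP; rewrite psumr_eq0 => [/allP h|i _]; last by rewrite -hnorm_sq exprn_ge0.
apply/ffunP => i; rewrite ffunE; apply/eqP; rewrite -normr_eq0 -sqrf_eq0 hnorm_sq.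
by have := h i (mem_index_enum i); rewrite implyTb.
Qed.

Lemma norm_comp_le (F : V) i : `|F i| <= dnorm (p := sum_dot) F.
Proof.
rewrite -(@ler_pXn2r _ 2) ?nnegrE ?(dnorm_nneg sum_dot_semidot) //.
rewrite dnorm_sq hnorm_sq /sum_dot (bigD1 i) //= lerDl.
by apply: sumr_ge0 => k _; rewrite -hnorm_sq exprn_ge0.
Qed.

Lemma dnorm_le_sum (F : V) : dnorm (p := sum_dot) F <= \sum_i `|F i|.
Proof.
rewrite -(@ler_pXn2r _ 2) ?nnegrE ?(dnorm_nneg sum_dot_semidot) ?sumr_ge0 //.
rewrite dnorm_sq /sum_dot expr2 mulr_suml; apply: ler_sum => i _.
rewrite -hnorm_sq expr2 ler_wpM2l // (bigD1 i) //= lerDl.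
by apply: sumr_ge0.
Qed.

Lemma sum_dot_complete : seq_complete_for (dnorm (p := sum_dot)).
Proof.
move=> F hF.
have ex i : exists l : H, forall n, `|F n i - l| <= 2%:R ^- n.
  apply: complete_seq => [|n m nm]; first exact: half_vanishing.
  apply: le_trans (hF n m nm); apply: le_trans (norm_comp_le _ i).
  by rewrite !ffunE.
pose L : V := [ffun i => projT1 (cid (ex i))].
have LP i n : `|F n i - L i| <= 2%:R ^- n by rewrite ffunE; case: cid.
exists L => eps e0; have I0 : 0 < #|I|%:R + 1 :> C by rewrite ltr_wpDl.
have [N hN] := half_vanishing (divr_gt0 e0 I0); exists N => n Nn.
rewrite ltr_pdivlMr // in hN; apply: le_lt_trans hN.
apply: le_trans (dnorm_le_sum _) _.
apply: le_trans (_ : \sum_(i : I) 2%:R ^- N <= _).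
  apply: ler_sum => i _; rewrite [X in `|X|]ffunE [X in _ + X]ffunE.
  apply: le_trans (LP i n) _.
  by rewrite lef_pV2 ?posrE ?exprn_gt0 // ler_eXn2l ?ltr1n.
by rewrite sumr_const -[leLHS]mulr_natr mulrDr mulr1 lerDl invr_ge0 exprn_ge0.
Qed.

Definition hsum : hilbertType C :=
  hilb sum_dot_semidot sum_dot_definite sum_dot_complete.

Definition inj_at (i : I) (x : H) : hsum := [ffun k => if k == i then x else 0] : V.
Definition at_ (i : I) (F : hsum) : H := (F : V) i.

Lemma hsum_dotE (F G : hsum) : hdot F G = \sum_i hdot (at_ i F) (at_ i G).
Proof. by []. Qed.
Lemma at_inj i k x : at_ k (inj_at i x) = if k == i then x else 0.
Proof. by rewrite /at_ ffunE. Qed.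
Lemma at_linear i : linear (at_ i).
Proof. by move=> k F G; rewrite /at_ !ffunE. Qed.
Lemma inj_at_linear i : linear (inj_at i).
Proof.
move=> k x y; apply/ffunP => l; rewrite !ffunE; case: eqP => // _.
by rewrite scaler0 addr0.
Qed.
Lemma hsum_ext (F G : hsum) : (forall i, at_ i F = at_ i G) -> F = G.
Proof. by move=> h; apply/ffunP => i; exact: h. Qed.
Lemma at_sum (J : Type) (r : seq J) (Q : pred J) (F : J -> hsum) i :
  at_ i (\sum_(l <- r | Q l) F l) = \sum_(l <- r | Q l) at_ i (F l).
Proof. exact: (linear_sum (mk_linear (at_linear i))). Qed.

Lemma dot_inj_l i x F : hdot (inj_at i x) F = hdot x (at_ i F).
Proof.
rewrite hsum_dotE (bigD1 i) //= at_inj eqxx big1 ?addr0 // => k /negPf ki.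
by rewrite at_inj ki linear0l.
Qed.
Lemma dot_inj_r i x F : hdot F (inj_at i x) = hdot (at_ i F) x.
Proof.
rewrite hsum_dotE (bigD1 i) //= at_inj eqxx big1 ?addr0 // => k /negPf ki.
by rewrite at_inj ki linear0r.
Qed.
Lemma norm_inj i x : `|inj_at i x| = `|x|.
Proof.
apply/eqP; rewrite -(@eqrXn2 _ 2) // !hnorm_sq dot_inj_l at_inj eqxx.
by [].
Qed.
Lemma norm_at_le i F : `|at_ i F| <= `|F|. Proof. exact: norm_comp_le. Qed.

Section Unit.
Variables (i k : I) (T : bop H).
Let fop F := inj_at i (op T (at_ k F)).
Let fadj F := inj_at k (adj T (at_ i F)).
Let bnd (l l' : I) (S : bop H) : linear (fun F => inj_at l (op S (at_ l' F))) /\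
   exists M : C, forall F, `|inj_at l (op S (at_ l' F))| <= M * `|F|.
Proof.
split; first by move=> a F G; rewrite at_linear opPx inj_at_linear.
exists (opnorm S) => F; rewrite norm_inj (le_trans (le_opnorm _ _)) //.
by rewrite ler_wpM2l ?opnorm_ge0 ?norm_at_le.
Qed.
Let adj1 F G : hdot (fop F) G = hdot F (fadj G).
Proof. by rewrite dot_inj_l dot_inj_r op_adj. Qed.
Let adj2 F G : hdot (fadj F) G = hdot F (fop G).
Proof. by rewrite dot_inj_l dot_inj_r adj_op. Qed.

Definition block : bop hsum :=
  Adjop (proj1 (bnd i k T)) (proj1 (bnd k i (star T)))
        (proj2 (bnd i k T)) (proj2 (bnd k i (star T))) adj1 adj2.
End Unit.

Lemma blockE i k T F : op (block i k T) F = inj_at i (op T (at_ k F)).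
Proof. by []. Qed.

Fact block_linear i k : linear (block i k).
Proof.
by move=> a S T; apply: bop_ext => F; exact: inj_at_linear.
Qed.
HB.instance Definition _ i k := GRing.isLinear.Build C (bop H) (bop hsum) _ (block i k) (block_linear i k).

Lemma block_star i k T : star (block i k T) = block k i (star T).
Proof. exact: bop_ext. Qed.

Lemma blockM i k k' l S T : block i k S ** block k' l T = if k == k' then block i l (S ** T) else 0.
Proof.
apply: bop_ext => F; rewrite opMx !blockE at_inj; case: eqP => // _.
by rewrite opx0 op0x; apply/ffunP => m; rewrite !ffunE if_same.
Qed.

Lemma block_sum1 : \sum_i block i i uone = uone.
Proof.
apply: bop_ext => F.
rewrite op_sum; apply: hsum_ext => i; rewrite at_sum (bigD1 i) //= at_inj eqxx big1 ?addr0 //.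
by move=> k ki; rewrite at_inj eq_sym (negPf ki).
Qed.

Definition diag (T : bop H) : bop hsum := \sum_i block i i T.
Fact diag_linear : linear diag.
Proof.
move=> a S T; rewrite /diag scaler_sumr -big_split; apply: eq_bigr => i _.
exact: linearP.
Qed.
HB.instance Definition _ := GRing.isLinear.Build C (bop H) (bop hsum) _ diag diag_linear.

Lemma diag_block T i k S : diag T ** block i k S = block i k (T ** S).
Proof.
rewrite /diag smul_suml (bigD1 i) //= blockM eqxx big1 ?addr0 // => l /negPf li.
by rewrite blockM li.
Qed.
Lemma block_diag T i k S : block i k S ** diag T = block i k (S ** T).
Proof.
rewrite /diag smul_sumr (bigD1 k) //= blockM eqxx big1 ?addr0 // => l /negPf li.
by rewrite blockM eq_sym li.
Qed.
Lemma diagM S T : diag (S ** T) = diag S ** diag T.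
Proof.
rewrite {2}/diag smul_suml; apply: eq_bigr => i _.
by rewrite block_diag.
Qed.
Lemma diag_star T : diag (star T) = star (diag T).
Proof. by rewrite /diag star_sum; apply: eq_bigr => i _; rewrite block_star. Qed.
Lemma diag_inj T i x : op (diag T) (inj_at i x) = inj_at i (op T x).
Proof.
apply: hsum_ext => l.
rewrite /diag op_sum at_sum (bigD1 i) //= !at_inj eqxx big1 ?addr0 // => k ki.
by rewrite !at_inj (negPf ki) opx0 if_same.
Qed.

End HilbertSum.

(** * Positive operators *)

Section PositiveOperators.
Context {R : realType}.
Local Notation C := R[i].

Section SquareRoot.
Context {H : hilbertType C}.
Implicit Types (x y : H) (S T : bop H).

Lemma op_form_semidot T : star T = T -> (forall x, 0 <= hdot (op T x) x) ->
  is_semidot (fun x y => hdot (op T x) y).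
Proof.
move=> sT T0; split=> [k x y z|x y|//].
- by rewrite opPx (semidotPl hdot_semidot).
- by rewrite -(semidotC hdot_semidot) -op_starE sT.
Qed.

(** Cauchy-Schwarz for the form of [T], at [x] and [T x], bounds [|T x|^4] by the product of the
    forms at these two vectors, hence by [q^2 |x|^2 |T x|^2]. *)
Lemma form_opnorm_le T (q : C) : star T = T -> 0 <= q ->
  (forall x, 0 <= hdot (op T x) x <= q * `|x| ^+ 2) -> opnorm T <= q.
Proof.
move=> sT q0 hT; apply: opnorm_le => // x.
have T0 y : 0 <= hdot (op T y) y by case/andP: (hT y).
have [->|Tx0] := eqVneq `|op T x| 0; first by rewrite mulr_ge0.
have Tx : 0 < `|op T x| by rewrite lt_def Tx0 normr_ge0.
rewrite -(@ler_pXn2r _ 2) ?nnegrE ?mulr_ge0 //.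
have := semidot_CS (op_form_semidot sT T0) x (op T x).
rewrite -hnorm_sq ger0_norm ?exprn_ge0 // => h.
rewrite -(ler_pM2r (exprn_gt0 2 Tx)) -expr2 (le_trans h) //.
have /andP[_ h1] := hT x; have /andP[_ h2] := hT (op T x).
apply: le_trans (ler_pM (T0 _) (T0 _) h1 h2) _.
by rewrite exprMn expr2 mulrACA !mulrA.
Qed.

Let C0 : set (bop H) := set0.
Let in0 T : commutant_pred C0 T. Proof. by apply/asboolP. Qed.
Let lift T : commutant C0 := Commutant (in0 T).

Lemma bop_sqrt_near T : star T = T -> opnorm (uone - T) <= 1 ->
  exists Z, [/\ star Z = Z, Z ** Z = T, opnorm (uone - Z) <= opnorm (uone - T)
    & forall S, S ** T = T ** S -> S ** Z = Z ** S].
Proof.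
move=> sT T1; have [||y [sy ny yE yc]] := @cstar_sqrt _ (commutant C0) (lift (uone - T)).
- by apply: val_inj; rewrite /= starB sT star_one.
- exact: T1.
have e k : uone - (uone - k) = k :> bop H by rewrite opprB addrC subrK.
exists (uone - cmt_val y); split.
- by rewrite starB star_one; have /(congr1 (@cmt_val R H C0)) /= -> := sy.
- by have /(congr1 (@cmt_val R H C0)) /= := yE; rewrite e.
- by rewrite e.
- move=> S ST; rewrite smulBr smulBl smul1l smul1r.
  have /(congr1 (@cmt_val R H C0)) /= -> // : lift S ** y = y ** lift S.
  by apply: yc; apply: val_inj; rewrite /= smulBr smulBl smul1l smul1r ST.
Qed.

Lemma normalized_form T (c : C) x : 0 < c ->
  hdot (op (uone - c^-1 *: T) x) x = `|x| ^+ 2 - c^-1 * hdot (op T x) x.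
Proof.
by move=> c0; rewrite opBx opZx op1x (semidotBl hdot_semidot) (semidotZl hdot_semidot) -hnorm_sq.
Qed.

Lemma op_form_le T x : (forall x, 0 <= hdot (op T x) x) -> hdot (op T x) x <= opnorm T * `|x| ^+ 2.
Proof.
move=> T0; rewrite -[leLHS]ger0_norm // (le_trans (hdot_CS _ _)) // expr2 mulrA.
by rewrite ler_wpM2r // le_opnorm.
Qed.

Lemma bop_sqrt T : star T = T -> (forall x, 0 <= hdot (op T x) x) ->
  exists Z, [/\ star Z = Z, Z ** Z = T & forall S, S ** T = T ** S -> S ** Z = Z ** S].
Proof.
move=> sT T0; set c := opnorm T.
have [c0|c0] := eqVneq c 0.
  exists 0; rewrite star_zero smul0l (opnorm0_eq0 c0); split=> // S.
have cp : 0 < c by rewrite lt_def c0 opnorm_ge0.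
have ci : (c^-1)^* = c^-1 by rewrite geC0_conj // invr_ge0 ltW.
have [||Z [sZ ZZ _ cZ]] := @bop_sqrt_near (c^-1 *: T).
- by rewrite starZ ci sT.
(* The form of [T] lies between 0 and [c |x|^2], hence that of [1 - T / c] between 0 and [|x|^2]. *)
- apply: form_opnorm_le => [||x]; rewrite ?ler01 //.
    by rewrite starB starZ ci sT star_one.
  rewrite normalized_form // mul1r gerBl mulr_ge0 ?invr_ge0 ?(ltW cp) // andbT.
  by rewrite subr_ge0 mulrC ler_pdivrMr // mulrC op_form_le.
exists (sqrtC c *: Z); split.
- by rewrite starZ sZ geC0_conj // sqrtC_ge0 ltW.
- by rewrite -smulZl -smulZr scalerA -expr2 sqrtCK ZZ scalerA mulfV // scale1r.
- by move=> S ST; rewrite -smulZr -smulZl cZ // -smulZr -smulZl ST.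
Qed.

(** The lower bound gives [|1 - T / c| <= 1 - eps / c < 1], so the root of [T / c] is at distance
    less than one from the identity and a Neumann series inverts it. *)
Lemma bop_inv_sqrt T (eps : C) : star T = T -> 0 < eps ->
  (forall x, eps * `|x| ^+ 2 <= hdot (op T x) x) ->
  exists Z W, [/\ star Z = Z /\ star W = W, Z ** Z = T, Z ** W = uone /\ W ** Z = uone
    & forall S, S ** T = T ** S -> S ** Z = Z ** S /\ S ** W = W ** S].
Proof.
move=> sT e0 hT; have T0 x : 0 <= hdot (op T x) x.
  by rewrite (le_trans _ (hT x)) // mulr_ge0 ?exprn_ge0 // ltW.
(* Adding [eps] keeps [c] positive, and at least [eps], even if [T] has norm zero. *)
set c := opnorm T + eps; have cp : 0 < c by rewrite ltr_wpDl ?opnorm_ge0.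
have ci : (c^-1)^* = c^-1 by rewrite geC0_conj // invr_ge0 ltW.
have ce : 0 <= 1 - eps / c by rewrite subr_ge0 ler_pdivrMr // mul1r lerDr opnorm_ge0.
have n1 : opnorm (uone - c^-1 *: T) <= 1 - eps / c.
  apply: form_opnorm_le => // [|x]; first by rewrite starB starZ ci sT star_one.
  rewrite normalized_form // mulrBl mul1r lerD2l lerN2 subr_ge0.
  apply/andP; split; last by rewrite [eps / c]mulrC -mulrA ler_wpM2l ?invr_ge0 ?(ltW cp).
  rewrite mulrC ler_pdivrMr // (le_trans (op_form_le _ _)) // mulrC ler_wpM2l ?exprn_ge0 //.
  by rewrite lerDl ltW.
have lt1 : 1 - eps / c < 1 by rewrite gtrBl divr_gt0.
have [||Z [sZ ZZ nZ cZ]] := @bop_sqrt_near (c^-1 *: T).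
- by rewrite starZ ci sT.
- exact: le_trans n1 (ltW lt1).
have [|w [/(congr1 (@cmt_val R H C0)) /= Zw /(congr1 (@cmt_val R H C0)) /= wZ wc]] :=
    @cstar_inv _ (commutant C0) (lift (uone - Z)).
  exact: le_lt_trans (le_trans nZ n1) lt1.
have e : uone - (uone - Z) = Z by rewrite opprB addrC subrK.
rewrite e in Zw wZ.
have wC S : S ** Z = Z ** S -> S ** cmt_val w = cmt_val w ** S.
  move=> SZ; have /(congr1 (@cmt_val R H C0)) // : lift S ** w = w ** lift S.
  by apply: wc; apply: val_inj; rewrite /= smulBr smulBl smul1l smul1r SZ.
have s0 : 0 < sqrtC c by rewrite sqrtC_gt0.
have sw : star (cmt_val w) = cmt_val w.
  rewrite -[LHS]smul1r -Zw smulA -{1}sZ -starM Zw star_one smul1l.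
  by [].
exists (sqrtC c *: Z), ((sqrtC c)^-1 *: cmt_val w); split.
- by rewrite !starZ sZ sw !geC0_conj // ?invr_ge0 ltW.
- by rewrite -smulZl -smulZr scalerA -expr2 sqrtCK ZZ scalerA mulfV ?scale1r // gt_eqF.
- rewrite -!smulZl -!smulZr !scalerA mulfV ?mulVf ?gt_eqF // !scale1r.
  by rewrite Zw wZ.
- move=> S ST; have SZ : S ** Z = Z ** S by apply: cZ; rewrite -smulZl -smulZr ST.
  by rewrite -!smulZr -!smulZl SZ wC.
Qed.
End SquareRoot.

Section Entries.
Variables (H : hilbertType C) (I : finType).
Local Notation HI := (hsum H I).

Section Entry.
Variables (i k : I) (T : bop HI).
Let bnd (l l' : I) (S : bop HI) : linear (fun x => at_ l (op S (inj_at l' x))) /\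
  exists M : C, forall x : H, `|at_ l (op S (inj_at l' x))| <= M * `|x|.
Proof.
split; first by move=> a x y; rewrite inj_at_linear opPx at_linear.
exists (opnorm S) => x; rewrite (le_trans (norm_at_le _ _)) // (le_trans (le_opnorm _ _)) //.
by rewrite norm_inj.
Qed.
Let adj1 x y : hdot (at_ i (op T (inj_at k x))) y = hdot x (at_ k (adj T (inj_at i y))).
Proof. by rewrite -dot_inj_r op_starEr dot_inj_l. Qed.
Let adj2 x y : hdot (at_ k (adj T (inj_at i x))) y = hdot x (at_ i (op T (inj_at k y))).
Proof. by rewrite -[adj T]/(op (star T)) -dot_inj_r op_starE dot_inj_l. Qed.
Definition entry : bop H :=
  Adjop (proj1 (bnd i k T)) (proj1 (bnd k i (star T)))
        (proj2 (bnd i k T)) (proj2 (bnd k i (star T))) adj1 adj2.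
End Entry.

Lemma inj_sum (F : HI) : F = \sum_i inj_at i (at_ i F).
Proof.
apply: hsum_ext => i; rewrite at_sum (bigD1 i) //= at_inj eqxx big1 ?addr0 // => k ki.
by rewrite at_inj eq_sym (negPf ki).
Qed.

Lemma entry_star i k T : entry i k (star T) = star (entry k i T).
Proof. exact: bop_ext. Qed.

Lemma entryM i k S T : entry i k (S ** T) = \sum_l entry i l S ** entry l k T.
Proof.
apply: bop_ext => x; rewrite op_sum -at_sum.
by rewrite -opx_sum -inj_sum.
Qed.

Lemma entry_block i k i' k' T :
  entry i k (block i' k' T) = if (i == i') && (k == k') then T else 0.
Proof.
apply: bop_ext => x; rewrite /= !at_inj [k' == k]eq_sym.
by case: eqP => //= _; case: eqP => //= _; rewrite opx0.
Qed.

Lemma entryD i k S T : entry i k (S + T) = entry i k S + entry i k T.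
Proof. by apply: bop_ext => x; rewrite opDx /= /at_ ffunE. Qed.
Lemma entry0 i k : entry i k 0 = 0.
Proof. by apply: bop_ext => x; rewrite /= /at_ ffunE. Qed.
Lemma entry_sum (J : Type) (r : seq J) (Q : pred J) (F : J -> bop HI) i k :
  entry i k (\sum_(l <- r | Q l) F l) = \sum_(l <- r | Q l) entry i k (F l).
Proof. by apply: (big_morph (entry i k)) => [S T|]; rewrite ?entryD ?entry0. Qed.

Lemma entry_matrix (F : I -> I -> bop H) i k :
  entry i k (\sum_i' \sum_k' block i' k' (F i' k')) = F i k.
Proof.
rewrite entry_sum (bigD1 i) //= entry_sum (bigD1 k) //= entry_block !eqxx.
rewrite !big1 ?addr0 // => l li; last by rewrite entry_block eqxx eq_sym (negPf li).
by rewrite entry_sum big1 // => m _; rewrite entry_block eq_sym (negPf li).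
Qed.

Lemma entry_ext S T : (forall i k, entry i k S = entry i k T) -> S = T.
Proof.
move=> h; apply: bop_ext => F; rewrite [F]inj_sum.
rewrite !opx_sum; apply: eq_bigr => k _; apply: hsum_ext => i.
exact: (congr1 (fun U : bop H => op U (at_ k F)) (h i k)).
Qed.

Lemma entry_diag i k T : entry i k (diag I T) = if i == k then T else 0.
Proof.
rewrite entry_sum (bigD1 i) //= entry_block eqxx /= [k == i]eq_sym big1 ?addr0 // => l li.
by rewrite entry_block eq_sym (negPf li).
Qed.

Lemma entry_diagM i k g T : entry i k (diag I g ** T) = g ** entry i k T.
Proof.
rewrite entryM (bigD1 i) //= entry_diag eqxx big1 ?addr0 // => l li.
by rewrite entry_diag eq_sym (negPf li) smul0l.
Qed.
Lemma entryM_diag i k g T : entry i k (T ** diag I g) = entry i k T ** g.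
Proof.
rewrite entryM (bigD1 k) //= entry_diag eqxx big1 ?addr0 // => l li.
by rewrite entry_diag (negPf li) smul0r.
Qed.

(* The square root of the operator matrix lies in the bicommutant of its entries. *)
Lemma operator_matrix_factor (F : I -> I -> bop H) :
  (forall i k, star (F i k) = F k i) ->
  (forall x : I -> H, 0 <= \sum_i \sum_k hdot (op (F i k) (x k)) (x i)) ->
  exists Z : I -> I -> bop H, (forall i k, F i k = \sum_l star (Z l i) ** Z l k) /\
    forall g, (forall i k, F i k ** g = g ** F i k) -> forall i k, Z i k ** g = g ** Z i k.
Proof.
move=> sF F0; pose T := \sum_i \sum_k block i k (F i k).
have ET i k : entry i k T = F i k by exact: entry_matrix.
have sT : star T = T by apply: entry_ext => i k; rewrite entry_star !ET sF.
have T0 x : 0 <= hdot (op T x) x.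
  rewrite hsum_dotE; have := F0 (fun i => at_ i x).
  suff -> : \sum_i \sum_k hdot (op (F i k) (at_ k x)) (at_ i x) =
            \sum_i hdot (at_ i (op T x)) (at_ i x) by [].
  apply: eq_bigr => i _; rewrite [X in op T X]inj_sum opx_sum.
  rewrite at_sum linear_sumlz; apply: eq_bigr => k _.
  by rewrite -ET.
have [Z [sZ ZZ cZ]] := bop_sqrt sT T0.
exists (fun i k => entry i k Z); split=> [i k|g gF i k].
  by rewrite -ET -ZZ -{1}sZ entryM; apply: eq_bigr => l _; rewrite entry_star.
have : diag I g ** Z = Z ** diag I g.
  by apply: cZ; apply: entry_ext => l m; rewrite entry_diagM entryM_diag ET gF.
by move/(congr1 (entry i k)); rewrite entry_diagM entryM_diag => ->.
Qed.

End Entries.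
End PositiveOperators.

(** * Dilations *)

Section SelfadjointUnitary.
Context {C : numClosedFieldType} {D : ustarAlgType C}.
Variable W : D.
Hypotheses (WW : W ** W = 0) (WsW : W ** star W ** W = W).

(* For W with orthogonal initial and final spaces, the self-adjoint unitary that exchanges
   the two and is the identity on their complement. *)
Definition swap_unitary : D := W + star W + (uone - star W ** W - W ** star W).
Local Notation U := swap_unitary.

Let sWsW : star W ** star W = 0. Proof. by rewrite -starM WW star_zero. Qed.
Let sWWsW : star W ** (W ** star W) = star W.
Proof. by rewrite -[in RHS]WsW !starM starK smulA. Qed.

Lemma swap_unitary_star : star U = U.
Proof.
rewrite /U !starD !starN !starM !starK star_one; congr (_ + _).
by rewrite addrC.
Qed.

Lemma swap_unitaryK : U ** U = uone.
Proof.
set f := uone - star W ** W - W ** star W.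
have UE : U = W + star W + f by [].
have sf : star f = f by rewrite /f !starB star_one !starM !starK.
have Wf : W ** f = 0.
  by rewrite /f !smulBr smul1r !smulA WsW WW smul0l subrr subr0.
have sWf : star W ** f = 0.
  by rewrite /f !smulBr smul1r sWWsW !smulA sWsW smul0l subr0 subrr.
have fW : f ** W = 0 by rewrite -[f ** W]starK starM sf sWf star_zero.
have fsW : f ** star W = 0 by rewrite -[f ** _]starK starM starK sf Wf star_zero.
have ff : f ** f = f by rewrite {2}/f !smulBr smul1r !smulA fsW fW !smul0l !subr0.
have fE : f + star W ** W + W ** star W = uone by rewrite /f addrAC !subrK.
rewrite !UE; clearbody f; rewrite !smulDl !smulDr WW sWsW Wf sWf fW fsW ff !addr0 !add0r.
by rewrite addrC addrCA addrC -addrA (addrC (star W ** W)) addrA addrAC.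
Qed.

End SelfadjointUnitary.

Definition unital (C : numClosedFieldType) (A B : ustarAlgType C) (f : {linear A -> B}) : Prop :=
  f uone = uone.

Lemma ucp_unital (C : numClosedFieldType) (A B : ustarAlgType C) (f : {linear A -> B}) :
  is_ucp f -> unital f.
Proof. by case. Qed.

Section MatrixDilation.
Context {C : numClosedFieldType} {O : finQSpace C} {D D' : ustarAlgType C} {N : nat}.
Context {j : 'I_N -> 'I_N -> {scalar O}} {c : 'I_N -> O} (jc : coordinates j c).
Variables (L : finType).
(** [O] acts through its coordinates on the first factor. The slots [(n, None)] are the domains of
    Stinespring's isometry, and its values go to the slots [Some]; the tag [n] there keeps the
    ranges of the [w n] orthogonal. *)
Local Notation K := ('I_N * option (L * 'I_N))%type.
Variable th : K -> K -> {linear D -> D'}.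
Hypotheses
  (thM : forall a b b' d x y, th a b x ** th b' d y = if b == b' then th a d (x ** y) else 0)
  (th_star : forall a b x, star (th a b x) = th b a (star x))
  (th1 : \sum_a th a a uone = uone).
Variables (phi : {linear O -> D}) (Y : L -> 'I_N -> D).
Hypotheses (phi1 : unital phi)
  (phiY : forall i k, phi (star (c i) ** c k) = \sum_l star (Y l i) ** Y l k).

Let e n : K := (n, None).
Let w n : D' := \sum_i \sum_l th (i, Some (l, n)) (e n) (Y l i).

Let phiE x : phi x = \sum_i \sum_k j i k x *: \sum_l star (Y l i) ** Y l k.
Proof.
rewrite {1}(coordE jc x) linear_sum; apply: eq_bigr => i _ /=.
by rewrite linear_sum; apply: eq_bigr => k _ /=; rewrite linearZ /= phiY.
Qed.

Let ww n m : w n ** w m = 0.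
Proof.
rewrite smul_suml big1 // => i _; rewrite smul_suml big1 // => l _.
rewrite smul_sumr big1 // => k _; rewrite smul_sumr big1 // => l' _.
by rewrite thM xpair_eqE andbF.
Qed.

Let w_star n : star (w n) = \sum_i \sum_l th (e n) (i, Some (l, n)) (star (Y l i)).
Proof.
rewrite star_sum; apply: eq_bigr => i _; rewrite star_sum; apply: eq_bigr => l _.
exact: th_star.
Qed.

(* [th a b] are amplified matrix units.  Stinespring's isometry W sends the corner [(n, None)]
   into the spare corners [Some], so that the unitary U built from W conjugates the obvious
   representation [scalar_rep] into one compressing to [phi]. *)
Definition scalar_rep (x : O) : D' :=
  \sum_s \sum_i \sum_k j i k x *: th (i, s) (k, s) uone.

Let rep_th x k s b y :
  scalar_rep x ** th (k, s) b y = \sum_i j i k x *: th (i, s) b y.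
Proof.
rewrite smul_suml (bigD1 s) //= [X in _ + X]big1 ?addr0 => [|s' /negPf ss].
  rewrite smul_suml; apply: eq_bigr => i _.
  rewrite smul_suml (bigD1 k) //= -smulZl thM eqxx smul1l big1 ?addr0 // => k' /negPf kk.
  by rewrite -smulZl thM xpair_eqE kk /= scaler0.
rewrite smul_suml big1 // => i _; rewrite smul_suml big1 // => k' _.
by rewrite -smulZl thM xpair_eqE ss andbF scaler0.
Qed.

Let starw_th n i l m b y :
  star (w n) ** th (i, Some (l, m)) b y = if n == m then th (e n) b (star (Y l i) ** y) else 0.
Proof.
rewrite w_star smul_suml (bigD1 i) //= [X in _ + X]big1 ?addr0 => [|i' /negPf ii].
  rewrite smul_suml (bigD1 l) //= thM xpair_eqE eqxx /= (inj_eq Some_inj) xpair_eqE eqxx /=.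
  rewrite big1 ?addr0 // => l' /negPf ll.
  by rewrite thM xpair_eqE (inj_eq Some_inj) xpair_eqE ll andbF.
by rewrite smul_suml big1 // => l' _; rewrite thM xpair_eqE ii.
Qed.

Let starw_e n m b y : star (w n) ** th (e m) b y = 0.
Proof.
rewrite w_star smul_suml big1 // => i _; rewrite smul_suml big1 // => l _.
by rewrite thM xpair_eqE andbF.
Qed.

Let w_e n m : w n ** th (e m) (e m) uone = if n == m then w n else 0.
Proof.
case: eqP => [<-|/eqP/negPf nm]; rewrite /w smul_suml.
  apply: eq_bigr => i _; rewrite smul_suml; apply: eq_bigr => l _.
  by rewrite thM eqxx smul1r.
rewrite big1 // => i _; rewrite smul_suml big1 // => l _.
by rewrite thM xpair_eqE nm.
Qed.

(** Here the Gram hypothesis enters: for [n = m] the coefficient of [j i k x] is the sum of the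
    [star (Y l i) ** Y l k], that is [phi (star (c i) ** c k)], and [coordE] reassembles [phi x]. *)
Let corner x n m :
  star (w n) ** (scalar_rep x ** w m) = if n == m then th (e n) (e n) (phi x) else 0.
Proof.
rewrite [X in _ ** (_ ** X)]/w smul_sumr smul_sumr.
case: (eqVneq n m) => [<-|/negPf nm]; last first.
  rewrite big1 // => k _; rewrite smul_sumr smul_sumr big1 // => l _.
  rewrite rep_th smul_sumr big1 // => i _.
  by rewrite -smulZr starw_th nm scaler0.
rewrite phiE linear_sum /=.
under eq_bigr => k _.
  rewrite smul_sumr smul_sumr; under eq_bigr => l _.
    rewrite rep_th smul_sumr; under eq_bigr do rewrite -smulZr starw_th eqxx.
    over.
  rewrite exchange_big; over.
rewrite /= exchange_big; apply: eq_bigr => i _ /=.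
rewrite linear_sum; apply: eq_bigr => k _ /=.
by rewrite -scaler_sumr linearZ; congr (_ *: _); rewrite linear_sum.
Qed.

Lemma scalar_rep_linear : linear scalar_rep.
Proof.
move=> a x y; rewrite /scalar_rep scaler_sumr -big_split; apply: eq_bigr => s _ /=.
rewrite scaler_sumr -big_split; apply: eq_bigr => i _ /=.
rewrite scaler_sumr -big_split; apply: eq_bigr => k _ /=.
by rewrite linearP scalerDl scalerA.
Qed.

Let rep1 : scalar_rep uone = uone.
Proof.
have -> : uone = \sum_i \sum_s th (i, s) (i, s) uone :> D'.
  by rewrite -th1 pair_bigA; apply: eq_bigr => -[].
rewrite exchange_big.
apply: eq_bigr => s _; apply: eq_bigr => i _ /=.
rewrite (bigD1 i) //= (coord1 jc) eqxx scale1r big1 ?addr0 // => k ki.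
by rewrite (coord1 jc) eq_sym (negPf ki) scale0r.
Qed.

Let repM x y : scalar_rep (x ** y) = scalar_rep x ** scalar_rep y.
Proof.
rewrite [X in _ = _ ** X]/scalar_rep smul_sumr; apply: eq_bigr => s _.
rewrite smul_sumr [RHS](eq_bigr (fun k => \sum_l \sum_i (j i k x * j k l y) *: th (i, s) (l, s) uone)).
  rewrite [RHS]exchange_big [LHS]exchange_big; apply: eq_bigr => l _ /=.
  rewrite [RHS]exchange_big; apply: eq_bigr => i _ /=.
  by rewrite (coordM jc) scaler_suml.
move=> k _; rewrite smul_sumr; apply: eq_bigr => l _.
rewrite -smulZr rep_th scaler_sumr; apply: eq_bigr => i _.
by rewrite scalerA mulrC.
Qed.

Let rep_star x : scalar_rep (star x) = star (scalar_rep x).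
Proof.
rewrite star_sum; apply: eq_bigr => s _; rewrite exchange_big star_sum; apply: eq_bigr => k _ /=.
rewrite star_sum; apply: eq_bigr => i _.
by rewrite starZ th_star star_one (coord_star jc).
Qed.

Let W : D' := \sum_n w n.
Let U : D' := swap_unitary W.

Let sww n m : star (w n) ** w m = if n == m then th (e n) (e n) uone else 0.
Proof. by have := corner uone n m; rewrite rep1 smul1l phi1. Qed.

Let WsW : star W ** W = \sum_n th (e n) (e n) uone.
Proof.
rewrite star_sum smul_suml; apply: eq_bigr => n _; rewrite smul_sumr (bigD1 n) //= sww eqxx.
by rewrite big1 ?addr0 // => m; rewrite eq_sym sww => /negPf ->.
Qed.

Let W_e n : W ** th (e n) (e n) uone = w n.
Proof.
rewrite smul_suml (bigD1 n) //= w_e eqxx big1 ?addr0 // => m /negPf mn.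
by rewrite w_e mn.
Qed.

Let WW0 : W ** W = 0.
Proof. by rewrite smul_suml big1 // => n _; rewrite smul_sumr big1. Qed.

Let WWW : W ** star W ** W = W.
Proof. by rewrite -smulA WsW smul_sumr; apply: eq_bigr => n _; rewrite W_e. Qed.

Let U_e n : U ** th (e n) (e n) uone = w n.
Proof.
have sWe : star W ** th (e n) (e n) uone = 0.
  by rewrite star_sum smul_suml big1 // => m _; rewrite starw_e.
rewrite /U /swap_unitary !smulDl !smulNl smul1l -!smulA sWe W_e smul0r oppr0 !addr0.
suff -> : star W ** w n = th (e n) (e n) uone by rewrite subrr addr0.
rewrite star_sum smul_suml (bigD1 n) //= sww eqxx big1 ?addr0 // => m /negPf mn.
by rewrite sww mn.
Qed.

(** On the slots [(n, None)] the self-adjoint unitary [U] agrees with [W], so conjugating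
    [scalar_rep] by it gives a unital homomorphism whose corners there are [phi]. The last clause
    holds because [U] and [scalar_rep] are assembled from amplifications of the [Y l i], of their
    adjoints and of the unit. *)
Lemma matrix_dilation : exists Phi : {linear O -> D'},
  [/\ is_starhom Phi,
      forall n x, th (n, None) (n, None) uone ** Phi x ** th (n, None) (n, None) uone =
                  th (n, None) (n, None) (phi x)
    & forall G g, (forall a b y, y ** g = g ** y -> th a b y ** G = G ** th a b y) ->
      (forall l i, Y l i ** g = g ** Y l i /\ star (Y l i) ** g = g ** star (Y l i)) ->
      forall x, Phi x ** G = G ** Phi x].
Proof.
have Us : star U = U by exact: swap_unitary_star.
have UU : U ** U = uone by exact: swap_unitaryK.
have lin : linear (fun x => U ** scalar_rep x ** U).
  by move=> a x y; rewrite scalar_rep_linear (smulDr U) (smulDl (U ** _) _ U) -smulZr -smulZl.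
exists (mk_linear lin); split=> [|n x|G g hG hY x] /=.
- split=> [|x y|x] /=.
  + by rewrite rep1 smul1r UU.
  + by rewrite repM -!smulA (smulA U U) UU smul1l.
  + by rewrite rep_star !starM Us smulA.
- rewrite -!smulA U_e !smulA -/(e n).
  have -> : th (e n) (e n) uone ** U = star (w n).
    by rewrite -U_e starM Us th_star star_one.
  by rewrite -smulA corner eqxx.
- have GD (y z : D') : y ** G = G ** y -> z ** G = G ** z -> (y + z) ** G = G ** (y + z).
    by move=> h h'; rewrite smulDl smulDr h h'.
  have G0 : (0 : D') ** G = G ** 0 by rewrite smul0l smul0r.
  have GM (y z : D') : y ** G = G ** y -> z ** G = G ** z -> (y ** z) ** G = G ** (y ** z).
    by move=> h h'; rewrite -smulA h' smulA h smulA.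
  have GN (y : D') : y ** G = G ** y -> (- y) ** G = G ** (- y).
    by move=> h; rewrite smulNl smulNr h.
  have Gw n : w n ** G = G ** w n.
    apply: (big_ind (fun y => y ** G = G ** y)) => // i _.
    apply: (big_ind (fun y => y ** G = G ** y)) => // l _.
    by apply: hG; case: (hY l i).
  have Gsw n : star (w n) ** G = G ** star (w n).
    rewrite w_star; apply: (big_ind (fun y => y ** G = G ** y)) => // i _.
    apply: (big_ind (fun y => y ** G = G ** y)) => // l _.
    by apply: hG; case: (hY l i).
  have GW : W ** G = G ** W by apply: (big_ind (fun y => y ** G = G ** y)).
  have GsW : star W ** G = G ** star W.
    by rewrite star_sum; apply: (big_ind (fun y => y ** G = G ** y)).
  have G1 : uone ** G = G ** uone by rewrite smul1l smul1r.
  have GU : U ** G = G ** U.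
    rewrite /U /swap_unitary.
    apply: (GD _ _ (GD _ _ GW GsW)).
    by apply: (GD _ _ (GD _ _ G1 (GN _ (GM _ _ GsW GW))) (GN _ (GM _ _ GW GsW))).
  have GR : scalar_rep x ** G = G ** scalar_rep x.
    do 3!(apply: (big_ind (fun y => y ** G = G ** y)) => // ? _).
    by rewrite -smulZl -smulZr hG // smul1l smul1r.
  exact: (GM _ _ (GM _ _ GU GR) GU).
Qed.
End MatrixDilation.

(** The index type comes before [D'], because [D'] will be built from operators on a direct sum
    indexed by it. *)
Lemma gram_dilation (C : numClosedFieldType) (O : finQSpace C) (D : ustarAlgType C) (N : nat)
    (j : 'I_N -> 'I_N -> {scalar O}) (c : 'I_N -> O) (jc : coordinates j c) (L : finType)
    (phi : {linear O -> D}) (Y : L -> 'I_N -> D) :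
  unital phi ->
  (forall i k, phi (star (c i) ** c k) = \sum_l star (Y l i) ** Y l k) ->
  exists (K : finType) (k0 : K), forall (D' : ustarAlgType C) (th : K -> K -> {linear D -> D'}),
    (forall a b b' d x y, th a b x ** th b' d y = if b == b' then th a d (x ** y) else 0) ->
    (forall a b x, star (th a b x) = th b a (star x)) ->
    \sum_a th a a uone = uone ->
  exists Phi : {linear O -> D'},
  [/\ is_starhom Phi,
      forall x, th k0 k0 uone ** Phi x ** th k0 k0 uone = th k0 k0 (phi x)
    & forall G g, (forall a b y, y ** g = g ** y -> th a b y ** G = G ** th a b y) ->
      (forall l i, Y l i ** g = g ** Y l i /\ star (Y l i) ** g = g ** star (Y l i)) ->
      forall x, Phi x ** G = G ** Phi x].
Proof.
move=> phi1 phiY; exists ('I_N * option (L * 'I_N))%type, (Ordinal (coord_gt0 jc), None).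
move=> D' th thM th_star th1.
have [Phi [h1 h2 h3]] := matrix_dilation jc thM th_star th1 phi1 phiY.
by exists Phi; split=> // x; exact: h2.
Qed.

Section Dilation.
Context {R : realType}.
Local Notation C := R[i].
Context {O P : finQSpace C} {N m : nat}.
Context {jO : 'I_N -> 'I_N -> {scalar O}} {cO : 'I_N -> O} (hO : coordinates jO cO).
Context {jP : 'I_m -> 'I_m -> {scalar P}} {cP : 'I_m -> P} (hP : coordinates jP cP).

(** Unlike a Gram factorisation, positivity of the form visibly passes to sums and compressions;
    [operator_matrix_factor] recovers a factor from it. *)
Definition form_positive (H : hilbertType C) (I : finType) (F : I -> I -> bop H) : Prop :=
  (forall i k, star (F i k) = F k i) /\
  forall x : I -> H, 0 <= \sum_i \sum_k hdot (op (F i k) (x k)) (x i).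

Lemma gram_form_positive (H : hilbertType C) (I Q : finType) (F : I -> I -> bop H)
    (V : Q -> I -> bop H) :
  (forall i k, F i k = \sum_q star (V q i) ** V q k) -> form_positive F.
Proof.
move=> FE; split=> [i k|x].
  by rewrite !FE star_sum; apply: eq_bigr => q _; rewrite starM starK.
have -> : \sum_i \sum_k hdot (op (F i k) (x k)) (x i) =
    \sum_q hdot (\sum_k op (V q k) (x k)) (\sum_i op (V q i) (x i)).
  under [RHS]eq_bigr do rewrite linear_sumr.
  rewrite [RHS]exchange_big; apply: eq_bigr => i _ /=.
  under [RHS]eq_bigr do rewrite linear_sumlz.
  rewrite [RHS]exchange_big; apply: eq_bigr => k _ /=.
  rewrite FE op_sum linear_sumlz; apply: eq_bigr => q _ /=.
  exact: op_starE.
by apply: sumr_ge0 => q _; rewrite -hnorm_sq exprn_ge0.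
Qed.

(** A Choi matrix: [star (cO i) ** cO k] plays the matrix unit, and the coordinates of C(P) are
    flattened into the index. *)
Definition slice_mx (H : hilbertType C) (phi : O -> tensor P (bop H)) (i k : 'I_N * 'I_m) : bop H :=
  slicel (jP i.2 k.2) (phi (star (cO i.1) ** cO k.1)).

Lemma entry_corner (H : hilbertType C) (K : finType) (a : K) (T : bop (hsum H K)) :
  entry a a (block a a uone ** T ** block a a uone) = entry a a T.
Proof. by apply: bop_ext => x; rewrite /= !at_inj !eqxx. Qed.

Lemma gram_tensor_dilation (D : ustarAlgType C) (L : finType) (phi : {linear O -> tensor P D})
    (Z : L -> 'I_N * 'I_m -> D) :
  unital phi ->
  (forall i k, slicel (jP i.2 k.2) (phi (star (cO i.1) ** cO k.1)) = \sum_l star (Z l i) ** Z l k) ->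
  exists (K : finType) (k0 : K), forall (D' : ustarAlgType C) (B : K -> K -> {linear D -> D'})
      (dg : D -> D'),
    (forall a b b' d S T, B a b S ** B b' d T = if b == b' then B a d (S ** T) else 0) ->
    (forall a b S, star (B a b S) = B b a (star S)) ->
    \sum_a B a a uone = uone ->
    (forall a b g S, dg g ** B a b S = B a b (g ** S) /\ B a b S ** dg g = B a b (S ** g)) ->
  exists Phi : {linear O -> tensor P D'},
  [/\ is_starhom Phi,
      forall w x, B k0 k0 uone ** slicel w (Phi x) ** B k0 k0 uone = B k0 k0 (slicel w (phi x))
    & forall g, (forall l i, Z l i ** g = g ** Z l i /\ star (Z l i) ** g = g ** star (Z l i)) ->
      forall w x, slicel w (Phi x) ** dg g = dg g ** slicel w (Phi x)].
Proof.
(* The factor over the flattened index is regrouped along C(P): as [star (cP a) ** cP b] is the unit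
   for [a] and [b], the [Y l i] factor [phi (star (cO i) ** cO k)]. *)
move=> phi1 phiZ; pose Y l i := \sum_a cP a \ot Z l (i, a).
have phiY i k : phi (star (cO i) ** cO k) = \sum_l star (Y l i) ** Y l k.
  rewrite [LHS](tensor_expand hP).
  under eq_bigr => a _.
    under eq_bigr => b _ do rewrite (phiZ (i, a) (k, b)) linear_sumr.
    rewrite exchange_big; over.
  rewrite exchange_big; apply: eq_bigr => l _ /=.
  rewrite /Y star_sum smul_suml; apply: eq_bigr => a _.
  rewrite smul_sumr; apply: eq_bigr => b _.
  by rewrite tensor_star tensorM.
have Yg h : (forall l i, Z l i ** h = h ** Z l i) -> forall l i,
    Y l i ** (uone \ot h) = (uone \ot h) ** Y l i.
  move=> hh l i; rewrite smul_suml smul_sumr; apply: eq_bigr => a _.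
  by rewrite !tensorM smul1l smul1r hh.
have [K [k0 dil]] := gram_dilation hO phi1 phiY; exists K, k0 => D' B dg BM B_star B1 dgB.
pose th a b : {linear tensor P D -> tensor P D'} := tmap idfun (B a b).
have slice_th w a b y : slicel w (th a b y) = B a b (slicel w y) by exact: slicel_tmap.
have th1E a : th a a uone = uone \ot B a a uone by exact: tmap_pair.
clearbody th; have [a b b' d x y|a b x||Phi [Phi_hom Phi_corner Phi_comm]] := dil _ th.
- apply: (tensor_slice_ext hP) => p q; rewrite (slicelM hP).
  under eq_bigr do rewrite !slice_th BM.
  case: eqP => _; last by rewrite linear0 big1.
  by rewrite slice_th (slicelM hP) linear_sum.
- apply: (tensor_slice_ext hP) => p q.
  by rewrite (slicel_star hP) !slice_th B_star (slicel_star hP).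
- under eq_bigr do rewrite th1E.
  by rewrite -linear_sumr B1.
exists Phi; split=> // [w x|g gZ w x].
  by have := congr1 (slicel w) (Phi_corner x); rewrite slice_th th1E slicelMr slicelMl.
rewrite -slicelMr -slicelMl; congr (slicel w _).
apply: (Phi_comm _ (uone \ot g)) => [a b y yg|l i].
  apply: (tensor_slice_ext hP) => p q; rewrite slicelMr slicelMl slice_th.
  by rewrite (dgB a b g _).1 (dgB a b g _).2 -slicelMr yg slicelMl.
split; first by apply: Yg => l' i'; case: (gZ l' i').
rewrite -[LHS]starK starM starK tensor_star star_one -Yg ?starM ?tensor_star ?star_one ?starK //.
by move=> l' i'; rewrite -[LHS]starK starM starK -(gZ l' i').2 starM starK.
Qed.

Lemma tensor_dilation (H : hilbertType C) (phi : {linear O -> tensor P (bop H)}) :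
  unital phi -> form_positive (slice_mx phi) ->
  exists (J : finType) (k0 : J) (Phi : {linear O -> tensor P (bop (hsum H J))}),
  [/\ is_starhom Phi,
      forall w x, entry k0 k0 (slicel w (Phi x)) = slicel w (phi x)
    & forall g, (forall w x, slicel w (phi x) ** g = g ** slicel w (phi x)) ->
      forall w x, slicel w (Phi x) ** diag J g = diag J g ** slicel w (Phi x)].
Proof.
move=> phi1 phi_pos.
have [Z [ZE Zg]] := operator_matrix_factor phi_pos.1 phi_pos.2.
have [K [k0 dil]] := gram_tensor_dilation phi1 ZE.
have [a b b' d S T|a b S||a b g S|Phi [SPhi Phi_corner Phi_comm]] :=
    dil _ (fun a b => mk_linear (@block_linear R H K a b)) (diag K).
- exact: blockM.
- exact: block_star.
- exact: block_sum1.
- by split; [exact: diag_block|exact: block_diag].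
exists K, k0, Phi; split=> // [w x|g phig].
  rewrite -entry_corner [X in entry _ _ X](Phi_corner w x) /=.
  by rewrite entry_block eqxx.
(* The slice matrix is self-adjoint, so its entries commute with [star g] as well; this is what
   makes [star (Z l i)] commute with [g]. *)
have Fsg i k : slice_mx phi i k ** star g = star g ** slice_mx phi i k.
  by rewrite -[LHS]starK starM starK phi_pos.1 -phig starM phi_pos.1.
have Zs l i : Z l i ** star g = star g ** Z l i by exact: Zg.
apply: Phi_comm => l i; split; first by apply: Zg => p q; exact: phig.
by rewrite -[LHS]starK starM starK -Zs starM starK.
Qed.

Section Ucp.
Variable H : hilbertType C.

Lemma unit_elt_mxpos : mxpos (\matrix_(i < N, k < N) (star (cO i) ** cO k)).
Proof.
have n0 := Ordinal (coord_gt0 hO).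
(* [mxpos] asks for a square factor: the row [cO], completed by zero rows. *)
exists (\matrix_(l, k) if l == n0 then cO k else 0).
apply/matrixP => i k; rewrite !mxE (bigD1 n0) //= !mxE eqxx big1 ?addr0 // => l /negPf ln.
by rewrite !mxE ln smul0r.
Qed.

Lemma ucp_form_positive (phi : {linear O -> tensor P (bop H)}) :
  is_ucp phi -> form_positive (slice_mx phi).
Proof.
move=> [_ /(_ _ _ unit_elt_mxpos)[Y YE]].
have {}YE i k : phi (star (cO i) ** cO k) = \sum_l star (Y l i) ** Y l k.
  by have /matrixP/(_ i k) := YE; rewrite !mxE.
apply: (@gram_form_positive H _ ('I_N * 'I_m)%type _ (fun q i => slicel (jP q.2 i.2) (Y q.1 i.1))).
move=> [i a] [k b]; rewrite /slice_mx /= YE linear_sum.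
rewrite -(pair_bigA _ (fun l d => star (slicel (jP d a) (Y l i)) ** slicel (jP d b) (Y l k))) /=.
apply: eq_bigr => l _; rewrite (slicelM hP); apply: eq_bigr => d _.
by rewrite (slicel_star hP).
Qed.

End Ucp.
End Dilation.

Section CommutingDilation.
Context {R : realType}.
Local Notation C := R[i].
Context {O P : finQSpace C} {N m : nat}.
Context {jO : 'I_N -> 'I_N -> {scalar O}} {cO : 'I_N -> O} (hO : coordinates jO cO).
Context {jP : 'I_m -> 'I_m -> {scalar P}} {cP : 'I_m -> P} (hP : coordinates jP cP).

(** A *-homomorphism does not act on the vectors of the form, but it preserves Gram
    factorisations. *)
Lemma form_positive_starhom (H G : hilbertType C) (d : {linear bop H -> bop G}) (I : finType)
    (F : I -> I -> bop H) :
  is_starhom d -> form_positive F -> form_positive (fun i k => d (F i k)).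
Proof.
move=> [_ dM ds] [sF F0]; have [Z [ZE _]] := operator_matrix_factor sF F0.
apply: (@gram_form_positive _ _ _ _ _ (fun l i => d (Z l i))) => i k.
by rewrite ZE linear_sum; apply: eq_bigr => l _; rewrite dM ds.
Qed.

Lemma hilbert_dilation (H : hilbertType C) (phi : {linear O -> tensor P (bop H)}) :
  unital phi -> form_positive (slice_mx (cO := cO) (jP := jP) phi) ->
  exists (G : hilbertType C) (d : {linear bop H -> bop G}) (V : H -> G)
      (Phi : {linear O -> tensor P (bop G)}),
  [/\ is_starhom d /\ is_starhom Phi,
      forall g h, op (d g) (V h) = V (op g h),
      forall h, `|V h| = `|h|,
      forall w x h k, hdot (op (slicel w (Phi x)) (V h)) (V k) = hdot (op (slicel w (phi x)) h) k
    & forall g, (forall w x, slicel w (phi x) ** g = g ** slicel w (phi x)) ->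
      forall w x, slicel w (Phi x) ** d g = d g ** slicel w (Phi x)].
Proof.
move=> u p; have [J [k0 [Phi [S E comm]]]] := tensor_dilation hO hP u p.
exists (hsum H J), (mk_linear (@diag_linear R H J)), (inj_at k0), Phi.
split=> [|g h|h|w x h k|].
- split=> //; split; [exact: block_sum1|exact: diagM|exact: diag_star].
- exact: diag_inj.
- exact: norm_inj.
- rewrite dot_inj_r -E.
  by [].
- exact: comm.
Qed.

(** Each dilation comes with an amplification [d] of all operators. The amplified [phi2] still
    commutes with the dilation of [phi1]; after it is dilated, the first homomorphism is amplified
    in its turn. *)
Lemma commuting_dilation (H : hilbertType C) (phi1 phi2 : {linear O -> tensor P (bop H)}) :
  unital phi1 -> unital phi2 ->
  form_positive (slice_mx (cO := cO) (jP := jP) phi1) ->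
  form_positive (slice_mx (cO := cO) (jP := jP) phi2) ->
  (forall x y w w', slicel w (phi1 x) ** slicel w' (phi2 y) =
                    slicel w' (phi2 y) ** slicel w (phi1 x)) ->
  exists (H' : hilbertType C) (Phi1 Phi2 : {linear O -> tensor P (bop H')}) (V : H -> H'),
  [/\ is_starhom Phi1, is_starhom Phi2,
      forall x y w w', slicel w (Phi1 x) ** slicel w' (Phi2 y) =
                       slicel w' (Phi2 y) ** slicel w (Phi1 x),
      forall h, `|V h| = `|h|
    & forall x y w w' h, hdot (op (slicel w (Phi1 x) ** slicel w' (Phi2 y)) (V h)) (V h) =
                         hdot (op (slicel w (phi1 x) ** slicel w' (phi2 y)) h) h].
Proof.
move=> u1 u2 p1 p2 c12.
have [G1 [d1 [V1 [Psi1 [[hd1 S1] dV1 nV1 E1 C1]]]]] := hilbert_dilation u1 p1.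
have [psi2 [v2 psi2E]] := tmap_unital hP u2 (let: And3 e _ _ := hd1 in e).
have q2 : form_positive (slice_mx (cO := cO) (jP := jP) psi2).
  rewrite (_ : slice_mx _ = fun i k => d1 (slice_mx (cO := cO) (jP := jP) phi2 i k)).
    exact: form_positive_starhom.
  by apply/funext => i; apply/funext => k; rewrite /slice_mx psi2E.
have c1 x y w w' : slicel w (Psi1 x) ** slicel w' (psi2 y) = slicel w' (psi2 y) ** slicel w (Psi1 x).
  by rewrite psi2E C1 // => w1 z; exact: c12.
have [G2 [d2 [V2 [Psi2 [[hd2 S2] dV2 nV2 E2 C2]]]]] := hilbert_dilation v2 q2.
have [Psi [SPsi PsiE]] := starhom_tmap hP S1 hd2.
have c2 x y w w' : slicel w (Psi x) ** slicel w' (Psi2 y) = slicel w' (Psi2 y) ** slicel w (Psi x).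
  by rewrite PsiE C2 // => w1 z; rewrite c1.
exists G2, Psi, Psi2, (fun h => V2 (V1 h)); split=> // [h|x y w w' h]; first by rewrite nV2.
(* The factor acting first has to be an amplification, which passes through the isometry; the other
   one is then compressed. Commutation puts the factors in this order at each stage. *)
rewrite c2 opMx PsiE dV2 E2 -opMx -c1 psi2E opMx dV1 E1.
by [].
Qed.

Lemma starhom_ucp (A B : ustarAlgType C) (f : {linear A -> B}) : is_starhom f -> is_ucp f.
Proof.
move=> [f1 fM fs]; split=> // n X [Y ->]; exists (map_mx f Y).
apply/matrixP => i k; rewrite !mxE linear_sum; apply: eq_bigr => l _.
by rewrite fM fs !mxE.
Qed.

End CommutingDilation.

(** * Correlations given by completely positive maps and by homomorphisms *)

Section Correlations.
Context {R : realType} {P O : finQSpace R[i]}.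
Variable T : {linear tensor O O -> tensor P P}.

Definition ucp_correlation : Prop :=
  exists (H : hilbertType R[i]) (phi1 phi2 : {linear O -> tensor P (bop H)})
     (xi : H),
     [/\ is_ucp phi1, is_ucp phi2,
         forall x y : O,
           leg13 (phi1 x) ** leg23 (phi2 y) = leg23 (phi2 y) ** leg13 (phi1 x),
         `|xi| = 1
       & forall x y : O,
           T (x \ot y) =
           slicer (vector_state xi) (leg13 (phi1 x) ** leg23 (phi2 y))].

Definition starhom_correlation : Prop :=
  exists (H : hilbertType R[i]) (Phi1 Phi2 : {linear O -> tensor P (bop H)})
     (xi : H),
     [/\ is_starhom Phi1, is_starhom Phi2,
         forall x y : O,
           leg13 (Phi1 x) ** leg23 (Phi2 y) = leg23 (Phi2 y) ** leg13 (Phi1 x),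
         `|xi| = 1
       & forall x y : O,
           T (x \ot y) =
           slicer (vector_state xi) (leg13 (Phi1 x) ** leg23 (Phi2 y))].

Lemma starhom_to_ucp_correlation : starhom_correlation -> ucp_correlation.
Proof.
move=> [H [Phi1 [Phi2 [xi [h1 h2 hc n1 hT]]]]]; exists H, Phi1, Phi2, xi.
by split=> //; exact: starhom_ucp.
Qed.

Lemma ucp_to_starhom_correlation : ucp_correlation -> starhom_correlation.
Proof.
move=> [H [phi1 [phi2 [xi [h1 h2 hc n1 hT]]]]].
have [N [jO [cO hO]]] := findim_coordinates O.
have [m [jP [cP hP]]] := findim_coordinates P.
have [|H' [Phi1 [Phi2 [V [S1 S2 C12 nV E]]]]] := commuting_dilation hO hP (ucp_unital h1) (ucp_unital h2)
    (ucp_form_positive hO hP h1) (ucp_form_positive hO hP h2).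
  by move=> x y w w'; apply: leg_commute_slices; exact: hc.
exists H', Phi1, Phi2, (V xi); split=> // [x y||x y].
- by apply: (leg_commute hP) => *; exact: C12.
- by rewrite nV.
- rewrite hT !(slicer_leg_mul hP); do 4!(apply: eq_bigr => ? _).
  by rewrite /= /vector_state E.
Qed.

End Correlations.

(** * The universal property *)

Section UnitalMultipliers.
Context {C : numClosedFieldType} (X : ucstarType C).
Implicit Types (a x y : X) (T : multiplier X).

Let bnd a : linear (fun x : X => a ** x) /\ exists M : C, forall x, `|a ** x| <= M * `|x|.
Proof.
split; first by move=> k x y; rewrite smulDr smulZr.
by exists `|a| => x; exact: norm_smul.
Qed.
Let adj1 a x y : mult_form (a ** x) y = mult_form x (star a ** y).
Proof. by rewrite /mult_form starM starK smulA. Qed.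
Let adj2 a x y : mult_form (star a ** x) y = mult_form x (a ** y).
Proof. by rewrite /mult_form starM smulA. Qed.

Definition left_mult a : multiplier X :=
  Adjop (proj1 (bnd a)) (proj1 (bnd (star a))) (proj2 (bnd a)) (proj2 (bnd (star a)))
    (adj1 a) (adj2 a).

(** For a unital algebra this identifies the multipliers with the algebra itself; [left_mult] is the
    inverse. *)
Definition mult_eval T : X := op T uone.

Lemma mult_evalK a : mult_eval (left_mult a) = a.
Proof. exact: smul1r. Qed.

(** Adjointability forces right module linearity: pairing [op T x] with the unit shows that it is
    [star (adj T uone) ** x]. *)
Lemma mult_opE T x : op T x = mult_eval T ** x.
Proof.
have h (S : multiplier X) z : op S z = star (adj S uone) ** z.
  by have := op_adj S z uone; rewrite /= /mult_form star_one smul1l.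
by rewrite /mult_eval (h T x) (h T uone) smul1r.
Qed.

Lemma mult_eval_star T : mult_eval (star T) = star (mult_eval T).
Proof.
have := op_adj T uone uone; rewrite /= /mult_form star_one smul1l smul1r.
by rewrite /mult_eval => ->; rewrite starK.
Qed.

Lemma mult_eval_inj S T : mult_eval S = mult_eval T -> S = T.
Proof.
move=> e; apply: adjop_ext => x; first by rewrite !mult_opE e.
by rewrite -[adj S]/(op (star S)) -[adj T]/(op (star T)) !mult_opE !mult_eval_star e.
Qed.

Lemma mult_eval_linear : linear mult_eval. Proof. by []. Qed.

Lemma mult_evalM S T : mult_eval (S ** T) = mult_eval S ** mult_eval T.
Proof. by rewrite -mult_opE. Qed.

End UnitalMultipliers.

Lemma commuting_product (C : numClosedFieldType) (A B D : ustarAlgType C)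
    (f : {linear A -> D}) (g : {linear B -> D}) :
  is_starhom f -> is_starhom g -> (forall a b, f a ** g b = g b ** f a) ->
  exists pi : {linear tensor A B -> D}, is_starhom pi /\ forall a b, pi (a \ot b) = f a ** g b.
Proof.
move=> [f1 fM fs] [g1 gM gs] fg.
have bil : is_bilinear (fun a b => f a ** g b).
  split=> [b|a] k x y; rewrite linearP.
    by rewrite /= smulDl -smulZl.
  by rewrite /= smulDr -smulZr.
pose b : {bilinear A -> B -> D} :=
  HB.pack (fun a b => f a ** g b) (bilinear_isBilinear.Build C A B D _ _ _ bil).
have biE u v : tlift b (u \ot v) = f u ** g v by exact: tlift_pair.
exists (tlift b); split=> //; split=> [|x y|x].
- by transitivity (tlift b ((uone : A) \ot (uone : B))) => //; rewrite biE f1 g1 smul1l.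
- move: x; apply: tensor_ind => [|u v|x x' hx hx'].
  + by rewrite smul0l linear0 smul0l.
  + move: y; apply: tensor_ind => [|u' v'|y y' hy hy'].
    * by rewrite smul0r linear0 smul0r.
    * transitivity (f (u ** u') ** g (v ** v')); first by rewrite tensorM; exact: biE.
      transitivity ((f u ** g v) ** (f u' ** g v')); last by congr (_ ** _); symmetry; exact: biE.
      by rewrite fM gM -!smulA; congr (_ ** _); rewrite !smulA fg.
    * by rewrite smulDr !linearD /= hy hy' smulDr.
  + by rewrite smulDl !linearD /= hx hx' smulDl.
- move: x; apply: tensor_ind => [|u v|x x' hx hx'].
  + by rewrite star_zero linear0 star_zero.
  + transitivity (f (star u) ** g (star v)); first by rewrite tensor_star; exact: biE.
    transitivity (star (f u ** g v)); last by congr (star _); symmetry; exact: biE.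
    by rewrite fg gs fs starM.
  + by rewrite starD !linearD /= hx hx' starD.
Qed.

Lemma starhom_slice_star (C : numClosedFieldType) (P O : finQSpace C) (A : ustarAlgType C) N
    (j : 'I_N -> 'I_N -> {scalar P}) (c : 'I_N -> P) (jc : coordinates j c)
    (Phi : {linear O -> tensor P A}) a b y :
  is_starhom Phi -> star (slicel (j a b) (Phi y)) = slicel (j b a) (Phi (star y)).
Proof. by move=> [_ _ ->]; rewrite (slicel_star jc). Qed.

Lemma slicel_expand (C : numClosedFieldType) (P : finQSpace C) N (j : 'I_N -> 'I_N -> {scalar P})
    (c : 'I_N -> P) (jc : coordinates j c) (V : lmodType C) (w : {scalar P}) (y : tensor P V) :
  slicel w y = \sum_a \sum_b w (unit_elt (c:=c) a b) *: slicel (j a b) y.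
Proof.
rewrite {1}(tensor_expand jc y) linear_sum; apply: eq_bigr => a _.
by rewrite linear_sum; apply: eq_bigr => b _; exact: slicel_pair.
Qed.

Definition assemble (C : numClosedFieldType) (P : finQSpace C) N (c : 'I_N -> P) (V : lmodType C)
    (f : 'I_N -> 'I_N -> V) : tensor P V :=
  \sum_a \sum_b unit_elt (c:=c) a b \ot f a b.

Lemma slicel_assemble (C : numClosedFieldType) (P : finQSpace C) N (c : 'I_N -> P) (V : lmodType C)
    (f : 'I_N -> 'I_N -> V) (w : {scalar P}) :
  slicel w (assemble c f) = \sum_a \sum_b w (unit_elt (c:=c) a b) *: f a b.
Proof.
rewrite linear_sum; apply: eq_bigr => a _.
by rewrite linear_sum; apply: eq_bigr => b _; exact: slicel_pair.
Qed.

(** Preimages of the coordinate slices are chosen one by one and reassembled; linearity and the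
    homomorphism laws hold after applying the injective [v], hence already before. *)
Lemma starhom_lift (R : realType) (P O : finQSpace R[i]) (D B : ustarAlgType R[i])
    (v : {linear D -> B}) : is_starhom v -> (forall s t, v s = v t -> s = t) ->
  forall Phi : {linear O -> tensor P B}, is_starhom Phi ->
  (forall w x, exists d, v d = slicel w (Phi x)) ->
  exists Psi : {linear O -> tensor P D}, is_starhom Psi /\
    forall w x, v (slicel w (Psi x)) = slicel w (Phi x).
Proof.
move=> [v1 vM vs] vinj Phi [Phi1 PhiM Phis] hd.
have [lift vlift] : exists lift : {scalar P} -> O -> D, forall w x, v (lift w x) = slicel w (Phi x).
  by exists (fun w x => projT1 (cid (hd w x))) => w x; exact: projT2 (cid (hd w x)).
have [N [j [c jc]]] := findim_coordinates P.
pose psi x := assemble c (fun a b => lift (j a b) x).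
have slice_psi w x : v (slicel w (psi x)) = slicel w (Phi x).
  rewrite [RHS](slicel_expand jc) slicel_assemble linear_sum; apply: eq_bigr => a _.
  by rewrite linear_sum; apply: eq_bigr => b _; rewrite linearZ /= vlift.
have ext y z : (forall a b, v (slicel (j a b) y) = v (slicel (j a b) z)) -> y = z.
  by move=> h; apply: (tensor_slice_ext jc) => a b; exact: vinj.
have lin : linear psi.
  by move=> k x y; apply: ext => a b; rewrite !linearP /= !slice_psi !linearP.
pose Psi : {linear O -> tensor P D} := mk_linear lin.
have PsiE w x : v (slicel w (Psi x)) = slicel w (Phi x) by exact: slice_psi.
clearbody Psi; exists Psi; split=> //; split=> [|x y|x]; apply: ext => a b.
- by rewrite PsiE Phi1 !slicel_one linearZ /= v1.
- rewrite PsiE PhiM !(slicelM jc) linear_sum; apply: eq_bigr => k _.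
  by rewrite /= vM !PsiE.
- by rewrite PsiE Phis !(slicel_star jc) vs PsiE.
Qed.

Section Universal.
Context {R : realType} {P O : finQSpace R[i]} (M : quantum_maps P O).
Local Notation C := R[i].

Lemma universal_lift (X : cstarType C) (B : ustarAlgType C) (v : {linear multiplier X -> B}) :
  is_starhom v -> (forall s t, v s = v t -> s = t) ->
  forall Phi : {linear O -> tensor P B}, is_starhom Phi ->
  (forall w x, exists d, v d = slicel w (Phi x)) ->
  exists L : {linear M -> B},
    [/\ is_starhom L, forall w x, slicel w (Phi x) = L (slicel w (qm_Phi M x))
      & forall y, exists T, L y = v T].
Proof.
move=> vhom vinj Phi SPhi hd.
have [Psi [SPsi PsiE]] := @starhom_lift R P O _ _ v vhom vinj Phi SPhi hd.
pose Psi' : {linear O -> tensor P (multiplier X)} := Psi.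
have SPsi' : is_starhom Psi' by [].
have PsiE' w x : v (slicel w (Psi' x)) = slicel w (Phi x) := PsiE w x.
clearbody Psi'.
have [L0 [[L1 LM Ls] PsiL _]] := @qm_universal C P O M X Psi' SPsi'.
exists (v \o L0); split.
- by case: vhom => v1 vM vs; split=> [|x y|x] /=; rewrite ?L1 ?LM ?Ls ?v1 ?vM ?vs.
- by move=> w x; rewrite -PsiE' PsiL slicel_tmap.
- by move=> y; exists (L0 y).
Qed.

(** The universal property is applied with the commutant of [G] as target, which places the whole
    range of [L], and not only the slices, in that commutant. *)
Lemma universal_representation (H : hilbertType C) (G : set (bop H))
    (Phi : {linear O -> tensor P (bop H)}) :
  is_starhom Phi ->
  (forall g w x, G g -> slicel w (Phi x) ** g = g ** slicel w (Phi x) /\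
     slicel w (Phi x) ** star g = star g ** slicel w (Phi x)) ->
  exists L : {linear M -> bop H},
  [/\ is_starhom L, forall w x, slicel w (Phi x) = L (slicel w (qm_Phi M x))
    & forall m g, G g -> L m ** g = g ** L m].
Proof.
move=> SPhi GPhi.
pose X : ucstarType C := commutant G.
have lv : linear (fun T : multiplier X => cmt_val (mult_eval T)).
  by move=> k S T; rewrite (mult_eval_linear k S T).
pose v : {linear multiplier X -> bop H} :=
  mk_linear lv.
have vE T : v T = cmt_val (mult_eval T) by [].
have vhom : is_starhom v.
  by split=> // [S T|T]; rewrite !vE ?mult_evalM ?mult_eval_star.
have vinj S T : v S = v T -> S = T.
  by rewrite !vE => /val_inj; exact: mult_eval_inj.
have vG T g : G g -> v T ** g = g ** v T by rewrite vE; exact: cmt_comm.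
have [w x|L [SL LE LX]] := @universal_lift X _ v vhom vinj Phi SPhi.
  have inG : commutant_pred G (slicel w (Phi x)) by apply/asboolP => g; exact: GPhi.
  by exists (@left_mult C X (Commutant inG)); rewrite vE mult_evalK.
by exists L; split=> // y g; have [T ->] := LX y; exact: vG.
Qed.

(** [L1] is built in the commutant of the coordinate slices of [Phi2]. These therefore commute with
    all of [range L1], so that [L2] can be built in the commutant of that range. *)
Lemma universal_pair (H : hilbertType C) (Phi1 Phi2 : {linear O -> tensor P (bop H)}) :
  is_starhom Phi1 -> is_starhom Phi2 ->
  (forall x y w w', slicel w (Phi1 x) ** slicel w' (Phi2 y) =
     slicel w' (Phi2 y) ** slicel w (Phi1 x)) ->
  exists pi : {linear tensor M M -> bop H}, is_starhom pi /\
    forall x y w w', pi (slicel w (qm_Phi M x) \ot slicel w' (qm_Phi M y)) =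
      slicel w (Phi1 x) ** slicel w' (Phi2 y).
Proof.
move=> S1 S2 comm12; have [m [j [c jc]]] := findim_coordinates P.
have [|L1 [SL1 L1E L1G]] := @universal_representation H
    [set g | exists a b y, g = slicel (j a b) (Phi2 y)] Phi1 S1.
  move=> _ w x [a [b [y ->]]]; split; first exact: comm12.
  by rewrite (starhom_slice_star jc a b y S2); exact: comm12.
have [|L2 [SL2 L2E L2G]] := @universal_representation H (range L1) Phi2 S2.
  have h w x n : slicel w (Phi2 x) ** L1 n = L1 n ** slicel w (Phi2 x).
    rewrite [slicel w _](slicel_expand jc) smul_suml smul_sumr; apply: eq_bigr => a _.
    rewrite smul_suml smul_sumr; apply: eq_bigr => b _.
    by rewrite -smulZl -smulZr L1G //; exists a, b, x.
  move=> _ w x [n _ <-]; split; first exact: h.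
  by case: SL1 => _ _ <-; exact: h.
have [|pi [Spi piE]] := commuting_product SL1 SL2.
  by move=> a b; rewrite L2G.
by exists pi; split=> // x y w w'; rewrite piE -L1E -L2E.
Qed.
End Universal.

(** * States on the maximal tensor product *)

(** The order is partial, so nonnegativity is treated as the equation [s = |s|]: for [r]
    nonnegative, the distance of [s] to [|s|] is at most twice [|s - r|]. *)
Lemma le0_of_small (K : numFieldType) (s : K) :
  (forall eps, 0 < eps -> exists2 r, 0 <= r & `|s - r| < eps) -> 0 <= s.
Proof.
move=> h; suff -> : s = `|s| by [].
apply/eqP; rewrite -subr_eq0 -normr_eq0; apply/negP => /negP n0.
have n0' : 0 < `|s - `|s| | / 2 by rewrite divr_gt0 // lt_neqAle eq_sym n0 normr_ge0.
have [r r0 hr] := h _ n0'.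
have : `|s - `|s| | < `|s - `|s| |; last by rewrite ltxx.
apply: le_lt_trans (ler_distD r s `|s|) _.
rewrite [X in _ < X]splitr ltrD //.
by rewrite -{1}(ger0_norm r0) (le_lt_trans (ler_dist_dist _ _)) // distrC.
Qed.

Lemma small_factor (K : numFieldType) (c eps : K) : 0 <= c -> 0 < eps ->
  exists d, [/\ 0 < d, d <= 1 & d * c < eps].
Proof.
move=> c0 eps0; have ce : 0 < c + eps by rewrite ltr_wpDl.
(* The denominator stays positive when [c] is 0 and keeps the quotient at most one. *)
exists (eps / (c + eps)); split; first by rewrite divr_gt0.
  by rewrite ler_pdivrMr // mul1r lerDr.
by rewrite mulrAC ltr_pdivrMr // ltr_pM2l // ltrDl.
Qed.

Section DenseExtension.
Context {R : realType}.
Local Notation C := R[i].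

Lemma complex_limit_rate (c e : nat -> C) :
  vanishing e -> (forall n m, (n <= m)%N -> `|c n - c m| <= e n) ->
  exists l : C, forall n, `|c n - l| <= e n.
Proof.
move=> ve hc; have [l hl] := complex_seq_complete ve hc; exists l => n.
apply/ler_addgt0Pr => d d0; have [N hN] := hl d d0.
rewrite (le_trans (ler_distD (c (maxn n N)) _ _)) // lerD ?hc ?leq_maxl //.
exact/ltW/hN/leq_maxr.
Qed.

Lemma half_vanishingM (c : C) : 0 <= c -> vanishing (fun n => 2%:R ^- n * c : C).
Proof.
move=> c0 eps eps0; have [d [d0 _ dc]] := small_factor c0 eps0.
have [n hn] := @half_vanishing R d d0; exists n; apply: le_lt_trans dc.
by rewrite ler_wpM2r // ltW.
Qed.

Lemma dense_range_approx (V : lmodType C) (Z : normedModType C) (iota : V -> Z) :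
  dense (range iota) -> forall z (eps : C), 0 < eps -> exists u, `|z - iota u| < eps.
Proof.
move=> dZ z eps eps0.
have [|y [/= zu [u _ e]]] := dZ (ball z eps) _ (@ball_open C Z z eps).
  by exists z; exact: ballxx.
by exists u; move: zu; rewrite -e -ball_normE.
Qed.

Context {V : lmodType C} {Z : normedModType C} (iota : {linear V -> Z}).
Hypothesis dZ : dense (range iota).

(** The estimate against every [u] determines each value, by density, and yields linearity; at
    [z = iota u] it says that [s] extends [f]. *)
Lemma dense_extension (f : {scalar V}) : (forall u, `|f u| <= `|iota u|) ->
  exists s : {scalar Z}, forall z u, `|s z - f u| <= `|z - iota u|.
Proof.
move=> fle.
have ext z : exists s : C, forall u, `|s - f u| <= `|z - iota u|.
  have hu n : exists u, `|z - iota u| < 2%:R ^- n / 2.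
    by apply: (dense_range_approx dZ); rewrite divr_gt0 ?invr_gt0 ?exprn_gt0.
  have [u uP] := choice hu.
  have small n m : (n <= m)%N -> `|z - iota (u m)| <= 2%:R ^- n / 2.
    move=> nm; apply: le_trans (ltW (uP m)) _; rewrite ler_pM2r ?invr_gt0 // lef_pV2 ?posrE ?exprn_gt0 //.
    by rewrite ler_eXn2l ?ltr1n.
  have [|s sP] := @complex_seq_complete R (fun n => f (u n)) _ half_vanishing.
    move=> n m nm; rewrite -linearB (le_trans (fle _)) // linearB /=.
    rewrite (le_trans (ler_distD z _ _)) // [X in _ <= X]splitr lerD //.
      by rewrite distrC small.
    exact: small.
  exists s => v; apply/ler_addgt0Pr => d d0.
  have d2 : 0 < d / 2 by rewrite divr_gt0.
  have [N hN] := sP _ d2; have [n hn] := half_vanishing d2.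
  have h1 := ltW (hN (maxn N n) (leq_maxl _ _)).
  have h2 : `|z - iota (u (maxn N n))| <= d / 2.
    apply: le_trans (ltW hn); apply: le_trans (small n _ (leq_maxr _ _)) _.
    by rewrite ler_piMr ?invr_ge0 ?exprn_ge0 // invf_le1 // ler1n.
  rewrite (le_trans (ler_distD (f (u (maxn N n))) _ _)) // [X in _ <= _ + X]splitr addrC.
  rewrite addrA lerD // 1?distrC //.
  rewrite -linearB (le_trans (fle _)) // linearB /= (le_trans (ler_distD z _ _)) // addrC.
  by rewrite addrC lerD // distrC.
have [s sP] := choice ext.
have lin : scalar s.
  move=> k x y; apply/eqP; rewrite -subr_eq0 -normr_eq0; apply/eqP/le_anti.
  rewrite normr_ge0 andbT; apply/ler_addgt0Pr => d d0; rewrite add0r.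
  pose e := d / (2 * (`|k| + 1)).
  have k1 : 0 < `|k| + 1 by rewrite ltr_wpDl.
  have e0 : 0 < e by rewrite divr_gt0 // mulr_gt0.
  have [u hu] := dense_range_approx dZ x e0; have [v hv] := dense_range_approx dZ y e0.
  have small : `|k| * `|x - iota u| + `|y - iota v| <= d / 2.
    rewrite (_ : d / 2 = `|k| * e + e); last by rewrite /e; field; rewrite gt_eqF.
    by rewrite lerD ?ler_wpM2l // ltW.
  have kuv : `|k *: x + y - iota (k *: u + v)| <= `|k| * `|x - iota u| + `|y - iota v|.
    by rewrite linearP /= opprD addrACA -scalerBr (le_trans (ler_normD _ _)) ?normrZ.
  rewrite (_ : _ - _ = (s (k *: x + y) - f (k *: u + v)) -
      (k * (s x - f u) + (s y - f v))); last first.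
    have -> : f (k *: u + v) = k * f u + f v by exact: linearP.
    by ring.
  rewrite (le_trans (ler_normB _ _)) // [X in _ <= X]splitr lerD //.
    exact: le_trans (sP _ _) (le_trans kuv small).
  rewrite (le_trans (ler_normD _ _)) // (le_trans _ small) // lerD // normrM.
  by rewrite ler_wpM2l.
by exists (mk_scalar lin).
Qed.
End DenseExtension.

Section RepresentationState.
Context {R : realType} {A B : ucstarType R[i]} (Z : max_tensor A B).
Local Notation C := R[i].

Lemma representation_state (H : hilbertType C) (pi : {linear tensor A B -> bop H}) (xi : H) :
  is_starhom pi -> `|xi| = 1 ->
  exists s : {scalar Z}, is_state s /\ forall u, s (mt_in Z u) = vector_state xi (pi u).
Proof.
move=> Spi xi1; have [pi1 piM pis] := Spi.
pose f := (vector_state xi \o pi : {scalar tensor A B}).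
have fle u : `|f u| <= `|mt_in Z u|.
  rewrite /f /= /vector_state (le_trans (hdot_CS _ _)) // xi1 mulr1.
  have [/(_ (lexx _)) + _] := @mt_norm _ _ _ Z u _ (normr_ge0 (mt_in Z u)).
  by move=> /(_ H pi Spi xi); rewrite xi1 mulr1.
have fpos u : 0 <= f (star u ** u).
  by rewrite /f /= piM pis /vector_state opMx op_starE -hnorm_sq exprn_ge0.
have [s sP] := dense_extension (@mt_dense _ _ _ Z) fle.
have sE u : s (mt_in Z u) = f u.
  by apply/eqP; rewrite -subr_eq0 -normr_le0 (le_trans (sP _ _)) // subrr normr0.
exists s; split=> //; split=> [|z].
  have [in1 _ _] := mt_starhom Z; rewrite -in1 sE /f /= pi1 /vector_state op1x -hnorm_sq xi1.
  by rewrite expr1n.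
apply: le0_of_small => eps eps0.
(* With [u] standing for its image, [|z - u| < d <= 1] makes [star z ** z] and [star u ** u] differ
   by at most [d (|z| + |u|)], and [|u| <= |z| + 1]. *)
pose c := `|z| + (`|z| + 1).
have c0 : 0 < c by rewrite /c ltr_wpDl // ltr_wpDl.
have [d [d0 d1 dc]] := small_factor (ltW c0) eps0.
have [u hu] := dense_range_approx (@mt_dense _ _ _ Z) z d0.
exists (f (star u ** u)) => //; apply: le_lt_trans (sP _ _) _.
have [_ inM ins] := mt_starhom Z; rewrite inM ins.
rewrite (_ : _ - _ = star z ** (z - mt_in Z u) + star (z - mt_in Z u) ** mt_in Z u); last first.
  by rewrite smulBr starB smulBl addrA subrK.
apply: le_lt_trans dc; rewrite (le_trans (ler_normD _ _)) // mulrDr lerD //.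
  by rewrite (le_trans (norm_smul _ _)) // mulrC norm_star ler_wpM2r // ltW.
rewrite (le_trans (norm_smul _ _)) // norm_star ler_pM // ?(ltW hu) //.
rewrite -[mt_in Z u](subrK z) addrC (le_trans (ler_normD _ _)) // lerD // distrC.
exact: le_trans (ltW hu) d1.
Qed.
End RepresentationState.

(** * The GNS construction *)

Section Completion.
Context {R : realType} {V : lmodType R[i]} {p : V -> V -> R[i]} (hp : is_semidot p).
Local Notation C := R[i].
Local Notation N := (@dnorm R V p).

Implicit Types (F G : V -> C^o) (x y z : V) (e d c : C).

(* The completion of V for [p] is realised by the functions y |-> p x y and their limits,
   uniform on the unit ball of V; null vectors disappear without a quotient. *)
Definition approx F x e : Prop := 0 <= e /\ forall y, `|F y - p x y| <= e * N y.

Definition completion_pred F : bool := `[< forall e, 0 < e -> exists x, approx F x e >].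

Lemma approxP F G x y e d k :
  approx F x e -> approx G y d -> approx (k *: F + G) (k *: x + y) (`|k| * e + d).
Proof.
move=> [e0 hF] [d0 hG]; split=> [|z]; first by rewrite addr_ge0 ?mulr_ge0.
rewrite (_ : _ - _ = k * (F z - p x z) + (G z - p y z)); last first.
  have -> : (k *: F + G) z = k * F z + G z by [].
  by rewrite (semidotPl hp); ring.
rewrite (le_trans (ler_normD _ _)) // mulrDl lerD // normrM -mulrA.
by rewrite ler_wpM2l.
Qed.

Fact completion_submod : subsemimod_closed completion_pred.
Proof.
have lin k F G : completion_pred F -> completion_pred G -> completion_pred (k *: F + G).
  move=> /asboolP hF /asboolP hG; apply/asboolP => e e0.
  have k1 : 0 < `|k| + 1 by rewrite ltr_wpDl.
  have [x hx] := hF (e / (`|k| + 1)) (divr_gt0 e0 k1).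
  have [y hy] := hG (e / (`|k| + 1)) (divr_gt0 e0 k1).
  exists (k *: x + y); rewrite (_ : e = `|k| * (e / (`|k| + 1)) + e / (`|k| + 1)).
    exact: approxP.
  by field; rewrite gt_eqF.
have h0 : completion_pred 0.
  apply/asboolP => e e0; exists 0; split=> [|y]; first exact: ltW.
  by rewrite (semidot0l hp) subrr normr0 mulr_ge0 ?dnorm_nneg // ltW.
split; [split=> //|].
- by move=> F G hF hG; rewrite -[F]scale1r; exact: lin.
- by move=> k F hF; rewrite -[_ *: F]addr0; exact: lin.
Qed.
HB.instance Definition _ :=
  GRing.isSubmodClosed.Build C (V -> C^o) completion_pred completion_submod.

Record completion : Type :=
  Completion { cpl_val : V -> C^o; cpl_valP : completion_pred cpl_val }.
HB.instance Definition _ := [isSub for cpl_val].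
HB.instance Definition _ := [Choice of completion by <:].
HB.instance Definition _ := [SubChoice_isSubLmodule of completion by <:].

Implicit Types (f g h : completion).

Lemma completion_approx f e : 0 < e -> exists x, approx (cpl_val f) x e.
Proof. by case: f => F h; have /asboolP hF := h; exact: hF. Qed.

Lemma completion_ext f g : (forall y, cpl_val f y = cpl_val g y) -> f = g.
Proof. by move=> fg; apply: val_inj; exact: funext. Qed.

Lemma cplP k f g y : cpl_val (k *: f + g) y = k * cpl_val f y + cpl_val g y.
Proof. by []. Qed.

Let Nn x : 0 <= N x. Proof. exact: dnorm_nneg. Qed.
Let CS x y : `|p x y| <= N x * N y. Proof. exact: le_dot_dnorm. Qed.
Lemma small_eq0 (a c : C) : 0 <= c -> (forall e, 0 < e -> `|a| <= c * e) -> a = 0.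
Proof.
move=> c0 h; apply: (eq_of_vanishing (@half_vanishing R) _ c0) => n.
  by rewrite invr_ge0 exprn_ge0.
by rewrite subr0 mulrC h // invr_gt0 exprn_gt0.
Qed.

Lemma cplPr f k x y : cpl_val f (k *: x + y) = k^* * cpl_val f x + cpl_val f y.
Proof.
apply/eqP; rewrite -subr_eq0; apply/eqP.
apply: (@small_eq0 _ (N (k *: x + y) + (`|k| * N x + N y))) => [|e e0].
  by rewrite !addr_ge0 ?mulr_ge0.
have [z [_ hz]] := completion_approx f e0.
rewrite (_ : _ - _ = (cpl_val f (k *: x + y) - p z (k *: x + y)) -
    (k^* * (cpl_val f x - p z x) + (cpl_val f y - p z y))); last first.
  by rewrite (semidotPr hp); ring.
rewrite (le_trans (ler_normB _ _)) // [leRHS]mulrC [leRHS]mulrDr lerD // (le_trans (ler_normD _ _)) //.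
by rewrite [leRHS]mulrDr lerD // normrM norm_conjC mulrCA ler_wpM2l.
Qed.

Lemma cplB f x y : cpl_val f (x - y) = cpl_val f x - cpl_val f y.
Proof. by rewrite addrC -scaleN1r cplPr rmorphN1 mulN1r addrC. Qed.

Lemma cpl_bounded f : exists2 c, 0 <= c & forall y, `|cpl_val f y| <= c * N y.
Proof.
have [x [_ hx]] := completion_approx f (@ltr01 C).
exists (1 + N x) => [|y]; first by rewrite addr_ge0.
rewrite -[cpl_val f y](subrK (p x y)) (le_trans (ler_normD _ _)) // mulrDl lerD //.
Qed.

Lemma le_of_sq_le (a b : C) : 0 <= a -> 0 <= b -> a ^+ 2 <= b * a -> a <= b.
Proof.
move=> a0 b0; have [->//|n0] := eqVneq a 0.
by rewrite expr2 ler_pM2r // lt_neqAle eq_sym n0.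
Qed.

Lemma approx_dist F x y e d : approx F x e -> approx F y d -> N (x - y) <= e + d.
Proof.
move=> [e0 hx] [d0 hy]; apply: le_of_sq_le => //; first by rewrite addr_ge0.
rewrite dnorm_sq -(ger0_norm (semidot_ge0 hp _)) {1}(semidotBl hp).
rewrite (_ : _ - _ = (F (x - y) - p y (x - y)) - (F (x - y) - p x (x - y))); last by ring.
by rewrite (le_trans (ler_normB _ _)) // addrC mulrDl lerD.
Qed.

(** As [cpl_val f y] is to be the inner product of [f] with the image of [y], that of [f] and [g] is
    its limit when [y] approaches [g]. With an error linear in [e] the limit is unique, and every
    identity for it reduces to one estimate. *)
Definition is_dot f g (l : C) : Prop :=
  exists2 c, 0 <= c & forall y e, approx (cpl_val g) y e -> `|l - cpl_val f y| <= c * e.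

Lemma is_dot_unique f g l l' : is_dot f g l -> is_dot f g l' -> l = l'.
Proof.
move=> [c c0 hl] [c' c0' hl']; apply/eqP; rewrite -subr_eq0; apply/eqP.
apply: (@small_eq0 _ (c + c')) => [|e e0]; first by rewrite addr_ge0.
have [y hy] := completion_approx g e0.
rewrite (le_trans (ler_distD (cpl_val f y) _ _)) // mulrDl lerD ?hl //.
by rewrite distrC hl'.
Qed.

Lemma is_dot_exists f g : exists l, is_dot f g l.
Proof.
have [c c0 fc] := cpl_bounded f.
have hu n : exists y, approx (cpl_val g) y (2%:R ^- n).
  by apply: completion_approx; rewrite invr_gt0 exprn_gt0.
have [u uP] := choice hu.
have near y e n : approx (cpl_val g) y e ->
    `|cpl_val f y - cpl_val f (u n)| <= c * (e + 2%:R ^- n).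
  move=> hy; rewrite -cplB (le_trans (fc _)) // ler_wpM2l //.
  exact: approx_dist hy (uP n).
have [|n m nm|l hl] := @complex_limit_rate R (fun n => cpl_val f (u n))
    (fun n => 2%:R ^- n * (c * 2)).
- by apply: half_vanishingM; rewrite mulr_ge0.
- rewrite (_ : 2%:R ^- n * _ = c * (2%:R ^- n + 2%:R ^- n)); last by ring.
  rewrite (le_trans (near _ _ m (uP n))) // ler_wpM2l // lerD2l.
  by rewrite lef_pV2 ?posrE ?exprn_gt0 // ler_eXn2l ?ltr1n.
exists l; exists c => // y e hy; apply/ler_addgt0Pr => d d0.
have [|n hn] := @half_vanishingM R (c * 2 + c) _ d d0; first by rewrite !addr_ge0 ?mulr_ge0.
rewrite (le_trans (ler_distD (cpl_val f (u n)) _ _)) //.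
have nu := near y e n hy; rewrite distrC in nu.
have lu := hl n; rewrite distrC in lu; apply: le_trans (lerD lu nu) _.
rewrite (_ : _ + _ = c * e + 2%:R ^- n * (c * 2 + c)); last by ring.
by rewrite lerD2l ltW.
Qed.

Definition cpl_dot f g : C := projT1 (cid (is_dot_exists f g)).

Lemma cpl_dotP f g : is_dot f g (cpl_dot f g).
Proof. exact: projT2 (cid (is_dot_exists f g)). Qed.

Lemma cpl_dotE f g l : is_dot f g l -> cpl_dot f g = l.
Proof. exact/is_dot_unique/cpl_dotP. Qed.

Lemma approx_le f : exists2 c, 0 <= c & forall x e, e <= 1 -> approx (cpl_val f) x e -> N x <= c.
Proof.
have [y hy] := completion_approx f (@ltr01 C).
exists (1 + 1 + N y) => [|x e e1 hx]; first by rewrite !addr_ge0.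
have := dnorm_triangle hp (x - y) y; rewrite subrK => /le_trans; apply; rewrite lerD2r.
by rewrite (le_trans (approx_dist hx hy)) // lerD2r.
Qed.

Lemma cpl_dot_semidot : is_semidot cpl_dot.
Proof.
split=> [k f g h|f g|f].
- apply: cpl_dotE; have [c c0 hc] := cpl_dotP f h; have [d d0 hd] := cpl_dotP g h.
  exists (`|k| * c + d) => [|y e hy]; first by rewrite addr_ge0 ?mulr_ge0.
  rewrite cplP (_ : _ - _ = k * (cpl_dot f h - cpl_val f y) + (cpl_dot g h - cpl_val g y)).
    rewrite (le_trans (ler_normD _ _)) // mulrDl lerD ?hd // normrM -mulrA.
    by rewrite ler_wpM2l // hc.
  by ring.
- apply: cpl_dotE; have [c c0 hc] := cpl_dotP g f; have [K K0 hK] := approx_le f.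
  exists K => // y e hy; apply/ler_addgt0Pr => eps eps0.
  have [|d [d0 d1 dc]] := @small_factor _ (c + N y) eps _ eps0; first by rewrite addr_ge0.
  have [x hx] := completion_approx f d0; have [_ fx] := hx; have [e0 gy] := hy.
  (* [cpl_dot g f] is near [cpl_val g x], which is near [p y x]; the conjugate [p x y] of the latter
     is near [cpl_val f y]. *)
  rewrite (_ : _ - _ = (cpl_dot g f - cpl_val g x)^* + (cpl_val g x - p y x)^* -
      (cpl_val f y - p x y)); last by rewrite !rmorphB (semidotC hp x y); ring.
  rewrite (le_trans (ler_normB _ _)) // (_ : K * e + eps = d * c + K * e + (eps - d * c)); last by ring.
  rewrite lerD //; last first.
    by rewrite (le_trans (fx _)) // lerBrDl -mulrDr ltW.
  rewrite (le_trans (ler_normD _ _)) // !norm_conjC lerD // 1?mulrC ?hc //.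
  by rewrite (le_trans (gy _)) // ler_wpM2l // (hK _ _ d1 hx).
- apply: le0_of_small => eps eps0; have [c c0 hc] := cpl_dotP f f.
  have [K K0 hK] := approx_le f.
  have [|d [d0 d1 dc]] := @small_factor _ (c + K) eps _ eps0; first by rewrite addr_ge0.
  have [x hx] := completion_approx f d0; have [_ fx] := hx.
  exists (p x x); first exact: semidot_ge0.
  apply: le_lt_trans dc; rewrite (le_trans (ler_distD (cpl_val f x) _ _)) // mulrDr lerD //.
    by rewrite mulrC hc.
  by rewrite (le_trans (fx _)) // ler_wpM2l ?(hK _ _ d1 hx) // ltW.
Qed.

Local Notation D := (@dnorm R completion cpl_dot).

(** Together with [cpl_val_le], this identifies the norm of [f] with its least constant [e], so that
    norm estimates in the completion become pointwise ones. *)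
Lemma cpl_norm_le f e : 0 <= e -> (forall y, `|cpl_val f y| <= e * N y) -> D f <= e.
Proof.
move=> e0 fe; rewrite -(@ler_pXn2r _ 2) ?nnegrE ?(dnorm_nneg cpl_dot_semidot) //.
rewrite dnorm_sq -(ger0_norm (semidot_ge0 cpl_dot_semidot f)).
apply/ler_addgt0Pr => eps eps0; have [c c0 hc] := cpl_dotP f f.
have [|d [d0 d1 dc]] := @small_factor _ (c + e) eps _ eps0; first by rewrite addr_ge0.
have [x hx] := completion_approx f d0; have [_ fx] := hx.
have Nx : N x <= e + d.
  apply: le_of_sq_le => //; first by rewrite addr_ge0 // ltW.
  rewrite dnorm_sq -(ger0_norm (semidot_ge0 hp x)) mulrDl.
  rewrite -[p x x](subrK (cpl_val f x)) addrC (le_trans (ler_normD _ _)) // lerD //.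
  by rewrite distrC.
rewrite -[cpl_dot f f](subrK (cpl_val f x)) (le_trans (ler_normD _ _)) //.
apply: (@le_trans _ _ (d * c + e * (e + d))).
  by rewrite lerD // ?(le_trans (fe x)) ?ler_wpM2l // mulrC hc.
rewrite (_ : _ + _ = e ^+ 2 + d * (c + e)); last by ring.
by rewrite lerD2l ltW.
Qed.

Fact cpl_embed_subproof x : completion_pred (p x).
Proof.
apply/asboolP => e e0; exists x; split=> [|y]; first exact: ltW.
by rewrite subrr normr0 mulr_ge0 // ltW.
Qed.
Definition cpl_embed x : completion := Completion (cpl_embed_subproof x).

Lemma cpl_dot_embed f y : cpl_dot f (cpl_embed y) = cpl_val f y.
Proof.
apply: cpl_dotE; have [c c0 hc] := cpl_bounded f; exists c => // z e hz.
rewrite -cplB (le_trans (hc _)) // ler_wpM2l // -[e]add0r.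
apply: approx_dist hz; split=> // x.
by rewrite subrr normr0 mul0r.
Qed.

Lemma cpl_definite f : cpl_dot f f = 0 -> f = 0.
Proof.
move=> f0; apply: completion_ext => y; rewrite -cpl_dot_embed.
apply/eqP; rewrite -normr_eq0 -sqrf_eq0; apply/eqP/le_anti.
rewrite exprn_ge0 // andbT (le_trans (semidot_CS cpl_dot_semidot _ _)) //.
by rewrite f0 mul0r.
Qed.

Lemma cpl_val_le f y : `|cpl_val f y| <= D f * N y.
Proof.
rewrite -cpl_dot_embed (le_trans (le_dot_dnorm cpl_dot_semidot _ _)) //.
by rewrite /dnorm [cpl_dot (cpl_embed y) _]cpl_dot_embed.
Qed.

Lemma cpl_complete : seq_complete_for D.
Proof.
move=> f fC.
have near n m y : (n <= m)%N ->
    `|cpl_val (f n) y - cpl_val (f m) y| <= 2%:R ^- n * N y.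
  move=> nm; rewrite (_ : _ - _ = cpl_val (f n - f m) y) // (le_trans (cpl_val_le _ _)) //.
  by rewrite ler_wpM2r ?fC.
have lim y : exists l, forall n, `|cpl_val (f n) y - l| <= 2%:R ^- n * N y.
  by apply: complex_limit_rate => [|n m]; [exact: half_vanishingM | exact: near].
have [l lP] := choice lim.
have lpred : completion_pred l.
  apply/asboolP => e e0; have e2 : 0 < e / 2 by rewrite divr_gt0.
  have [n hn] := @half_vanishing R _ e2; have [x [_ hx]] := completion_approx (f n) e2.
  exists x; split=> [|y]; first exact: ltW.
  rewrite (le_trans (ler_distD (cpl_val (f n) y) _ _)) // [e in leRHS]splitr mulrDl lerD //.
  by rewrite distrC (le_trans (lP _ _)) // ler_wpM2r // ltW.
exists (Completion lpred) => eps eps0; have [n0 hn] := @half_vanishing R _ eps0.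
exists n0 => n n0n; apply: le_lt_trans hn; apply: cpl_norm_le => [|y].
  by rewrite invr_ge0 exprn_ge0.
rewrite (_ : cpl_val _ y = cpl_val (f n) y - l y) // (le_trans (lP _ _)) // ler_wpM2r //.
by rewrite lef_pV2 ?posrE ?exprn_gt0 // ler_eXn2l ?ltr1n.
Qed.

Definition cpl_hilb : hilbertType C := hilb cpl_dot_semidot cpl_definite cpl_complete.

Section Action.
Context {A : ustarAlgType C} (act : A -> V -> V).
Hypotheses (actP : forall k a b x, act (k *: a + b) x = k *: act a x + act b x)
  (act1 : forall x, act uone x = x) (actM : forall a b x, act (a ** b) x = act a (act b x))
  (act_star : forall a x y, p (act a x) y = p x (act (star a) y))
  (act_bounded : forall a, exists2 c, 0 <= c & forall x, N (act a x) <= c * N x).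

(** The action extends by duality: on the image of [x] the composite with [act (star a)] is the
    image of [act a x], and composition makes sense on the whole completion without taking
    limits. *)
Fact cpl_act_subproof a f : completion_pred (fun y => cpl_val f (act (star a) y)).
Proof.
apply/asboolP => e e0; have [c c0 hc] := act_bounded (star a).
have [d [d0 _ dc]] := small_factor c0 e0; have [x [_ hx]] := completion_approx f d0.
exists (act a x); split=> [|y]; first exact: ltW.
rewrite act_star (le_trans (hx _)) //; apply: (@le_trans _ _ (d * (c * N y))).
  by rewrite ler_wpM2l // ltW.
by rewrite mulrA ler_wpM2r // ltW.
Qed.
Definition cpl_act a f : completion := Completion (cpl_act_subproof a f).

Lemma cpl_actE a f y : cpl_val (cpl_act a f) y = cpl_val f (act (star a) y).
Proof. by []. Qed.

Lemma cpl_act_linear a : linear (cpl_act a).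
Proof. by move=> k f g; apply: completion_ext. Qed.

Lemma cpl_act_bounded a : exists c, forall f, D (cpl_act a f) <= c * D f.
Proof.
have [c c0 hc] := act_bounded (star a); exists c => f.
have Df : 0 <= D f by exact: dnorm_nneg cpl_dot_semidot f.
apply: cpl_norm_le => [|y]; first by rewrite mulr_ge0.
by rewrite cpl_actE (le_trans (cpl_val_le _ _)) // [c * _]mulrC -mulrA ler_wpM2l.
Qed.

Lemma cpl_act_adj a f g : cpl_dot (cpl_act a f) g = cpl_dot f (cpl_act (star a) g).
Proof.
apply: cpl_dotE; have [c c0 hc] := cpl_dotP f (cpl_act (star a) g).
have [c' c0' hc'] := act_bounded a; exists (c * c') => [|y e [e0 hy]].
  by rewrite mulr_ge0.
rewrite cpl_actE -mulrA hc //; split=> [|z]; first by rewrite mulr_ge0.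
rewrite cpl_actE starK act_star starK (le_trans (hy _)) // mulrAC [leRHS]mulrC.
by rewrite ler_wpM2l.
Qed.

Definition cpl_op (a : A) : bop cpl_hilb :=
  @Adjop C cpl_hilb _ _ (@hdot C cpl_hilb) (cpl_act a) (cpl_act (star a))
    (cpl_act_linear a) (cpl_act_linear (star a)) (cpl_act_bounded a) (cpl_act_bounded (star a))
    (cpl_act_adj a) (fun f g => etrans (cpl_act_adj (star a) f g)
      (congr1 (fun b => cpl_dot f (cpl_act b g)) (starK a))).

Lemma cpl_opE a f y : cpl_val (op (cpl_op a) f) y = cpl_val f (act (star a) y).
Proof. by []. Qed.

Lemma cpl_op_linear : linear cpl_op.
Proof.
move=> k a b; apply: bop_ext => f; apply: completion_ext => y.
by rewrite cpl_opE starD starZ actP cplPr conjCK.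
Qed.

Lemma completion_representation :
  exists (H : hilbertType C) (pi : {linear A -> bop H}) (J : V -> H),
    [/\ is_starhom pi, forall a x, op (pi a) (J x) = J (act a x)
      & forall x y, hdot (J x) (J y) = p x y].
Proof.
exists cpl_hilb, (mk_linear cpl_op_linear), cpl_embed; split.
- split=> [|a b|a]; apply: bop_ext => f; apply: completion_ext => y; rewrite !cpl_opE.
  + by rewrite star_one act1.
  + by rewrite starM actM.
  + by [].
- by move=> a x; apply: completion_ext => y; rewrite cpl_opE /= -act_star.
- by move=> x y; exact: cpl_dot_embed.
Qed.

End Action.
End Completion.

(** The form is real on the diagonal, so [k * q x y + k^* * q y x] is real for every [k]; the cases
    [k = 1] and [k = 'i] determine [q x y]. *)
Lemma sesquilinear_hermitian (R : realType) (V : lmodType R[i]) (q : V -> V -> R[i]) :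
  (forall k x y z, q (k *: x + y) z = k * q x z + q y z) ->
  (forall k x y z, q z (k *: x + y) = k^* * q z x + q z y) ->
  (forall x, 0 <= q x x) -> forall x y, q x y = (q y x)^*.
Proof.
move=> qPl qPr q0 x y.
have conj (k : R[i]) : k^* * (q x y)^* + k * (q y x)^* = k * q x y + k^* * q y x.
  have : k * q x y + k^* * q y x \is Num.real.
    rewrite (_ : _ + _ = q (k *: x + y) (k *: x + y) - q y y - k^* * k * q x x).
      by rewrite !rpredB ?ger0_real // mulr_ge0 // mulrC -normCK exprn_ge0.
    by rewrite qPl !qPr; ring.
  by rewrite CrealE rmorphD !rmorphM /= conjCK => /eqP.
have h1 := conj 1; have h2 := conj 'i; rewrite conjCi in h2; rewrite conjC1 !mul1r in h1.
have : 2 * 'i * q x y = 2 * 'i * (q y x)^*.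
  rewrite (_ : _ * q x y = 2 * 'i * (q y x)^* -
      ('i * ((q x y)^* + (q y x)^* - (q x y + q y x)) +
       (- 'i * (q x y)^* + 'i * (q y x)^* - ('i * q x y + - 'i * q y x)))); last by ring.
  by rewrite h1 h2 !subrr mulr0 addr0 subr0.
by apply: mulfI; rewrite mulf_neq0 ?neq0Ci // pnatr_eq0.
Qed.

Section GNS.
Context {R : realType} {A : ustarAlgType R[i]} (s : {scalar A}).
Local Notation C := R[i].
Hypothesis s_ge0 : forall x, 0 <= s (star x ** x).

Lemma positive_semidot : is_semidot (fun x y => s (star y ** x)).
Proof.
have sP (k : C) x y : s (k *: x + y) = k * s x + s y by exact: linearP.
have pl k x y z : s (star z ** (k *: x + y)) = k * s (star z ** x) + s (star z ** y).
  by rewrite smulDr -smulZr sP.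
split=> [//|x y|x]; last exact: s_ge0.
apply: (sesquilinear_hermitian (q := fun x y => s (star y ** x))) => // k x' y' z.
by rewrite starD starZ smulDl -smulZl sP.
Qed.

(** [A] carries no norm, being an algebraic tensor product in the applications, so boundedness of
    left multiplication is a hypothesis. *)
Lemma gns_representation :
  (forall a, exists2 c, 0 <= c & forall x, s (star (a ** x) ** (a ** x)) <= c * s (star x ** x)) ->
  exists (H : hilbertType C) (pi : {linear A -> bop H}) (xi : H),
    is_starhom pi /\ forall a, vector_state xi (pi a) = s a.
Proof.
move=> sb; have hp := positive_semidot.
have [k a b x|x|a b x|a x y|a|H [pi [J [Spi piJ dotJ]]]] :=
    @completion_representation _ _ _ hp A (@smul C A).
- by rewrite smulDl -smulZl.
- exact: smul1l.
- by rewrite smulA.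
- by rewrite starM starK smulA.
- have [c c0 hc] := sb a; exists (sqrtC c) => [|x]; first by rewrite sqrtC_ge0.
  rewrite /dnorm -rootCMl // ler_rootC ?nnegrE ?mulr_ge0 //.
exists H, pi, (J uone); split=> // a.
by rewrite /vector_state piJ dotJ star_one smul1l smul1r.
Qed.
End GNS.

Lemma tensor_linear_ext (C : fieldType) (U V W : lmodType C) (f g : {linear tensor U V -> W}) :
  (forall u v, f (u \ot v) = g (u \ot v)) -> f =1 g.
Proof.
move=> fg; apply: tensor_ind => [||x y hx hy]; [by rewrite !linear0|exact: fg|].
by rewrite !linearD hx hy.
Qed.

Lemma mxpos1 (C : numClosedFieldType) (A : starAlgType C) (x : A) :
  mxpos (const_mx x : 'M[A]_1) <-> exists y, x = star y ** y.
Proof.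
split=> [[Y /matrixP/(_ 0 0)]|[y ->]].
  by rewrite !mxE big_ord_recl big_ord0 addr0 => ->; exists (Y 0 0).
exists (const_mx y); apply/matrixP => i k.
by rewrite !mxE big_ord_recl big_ord0 addr0 !mxE.
Qed.

Lemma starhom_factors (C : numClosedFieldType) (A B D : ustarAlgType C)
    (pi : {linear tensor A B -> D}) : is_starhom pi ->
  exists (f : {linear A -> D}) (g : {linear B -> D}),
  [/\ is_starhom f, is_starhom g, forall a b, f a ** g b = g b ** f a
    & forall a b, pi (a \ot b) = f a ** g b].
Proof.
move=> [pi1 piM pis].
have lf : linear (fun a => pi (a \ot (uone : B))) by move=> k x y; rewrite linearPl linearP.
have lg : linear (fun b => pi ((uone : A) \ot b)) by move=> k x y; rewrite linearPr linearP.
have fM a a' b b' : pi ((a ** a') \ot (b ** b')) = pi (a \ot b) ** pi (a' \ot b').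
  by rewrite -piM; congr (pi _); rewrite [RHS]tensorM.
have fs a b : pi (star a \ot star b) = star (pi (a \ot b)).
  by rewrite -pis; congr (pi _); rewrite [RHS]tensor_star.
exists (mk_linear lf), (mk_linear lg); split=> /=.
- split=> //= [x y|x]; first by rewrite -fM smul1l.
  by rewrite -fs star_one.
- split=> //= [x y|x]; first by rewrite -fM smul1l.
  by rewrite -fs star_one.
- by move=> a b /=; rewrite -!fM !smul1l !smul1r.
- by move=> a b /=; rewrite -!fM !smul1l !smul1r.
Qed.

Lemma starhom_legs (R : realType) (P O : finQSpace R[i]) (A D : ustarAlgType R[i])
    (Phi Psi : {linear O -> tensor P A}) (pi : {linear tensor A A -> D}) :
  is_starhom Phi -> is_starhom Psi -> is_starhom pi ->
  exists F G : {linear O -> tensor P D},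
  [/\ is_starhom F, is_starhom G,
      forall x y, leg13 (F x) ** leg23 (G y) = leg23 (G y) ** leg13 (F x)
    & forall (om : {scalar D}) x y, slicer om (leg13 (F x) ** leg23 (G y)) =
        slicer (om \o pi) (tinter (Phi x) (Psi y))].
Proof.
move=> SPhi SPsi /starhom_factors[f [g [Sf Sg fg pifg]]].
have [m [j [c jc]]] := findim_coordinates P.
have [F [SF FE]] := starhom_tmap jc SPhi Sf; have [G [SG GE]] := starhom_tmap jc SPsi Sg.
exists F, G; split=> // [x y|om x y].
  by apply: (leg_commute jc) => *; rewrite FE GE fg.
rewrite (slicer_leg_mul jc) (slicer_tinter jc); do 4!(apply: eq_bigr => ? _).
by rewrite /= FE GE pifg.
Qed.

Lemma starhom_os_cp (C : numClosedFieldType) (A : ucstarType C) (S : opSystem A)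
    (B : ustarAlgType C) (f : {linear A -> B}) :
  is_starhom f -> is_cp (f \o @os_val C A S : {linear os_space S -> B}).
Proof.
move=> [_ fM fs] n X [Y XY]; exists (map_mx f Y).
apply/matrixP => i k; have /matrixP/(_ i k) := XY; rewrite !mxE /= => ->.
by rewrite linear_sum; apply: eq_bigr => l _; rewrite fM fs !mxE.
Qed.

Lemma vector_state_star (R : realType) (H : hilbertType R[i]) (xi : H) (Y : bop H) :
  vector_state xi (star Y ** Y) = `|op Y xi| ^+ 2.
Proof. by rewrite /vector_state opMx op_starE -hnorm_sq. Qed.

Lemma vector_state_one (R : realType) (H : hilbertType R[i]) (xi : H) :
  vector_state xi uone = `|xi| ^+ 2.
Proof. by rewrite /vector_state op1x -hnorm_sq. Qed.

(** The difference of the two sides is [s] at [star (b ** x) ** (b ** x)], with [b] from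
    [cstar_norm_sq]. *)
Lemma positive_mul_le (R : realType) (A : ucstarType R[i]) (s : {scalar A}) (a x : A) :
  (forall y, 0 <= s (star y ** y)) ->
  s (star (a ** x) ** (a ** x)) <= `|a| ^+ 2 * s (star x ** x).
Proof.
move=> s0; have [b bE] := cstar_norm_sq a; rewrite -subr_ge0.
have sZ (k : R[i]) y : s (k *: y) = k * s y by exact: linearZ.
suff <- : s (star (b ** x) ** (b ** x)) =
    `|a| ^+ 2 * s (star x ** x) - s (star (a ** x) ** (a ** x)) by [].
rewrite -sZ -linearB; congr (s _).
rewrite (starM b) -smulA [star b ** _]smulA bE smulBl -smulZl smul1l smulBr -smulZr.
by rewrite starM !smulA.
Qed.

(** * From homomorphisms to states on the two tensor products *)

Section Correlations.
Context {R : realType} {P O : finQSpace R[i]} {T : {linear tensor O O -> tensor P P}}.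
Context {M : quantum_maps P O} (Z : max_tensor M M).
Local Notation C := R[i].
Local Notation S := (slice_system M).

Definition maximal_correlation : Prop :=
  exists sigma : {scalar Z},
     is_state sigma /\
     forall x y : O,
       T (x \ot y) =
       slicer (sigma \o mt_in Z) (tinter (qm_Phi M x) (qm_Phi M y)).

Definition commuting_correlation : Prop :=
  exists sigma : {scalar tensor (os_space S) (os_space S)},
     is_commuting_state sigma /\
     forall x y : O,
       T (x \ot y) = slicer sigma (tinter (slice_phi M x) (slice_phi M y)).

Lemma starhom_to_maximal_correlation : starhom_correlation T -> maximal_correlation.
Proof.
move=> [H [Phi1 [Phi2 [xi [S1 S2 hc n1 hT]]]]].
have [|pi [Spi piE]] := @universal_pair R P O M H Phi1 Phi2 S1 S2.
  by move=> x y w w'; apply: leg_commute_slices; exact: hc.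
have [s [ss sE]] := representation_state Z Spi n1.
have [m [jP [cP hP]]] := findim_coordinates P.
exists s; split=> // x y; rewrite hT (slicer_leg_mul hP) (slicer_tinter hP).
by do 4!(apply: eq_bigr => ? _); rewrite /= sE piE.
Qed.

(** GNS is applied to the restriction of [s] to the algebraic tensor product, so that the
    representation splits into two commuting factors; the bounds come from the norm of [Z]. *)
Lemma max_tensor_gns (s : {scalar Z}) : is_state s ->
  exists (H : hilbertType C) (pi : {linear tensor M M -> bop H}) (xi : H),
    [/\ is_starhom pi, `|xi| = 1 & forall u, vector_state xi (pi u) = s (mt_in Z u)].
Proof.
move=> [s1 s0]; have [in1 inM ins] := mt_starhom Z.
pose t := (s \o mt_in Z : {scalar tensor M M}).
have tE u : t u = s (mt_in Z u) by [].
clearbody t.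
have [u|a|H [pi [xi [Spi piE]]]] := @gns_representation R (tensor M M) t.
- by rewrite tE inM ins.
- exists (`|mt_in Z a| ^+ 2) => [|x]; first exact: exprn_ge0.
  by rewrite !tE !inM !ins inM; exact: positive_mul_le.
exists H, pi, xi; split=> //; last by move=> u; rewrite piE tE.
apply/eqP; rewrite -(@eqrXn2 _ 2) // expr1n -vector_state_one.
by have [<- _ _] := Spi; rewrite piE tE in1 s1.
Qed.

Lemma slicel_slice_phi (w : {scalar P}) x :
  os_val (slicel w (slice_phi M x)) = slicel w (qm_Phi M x).
Proof. by rewrite -[RHS](congr1 (slicel w) (slice_phiE M x)) slicel_tmap. Qed.

Lemma slice_phi_linear (w : {scalar P}) (k : C) (x y : O) :
  slicel w (slice_phi M (k *: x + y)) =
  k *: slicel w (slice_phi M x) + slicel w (slice_phi M y).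
Proof.
apply: val_inj; transitivity (k *: os_val (slicel w (slice_phi M x)) +
  os_val (slicel w (slice_phi M y))) => //.
rewrite !slicel_slice_phi -linearP -linearP; exact: slicel_slice_phi.
Qed.

Lemma slice_phi_one (w : {scalar P}) : slicel w (slice_phi M uone) = w uone *: os_one S.
Proof.
apply: val_inj; transitivity (slicel w (qm_Phi M uone)); first exact: slicel_slice_phi.
by have [-> _ _] := qm_starhom M; rewrite slicel_one.
Qed.

Lemma maximal_to_commuting_correlation : maximal_correlation -> commuting_correlation.
Proof.
move=> [s [ss hT]]; have [H [pi [xi [Spi n1 piE]]]] := max_tensor_gns ss.
have [f [g [Sf Sg fg pifg]]] := starhom_factors Spi.
pose val2 : {linear tensor (os_space S) (os_space S) -> tensor M M} :=
  tmap (@os_val C M S) (@os_val C M S).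
have val2E a b : val2 (a \ot b) = os_val a \ot os_val b by exact: tmap_pair.
clearbody val2.
pose t := (vector_state xi \o pi \o val2 : {scalar tensor (os_space S) (os_space S)}).
have tE u : t u = vector_state xi (pi (val2 u)) by [].
clearbody t; exists t; split; [split|].
- rewrite tE val2E /= pifg; have [-> _ _] := Sf; have [-> _ _] := Sg.
  by rewrite smul1l vector_state_one n1 expr1n.
- move=> u [_ pos]; 
  (* The pair tested against commuting positivity consists of the two factors of [pi], restricted to
     the slice system. *)
  pose F : {linear os_space S -> bop H} := f \o @os_val C M S.
  pose G : {linear os_space S -> bop H} := g \o @os_val C M S.
  have : mxpos (map_mx (os_mul F G) (const_mx u : 'M_1)).
    by apply: pos => [||a b]; [exact: starhom_os_cp|exact: starhom_os_cp|exact: fg].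
  rewrite map_const_mx => /mxpos1[Y YE]; rewrite tE.
  have <- : os_mul F G u = pi (val2 u).
    apply: (@tensor_linear_ext _ _ _ _ (tlift (os_mul_fun F G)) (pi \o val2)) => c d.
    transitivity (F c ** G d); first exact: tlift_pair.
    by rewrite /= val2E pifg.
  by rewrite YE vector_state_star exprn_ge0.
- have [m [jP [cP hP]]] := findim_coordinates P.
  move=> x y; rewrite hT !(slicer_tinter hP).
  by do 4!(apply: eq_bigr => ? _); rewrite /= tE val2E !slicel_slice_phi piE.
Qed.

End Correlations.

(** * Completely positive maps on the slice system *)

(** [mxpos] asks for a square factor. The injection [h] places the rows of [V] among the indices of
    the matrix, and the remaining rows are zero. *)
Lemma is_cp_gram (C : numClosedFieldType) (A : ucstarType C) (S : opSystem A) (B : ustarAlgType C)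
    (f : {linear os_space S -> B}) (I Q : finType) (X : I -> I -> os_space S) (V : Q -> I -> A)
    (h : Q -> I) :
  is_cp f -> injective h ->
  (forall i k, os_val (X i k) = \sum_q star (V q i) ** V q k) ->
  exists n (Y : 'I_n -> I -> B), forall i k, f (X i k) = \sum_l star (Y l i) ** Y l k.
Proof.
move=> cpf hI XE.
pose Y (l : 'I_#|I|) i := if [pick q | h q == enum_val l] is Some q then V q i else 0.
have YE i k : os_val (X i k) = \sum_(l < #|I|) star (Y l i) ** Y l k.
  rewrite XE (partition_big h xpredT) //= (reindex _ (onW_bij _ (enum_val_bij I))) /=.
  apply: eq_bigr => l _; rewrite /Y; case: pickP => [q /eqP hq|none].
    by rewrite (bigD1 q) ?hq //= big1 ?addr0 // => q' /andP[/eqP e]; rewrite (hI q' q) ?eqxx // hq.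
  by rewrite smul0r big1 // => q /eqP hq; have := none q; rewrite hq eqxx.
have [|Z /matrixP ZE] := cpf #|I| (\matrix_(i, k) X (enum_val i) (enum_val k)).
  exists (\matrix_(l, i) Y l (enum_val i)); apply/matrixP => i k; rewrite !mxE YE.
  by apply: eq_bigr => l _; rewrite !mxE.
exists #|I|, (fun l i => Z l (enum_rank i)) => i k.
by have := ZE (enum_rank i) (enum_rank k); rewrite !mxE !enum_rankK.
Qed.

Section Positivity.
Context {R : realType} {O P : finQSpace R[i]} {M : quantum_maps P O} {N m : nat}.
Local Notation C := R[i].
Local Notation S := (slice_system M).
Context {jO : 'I_N -> 'I_N -> {scalar O}} {cO : 'I_N -> O} (hO : coordinates jO cO).
Context {jP : 'I_m -> 'I_m -> {scalar P}} {cP : 'I_m -> P} (hP : coordinates jP cP).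
Context {K : hilbertType C}.
Local Notation form_positive_map phi := (form_positive (slice_mx (cO := cO) (jP := jP) phi)).

Lemma cp_tensor_map (f : {linear os_space S -> bop K}) :
  exists phi : {linear O -> tensor P (bop K)},
    forall w x, slicel w (phi x) = f (slicel w (slice_phi M x)).
Proof.
have sl w x : slicel w (tmap idfun f (slice_phi M x)) = f (slicel w (slice_phi M x)).
  exact: slicel_tmap.
have lin : linear (fun x => tmap idfun f (slice_phi M x) : tensor P (bop K)).
  move=> k x y; apply: (tensor_slice_ext hP) => a b.
  by rewrite linearP /= !sl -linearP slice_phi_linear.
by exists (mk_linear lin).
Qed.

(** Multiplicativity of [qm_Phi] writes the matrix of slices as a Gram matrix over the ambient
    algebra, hence as a positive matrix over the slice system, to which [f] applies. *)
Lemma cp_tensor_map_positive (f : {linear os_space S -> bop K})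
    (phi : {linear O -> tensor P (bop K)}) : is_cp f ->
  (forall w x, slicel w (phi x) = f (slicel w (slice_phi M x))) -> form_positive_map phi.
Proof.
move=> cpf phiE; have n0 := Ordinal (coord_gt0 hO).
have [|i k|n [Y YE]] := @is_cp_gram _ _ _ _ f ('I_N * 'I_m)%type 'I_m
  (fun i k => slicel (jP i.2 k.2) (slice_phi M (star (cO i.1) ** cO k.1)))
  (fun l i => slicel (jP l i.2) (qm_Phi M (cO i.1))) (fun l => (n0, l)) cpf.
- by move=> l l' [].
- rewrite slicel_slice_phi; have [_ -> ->] := qm_starhom M; rewrite (slicelM hP).
  by apply: eq_bigr => l _; rewrite (slicel_star hP).
apply: (@gram_form_positive _ _ _ _ _ Y) => i k.
by rewrite /slice_mx phiE YE.
Qed.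

Lemma form_positiveD (H : hilbertType C) (I : finType) (F G : I -> I -> bop H) :
  form_positive F -> form_positive G -> form_positive (fun i k => F i k + G i k).
Proof.
move=> [sF F0] [sG G0]; split=> [i k|x]; first by rewrite starD sF sG.
rewrite (_ : \sum_i _ = \sum_i \sum_k hdot (op (F i k) (x k)) (x i) +
    \sum_i \sum_k hdot (op (G i k) (x k)) (x i)) ?addr_ge0 //.
rewrite -big_split; apply: eq_bigr => i _ /=; rewrite -big_split; apply: eq_bigr => k _ /=.
by rewrite (semidotDl hdot_semidot).
Qed.

Lemma form_positiveJ (H : hilbertType C) (I : finType) (F : I -> I -> bop H) (W : bop H) :
  star W = W -> form_positive F -> form_positive (fun i k => W ** F i k ** W).
Proof.
move=> sW [sF F0]; split=> [i k|x]; first by rewrite !starM sF sW smulA.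
have := F0 (fun i => op W (x i)); congr (0 <= _).
apply: eq_bigr => i _; apply: eq_bigr => k _.
by rewrite !opMx [RHS]op_starEr sW.
Qed.

(* [f 1] need not be invertible: eps times a scalar-valued map is added before normalising
   by the inverse square root of the value at 1. *)
Lemma cp_unital_approx (n0 : 'I_N) (f : {linear os_space S -> bop K}) (eps : C) :
  is_cp f -> 0 < eps ->
  exists (phi : {linear O -> tensor P (bop K)}) (Z : bop K),
  [/\ unital phi, form_positive_map phi, star Z = Z /\ exists W, Z ** W = uone,
      forall w x, Z ** slicel w (phi x) ** Z = f (slicel w (slice_phi M x)) +
        (eps * (w uone * jO n0 n0 x)) *: uone
    & forall g, (forall s, f s ** g = g ** f s) ->
        Z ** g = g ** Z /\ forall w x, slicel w (phi x) ** g = g ** slicel w (phi x)].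
Proof.
move=> cpf eps0; have [phi0 phi0E] := cp_tensor_map f.
have pos0 := cp_tensor_map_positive cpf phi0E.
(* These are the slices of the map sending [x] to the scalar [jO n0 n0 x]; a diagonal coordinate is
   a state by [coord1], [coordM] and [coord_star]. *)
pose al (w : {scalar P}) (x : O) : C := w uone * jO n0 n0 x.
pose F := f (os_one S) + eps *: uone.
have e_real : eps^* = eps by rewrite geC0_conj // ltW.
have [Y f1] : exists Y, f (os_one S) = star Y ** Y.
  apply/mxpos1; have [|Y' Y'E] := cpf 1%N (const_mx (os_one S)); last first.
    by exists Y'; rewrite -Y'E map_const_mx.
  by rewrite map_const_mx; apply/mxpos1; exists uone; rewrite star_one smul1l.
have sF : star F = F by rewrite /F starD starZ e_real star_one f1 starM starK.
have [x|Z [W [[sZ sW] ZZ [ZW WZ] cZW]]] := bop_inv_sqrt sF eps0.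
  rewrite /F f1 opDx opZx op1x (semidotDl hdot_semidot) (semidotZl hdot_semidot) -hnorm_sq.
  by rewrite lerDr opMx op_starE -hnorm_sq exprn_ge0.
have lJ : linear (fun T : bop K => W ** T ** W).
  by move=> k T T'; rewrite smulDr smulDl -smulZr -smulZl.
pose J : {linear bop K -> bop K} := mk_linear lJ.
have JE T : J T = W ** T ** W by [].
clearbody J.
have lphi : linear (fun x => tmap idfun J (phi0 x + (eps * jO n0 n0 x) *: (uone \ot uone))
    : tensor P (bop K)).
  move=> k x y; rewrite -linearP; congr (tmap _ _ _).
  rewrite !linearP /= scalerDr scalerA addrACA mulrDr scalerDl; congr (_ + (_ + _)).
  by rewrite mulrCA.
pose phi : {linear O -> tensor P (bop K)} := mk_linear lphi.
have phiE w x : slicel w (phi x) =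
    W ** (f (slicel w (slice_phi M x)) + (eps * al w x) *: uone) ** W.
  rewrite slicel_tmap JE; congr (_ ** _ ** _).
  rewrite linearD linearZ /= phi0E slicel_pair scalerA; congr (_ + _ *: _).
  by rewrite /al mulrA mulrAC.
clearbody phi; exists phi, Z; split=> //.
- apply: (tensor_slice_ext hP) => a b; set w := jP a b.
  rewrite phiE slicel_one slice_phi_one.
  rewrite linearZ /al (coord1 hO) eqxx mulr1 mulrC -scalerA -scalerDr -smulZr -smulZl.
  by rewrite -/F -ZZ smulA WZ smul1l ZW.
- pose G i k : bop K := slice_mx (cO := cO) (jP := jP) phi0 i k +
    (eps * al (jP i.2 k.2) (star (cO i.1) ** cO k.1)) *: uone.
  rewrite (_ : slice_mx _ = fun i k => W ** G i k ** W); last first.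
    by apply/funext => i; apply/funext => k; rewrite /slice_mx phiE -phi0E.
  apply: form_positiveJ => //; apply: form_positiveD => //.
  (* With the unit of C(P) written as [star uone ** uone], [coordM] and [coord_star] expand both
     scalar matrices as Gram matrices, whose factors are multiplied. *)
  apply: (@gram_form_positive _ _ _ ('I_N * 'I_m)%type _ (fun l i =>
    (sqrtC eps * (jO l.1 n0 (cO i.1) * jP l.2 i.2 uone)) *: uone)) => i k.
  have e2 : (sqrtC eps)^* * sqrtC eps = eps.
    by rewrite geC0_conj ?sqrtC_ge0 ?ltW // -expr2 sqrtCK.
  rewrite /al -[X in jP i.2 k.2 X](smul1l (uone : P)) -{1}(star_one P) (coordM hP) (coordM hO).
  rewrite [X in eps * X]mulrC big_distrlr /= pair_bigA /= mulr_sumr scaler_suml.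
  apply: eq_bigr => q _; rewrite starZ (star_one (bop K)) -smulZl -smulZr smul1l scalerA; congr (_ *: _).
  by rewrite (coord_star hO) (coord_star hP) !rmorphM /= -{1}e2; ring.
- by split=> //; exists W.
- by move=> w x; rewrite phiE !smulA ZW smul1l -smulA WZ smul1r.
- move=> g fg; have [|gZ gW] := cZW g.
    by rewrite /F smulDl smulDr fg -smulZl -smulZr smul1l smul1r.
  split=> // w x; rewrite phiE.
  set X := f _ + _; have gX : g ** X = X ** g.
    by rewrite /X smulDl smulDr fg -smulZl -smulZr smul1l smul1r.
  by rewrite !smulA gW -(smulA W g X) gX smulA -(smulA (W ** X) W g) -gW smulA.
Qed.

End Positivity.

Section SliceTensors.
Context {R : realType} {O P : finQSpace R[i]} (M : quantum_maps P O).
Local Notation C := R[i].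
Local Notation S := (slice_system M).
Local Notation SS := (tensor (os_space S) (os_space S)).
Local Notation slice w x := (slicel w (slice_phi M x)).

(** The list remembers functionals and elements of [O], so that maps of the slice system can be
    replaced term by term by maps defined on C(O). *)
Definition slice_tensors (L : seq (({scalar P} * O) * ({scalar P} * O))) : SS :=
  \sum_(q <- L) slice q.1.1 q.1.2 \ot slice q.2.1 q.2.2.

Definition os_incl : {linear SS -> tensor M M} := tmap (@os_val C M S) (@os_val C M S).

Lemma os_inclE a b : os_incl (a \ot b) = os_val a \ot os_val b.
Proof. exact: tmap_pair. Qed.

Lemma slice_tensors_map (W : lmodType C) (h : {linear SS -> W}) L :
  h (slice_tensors L) = \sum_(q <- L) h (slice q.1.1 q.1.2 \ot slice q.2.1 q.2.2).
Proof. exact: linear_sum. Qed.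

Lemma os_mulE (K : hilbertType C) (f g : {linear os_space S -> bop K}) a b :
  os_mul f g (a \ot b) = f a ** g b.
Proof. exact: (tlift_pair (os_mul_fun f g)). Qed.

Lemma slice_tensors_positive (K : hilbertType C) (f g : {linear os_space S -> bop K}) L :
  is_cp f -> is_cp g -> (forall s r, f s ** g r = g r ** f s) ->
  (forall (H : hilbertType C) (pi : {linear tensor M M -> bop H}), is_starhom pi ->
     forall h, 0 <= hdot (op (pi (os_incl (slice_tensors L))) h) h) ->
  forall k, 0 <= hdot (op (os_mul f g (slice_tensors L)) k) k.
Proof.
move=> cpf cpg fg pos k.
have [N [jO [cO hO]]] := findim_coordinates O.
have [m [jP [cP hP]]] := findim_coordinates P.
have n0 := Ordinal (coord_gt0 hO).
pose al (q : {scalar P} * O) : C := q.1 uone * jO n0 n0 q.2.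
pose a (q : ({scalar P} * O) * ({scalar P} * O)) := f (slice q.1.1 q.1.2).
pose b (q : ({scalar P} * O) * ({scalar P} * O)) := g (slice q.2.1 q.2.2).
(* This is the form at [k] of the pair perturbed by [d]: a polynomial in [d] with the wanted value
   as constant term, so that positivity for [d > 0] passes to the limit. *)
pose form (d : C) := \sum_(q <- L) hdot
  (op ((a q + (d * al q.1) *: uone) ** (b q + (d * al q.2) *: uone)) k) k.
have form_ge0 d : 0 < d -> 0 <= form d.
  move=> d0.
  have [phi1 [Z1 [u1 p1 [sZ1 [W1 ZW1]] E1 c1]]] := cp_unital_approx hO hP n0 cpf d0.
  have [phi2 [Z2 [u2 p2 [sZ2 [W2 ZW2]] E2 c2]]] := cp_unital_approx hO hP n0 cpg d0.
  have fphi2 s w y : f s ** slicel w (phi2 y) = slicel w (phi2 y) ** f s.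
    by have [|_ ->] := c2 (f s); first by move=> r; rewrite fg.
  have fZ2 s : f s ** Z2 = Z2 ** f s.
    by have [|-> _] := c2 (f s); first by move=> r; rewrite fg.
  have Z12 : Z1 ** Z2 = Z2 ** Z1 by have [|-> _] := c1 Z2.
  have phi1Z2 w x : slicel w (phi1 x) ** Z2 = Z2 ** slicel w (phi1 x).
    by have [|_ ->] := c1 Z2.
  have Z1phi2 w y : Z1 ** slicel w (phi2 y) = slicel w (phi2 y) ** Z1.
    by have [|-> _] := c1 (slicel w (phi2 y)).
  have [|H [Phi1 [Phi2 [V [S1 S2 C12 _ EV]]]]] := commuting_dilation hO hP u1 u2 p1 p2.
    by move=> x y w w'; have [|_ ->] := c1 (slicel w' (phi2 y)).
  have [pi [Spi piE]] := @universal_pair R P O M H Phi1 Phi2 S1 S2 C12.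
  (* [Z1] and [Z2] commute with each other and with the opposite map, so the form of a product of
     slices of [phi1] and [phi2] at [Z1 Z2 k] is the form at [k] of the product of the slices
     multiplied by [Z1], respectively [Z2], on both sides. *)
  have := pos H pi Spi (V (op (Z1 ** Z2) k)); congr (0 <= _).
  have -> : pi (os_incl (slice_tensors L)) =
      \sum_(q <- L) pi (os_incl (slice q.1.1 q.1.2 \ot slice q.2.1 q.2.2)).
    exact: (slice_tensors_map (pi \o os_incl)).
  rewrite op_sum linear_sumlz; apply: eq_bigr => q _.
  rewrite os_inclE !slicel_slice_phi piE; apply: etrans (EV _ _ _ _ _) _.
  have -> : a q + (d * al q.1) *: uone = Z1 ** slicel q.1.1 (phi1 q.1.2) ** Z1 by rewrite E1.
  have -> : b q + (d * al q.2) *: uone = Z2 ** slicel q.2.1 (phi2 q.2.2) ** Z2 by rewrite E2.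
  rewrite -op_starE -!opMx; congr (hdot (op _ k) k).
  rewrite starM sZ1 sZ2 -Z12 !smulA; congr (_ ** _).
  rewrite -(smulA Z1 Z2) -phi1Z2 !smulA -(smulA _ _ Z1) -Z1phi2 !smulA; congr (_ ** _).
  by rewrite -!smulA Z12.
have osE : os_mul f g (slice_tensors L) = \sum_(q <- L) a q ** b q.
  transitivity (tlift (os_mul_fun f g) (slice_tensors L)) => //.
  by rewrite slice_tensors_map; apply: eq_bigr => q _; exact: os_mulE.
rewrite osE op_sum linear_sumlz; apply: le0_of_small => e e0.
pose B := \sum_(q <- L) (al q.1 * hdot (op (b q) k) k + al q.2 * hdot (op (a q) k) k).
pose D := \sum_(q <- L) al q.1 * al q.2 * `|k| ^+ 2.
have [|d [d0 d1 dc]] := @small_factor _ (`|B| + `|D|) e _ e0; first by rewrite addr_ge0.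
exists (form d); first exact: form_ge0.
have -> : form d = \sum_(q <- L) hdot (op (a q ** b q) k) k + (d * B + d ^+ 2 * D).
  rewrite /B /D !mulr_sumr -!big_split; apply: eq_bigr => q _ /=.
  rewrite opxD opxZ !(semidotDl hdot_semidot, semidotZl hdot_semidot) -hnorm_sq.
  by ring.
rewrite opprD addrA subrr add0r normrN (le_lt_trans (ler_normD _ _)) //.
apply: le_lt_trans dc; rewrite !normrM mulrDr (ger0_norm (ltW d0)) lerD //.
by rewrite ler_wpM2r // -[leRHS]mulr1 ler_wpM2l // ltW.
Qed.

End SliceTensors.

(** * Riesz' extension theorem *)

(* Functionals are handled through their graphs, so that Zorn's lemma applies to
   sets of pairs ordered by inclusion. *)
Section RieszExtension.
Context {R : realType} {V : lmodType R[i]} (K : set V) (e : V) (G0 : set (V * R)).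
Local Notation "r *.: x" := (r%:C%C *: x) (at level 40).

Hypotheses (K_add : forall x y, K x -> K y -> K (x + y))
  (K_scale : forall (r : R) x, 0 <= r -> K x -> K (r *.: x))
  (K_unit : forall x, exists2 r : R, 0 <= r & K (r *.: e - x)).

Definition graph_linear (G : set (V * R)) : Prop :=
  forall (r : R) p q, G p -> G q -> G (r *.: p.1 + q.1, r * p.2 + q.2).
Definition graph_positive (G : set (V * R)) : Prop :=
  forall p, G p -> K p.1 -> 0 <= p.2.
(** Single-valuedness is automatic: the difference of two values at a point is, in both orders, a
    value at 0, which lies in [K]. *)
Definition graph_good G := graph_linear G /\ graph_positive G.

Hypotheses (G0_good : graph_good G0) (G0_unit : G0 (e, 1)).

Let K0 : K 0.
Proof.
have [r r0 Kr] := K_unit e; rewrite -(scale0r (r *.: e - e)).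
by rewrite -[0 : R[i]]/(0%:C%C); apply: K_scale.
Qed.

(** The new value has to dominate the values at points below [x] and be dominated by those above;
    [sup L] does both. As [e] is an order unit, [L] is nonempty and bounded above. *)
Lemma graph_extend G x : graph_good G -> G0 `<=` G -> (forall r, ~ G (x, r)) ->
  exists t, graph_good [set p | exists c q, G q /\ p = (q.1 + c *.: x, q.2 + c * t)].
Proof.
move=> [Glin Gpos] G0G Gx.
have G00 : G (0, 0).
  have := Glin (-1) _ _ (G0G _ G0_unit) (G0G _ G0_unit); rewrite /= rmorphN rmorph1.
  by rewrite scaleN1r addNr mulN1r addNr.
have GZ r q : G q -> G (r *.: q.1, r * q.2).
  by move=> Gq; have := Glin r _ _ Gq G00; rewrite /= !addr0.
pose L := [set r | exists2 y, G (y, r) & K (x - y)].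
have LU l y u : L l -> G (y, u) -> K (y - x) -> l <= u.
  move=> [y' Gl Kl] Gu Ku; rewrite -subr_ge0.
  have := Glin (-1) _ _ Gl Gu; rewrite /= rmorphN rmorph1 scaleN1r mulN1r addrC [- l + u]addrC.
  move=> /Gpos; apply; rewrite /= (_ : y - y' = (y - x) + (x - y')); first exact: K_add.
  by rewrite addrA subrK.
have [r r0 Kr] := K_unit (- x); have [u u0 Ku] := K_unit x.
have supL : has_sup L.
  split; first exists (- r).
    exists (- (r *.: e)); last by rewrite opprK addrC; rewrite opprK in Kr.
    by have := GZ (- r) _ (G0G _ G0_unit); rewrite /= rmorphN scaleNr mulr1.
  exists u => l Ll; apply: (LU _ (u *.: e)) => //.
  by have := GZ u _ (G0G _ G0_unit); rewrite /= mulr1.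
exists (sup L); split.
  move=> s _ _ [c [p [Gp ->]]] [d [q [Gq ->]]] /=.
  exists (s * c + d), (s *.: p.1 + q.1, s * p.2 + q.2); split; first exact: Glin.
  rewrite /= rmorphD rmorphM scalerDl scalerDr scalerA addrACA; congr (_, _).
  by ring.
move=> _ [c [[y q] [Gq ->]]] /=; have [c0|c0|->] := ltgtP c 0; last first.
- by rewrite scale0r mul0r !addr0; exact: (Gpos (y, q)).
- move=> Kyx; have ci : 0 <= c^-1 by rewrite invr_ge0 ltW.
  have Ll : L (- (c^-1 * q)).
    exists (- (c^-1 *.: y)).
      by have := GZ (- c^-1) _ Gq; rewrite /= rmorphN scaleNr mulNr.
    have := K_scale ci Kyx; rewrite scalerDr scalerA -rmorphM mulVf ?gt_eqF //.
    by rewrite scale1r opprK addrC.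
  have := sup_upper_bound supL Ll; rewrite -(ler_pM2l c0) mulrN mulrA mulfV ?gt_eqF // mul1r.
  by rewrite -subr_ge0 opprK addrC.
- move=> Kyx; have ci : 0 <= - c^-1 by rewrite oppr_ge0 invr_le0 ltW.
  have : sup L <= - c^-1 * q.
    apply: ge_sup => [|l Ll]; first by case: supL.
    apply: (LU _ (- c^-1 *.: y) _ Ll).
      by have := GZ (- c^-1) _ Gq.
    have := K_scale ci Kyx; rewrite scalerDr scalerA -rmorphM mulNr mulVf ?lt_eqF //.
    by rewrite rmorphN1 scaleN1r.
  rewrite -(ler_nM2l c0) mulNr mulrN mulrA mulfV ?lt_eqF // mul1r => h.
  by rewrite -subr_ge0 opprK addrC in h.
Qed.

Lemma riesz_extension : exists f : V -> R,
  [/\ forall (r : R) x y, f (r *.: x + y) = r * f x + f y, forall p, G0 p -> f p.1 = p.2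
    & forall x, K x -> 0 <= f x].
Proof.
(* Adjoining [G0] inside the predicate covers the empty chain, whose union is empty. *)
pose Q G := graph_good (G0 `|` G).
have [F FQ Ftot|G [[Glin Gpos] Gmax]] := @Zorn_bigcup (V * R)%type Q.
  have directed p q : (G0 `|` \bigcup_(X in F) X) p -> (G0 `|` \bigcup_(X in F) X) q ->
      exists G, [/\ graph_good G, G p, G q & G `<=` G0 `|` \bigcup_(X in F) X].
    have inF X : F X -> G0 `|` X `<=` G0 `|` \bigcup_(X in F) X.
      by move=> FX; apply: setUS => y Xy; exists X.
    move=> [G0p|[X FX Xp]] [G0q|[Y FY Yq]].
    - by exists G0; split=> // y; left.
    - by exists (G0 `|` Y); split; [exact: FQ|left|right|exact: inF].
    - by exists (G0 `|` X); split; [exact: FQ|right|left|exact: inF].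
    - have [XY|YX] := Ftot _ _ FX FY.
        by exists (G0 `|` Y); split; [exact: FQ|right; exact: XY|right|exact: inF].
      by exists (G0 `|` X); split; [exact: FQ|right|right; exact: YX|exact: inF].
  split=> [r p q /directed h /h[G [[Glin _] Gp Gq]]|p Gp].
    by apply; exact: Glin.
  by have [G [[_ Gpos] {}Gp _ _]] := directed _ _ Gp Gp; exact: Gpos.
pose H := G0 `|` G.
have G0H : G0 `<=` H by move=> p; left.
have H0 : H (0, 0).
  have := Glin (-1) _ _ (G0H _ G0_unit) (G0H _ G0_unit).
  by rewrite /= rmorphN1 scaleN1r addNr mulN1r addNr.
have tot x : exists r, H (x, r).
  apply: contrapT => /forallNP none.
  have [t good] := @graph_extend H x (conj Glin Gpos) G0H none.
  set H' := [set p | _] in good.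
  have HH' : H `<=` H' by move=> [y r] Hy; exists 0, (y, r); rewrite /= scale0r mul0r !addr0.
  have H'x : H' (x, t) by exists 1, (0, 0); rewrite /= rmorph1 scale1r mul1r !add0r.
  apply: (Gmax H'); last first.
    by rewrite /Q (_ : G0 `|` H' = H') //; apply/setUidPr => p Gp; apply: HH'; left.
  split=> [p Gp|H'G]; first by apply: HH'; right.
  by apply: (none t); right; exact: H'G.
have [f fH] := choice tot.
have diff x r r' : H (x, r) -> H (x, r') -> 0 <= r' - r.
  move=> Hr Hr'; have := Glin (-1) _ _ Hr Hr'.
  by rewrite /= rmorphN1 scaleN1r mulN1r addNr addrC => /Gpos; apply.
have uniq x r : H (x, r) -> f x = r.
  move=> Hr; apply/le_anti; rewrite -subr_ge0 (diff _ _ _ (fH x) Hr) /=.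
  by rewrite -subr_ge0 (diff _ _ _ Hr (fH x)).
exists f; split=> [r x y|[x r] G0p|x Kx].
- by apply: uniq; exact: (Glin r _ _ (fH x) (fH y)).
- by apply: uniq; exact: G0H.
- exact: (Gpos _ (fH x) Kx).
Qed.

End RieszExtension.

Lemma complexification (R : realType) (V : lmodType R[i]) (f : V -> R) :
  (forall (r : R) x y, f (r%:C%C *: x + y) = r * f x + f y) ->
  exists s : {scalar V}, forall x, s x = (f x +i* - f ('i *: x))%C.
Proof.
move=> fP.
have fD x y : f (x + y) = f x + f y.
  by have := fP 1 x y; rewrite rmorph1 scale1r mul1r.
have f00 : f 0 = 0 by apply: (addrI (f 0)); rewrite -fD !addr0.
have fZ (r : R) x : f (r%:C%C *: x) = r * f x by have := fP r x 0; rewrite !addr0 f00 addr0.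
have fN x : f (- x) = - f x.
  by rewrite -scaleN1r -(rmorphN1 (real_complex R)) fZ mulN1r.
have fC (a b : R) x : f ((a +i* b)%C *: x) = a * f x + b * f ('i *: x).
  have -> : (a +i* b)%C = a%:C%C + b%:C%C * 'i 
    by rewrite -complexiE mulrC; exact: complexE.
  by rewrite scalerDl fD fZ -scalerA fZ.
pose s x : R[i] := (f x +i* - f ('i *: x))%C.
suff sP : scalar s by exists (mk_scalar sP).
have fiC (a b : R) x : f ('i *: ((a +i* b)%C *: x)) = a * f ('i *: x) - b * f x.
  by rewrite scalerA mulrC -scalerA fC scalerA -expr2 sqrCi scaleN1r fN mulrN.
move=> [a b] x y; rewrite /s scalerDr !fD fC fiC; apply/eqP; rewrite eq_complex /=.
by apply/andP; split; apply/eqP; ring.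
Qed.

(** * Extension of commuting states *)

Lemma Re_scale (R : rcfType) (r : R) (z : R[i]) : complex.Re (r%:C%C * z) = r * complex.Re z.
Proof. by case: z => a b /=; rewrite mul0r subr0. Qed.

Lemma Im_mulI (R : rcfType) (z : R[i]) : complex.Im ('i * z) = complex.Re z.
Proof. by rewrite -complexiE; case: z => a b /=; rewrite mul0r mul1r add0r. Qed.

Lemma Re_le_norm (R : realType) (z c : R[i]) : 0 <= c -> `|z| <= c -> complex.Re z <= complex.Re c.
Proof.
move=> c0 zc; rewrite -lecR -(nneg_real c0); apply: le_trans zc.
by apply: le_trans (normc_ge_Re z); rewrite lecR ler_norm.
Qed.

Lemma nneg_of_Re (R : rcfType) (z : R[i]) : z^* = z -> 0 <= complex.Re z -> 0 <= z.
Proof.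
case: z => a b [] /eqP; rewrite eq_sym -subr_eq0 opprK -mulr2n mulrn_eq0 /= => /eqP -> a0.
by rewrite lecE /= eqxx.
Qed.

Lemma form_selfadjoint (R : realType) (H : hilbertType R[i]) (T : bop H) :
  (forall x, 0 <= hdot (op T x) x) -> star T = T.
Proof.
move=> T0; apply: bop_ext => x; apply: hdot_ext => z; rewrite op_starE.
rewrite [LHS](semidotC hdot_semidot); symmetry.
apply: (sesquilinear_hermitian (q := fun x y => hdot (op T x) y)) => // k u v y.
  by rewrite opPx (semidotPl hdot_semidot).
exact: (semidotPr hdot_semidot).
Qed.

Section StarSlice.
Context {C : numClosedFieldType} {P : ustarAlgType C} (w : {scalar P}).

Fact star_functional_linear : scalar (fun x => (w (star x))^*).
Proof. by move=> k x y; rewrite starD starZ linearP /= rmorphD rmorphM /= conjCK. Qed.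

Definition star_functional : {scalar P} := mk_scalar star_functional_linear.

Lemma star_slicel (A : starAlgType C) (y : tensor P A) :
  star (slicel w y) = slicel star_functional (star y).
Proof.
move: y; apply: tensor_ind => [|p a|x y hx hy].
- by rewrite star_zero !linear0 star_zero.
- by rewrite tensor_star !slicel_pair /= starK starZ.
- by rewrite starD !linearD /= starD hx hy.
Qed.
End StarSlice.

Section CommutingState.
Context {R : realType} {O P : finQSpace R[i]} {M : quantum_maps P O} (Z : max_tensor M M).
Local Notation C := R[i].
Local Notation S := (slice_system M).
Local Notation SS := (tensor (os_space S) (os_space S)).
Local Notation A := (tensor M M).
Local Notation slice w x := (slicel w (slice_phi M x)).
Local Notation incl := (os_incl M).

(* The closed convex cone for which Riesz' extension theorem is applied; [1 \ot 1] is an order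
   unit because of the norm of the maximal tensor product. *)
Definition max_positive (x : A) : Prop :=
  forall (H : hilbertType C) (pi : {linear A -> bop H}), is_starhom pi ->
  forall h, 0 <= complex.Re (hdot (op (pi x) h) h).

Lemma max_positiveD x y : max_positive x -> max_positive y -> max_positive (x + y).
Proof.
move=> hx hy H pi Spi h; rewrite linearD /= (semidotDl hdot_semidot) raddfD addr_ge0 //.
  exact: hx.
exact: hy.
Qed.

Lemma max_positiveZ (r : R) x : 0 <= r -> max_positive x -> max_positive (r%:C%C *: x).
Proof.
move=> r0 hx H pi Spi h; rewrite linearZ /= (semidotZl hdot_semidot) Re_scale mulr_ge0 //.
exact: hx.
Qed.

Lemma max_positive_unit (x : A) :
  exists2 r : R, 0 <= r & max_positive (r%:C%C *: ((uone : M) \ot (uone : M)) - x).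
Proof.
have n0 : 0 <= `|mt_in Z x| by [].
exists (complex.Re `|mt_in Z x|) => [|H pi Spi h]; first by rewrite -lecR -nneg_real.
have [pi1 _ _] := Spi.
have {}pi1 : pi ((uone : M) \ot (uone : M)) = uone by exact: pi1.
have -> : pi ((complex.Re `|mt_in Z x|)%:C%C *: (uone \ot uone) - x) = `|mt_in Z x| *: uone - pi x.
  by rewrite linearB linearZ /= pi1 -nneg_real.
rewrite opBx opZx op1x (semidotBl hdot_semidot) (semidotZl hdot_semidot).
rewrite -hnorm_sq raddfB subr_ge0; apply: Re_le_norm.
  by rewrite mulr_ge0 // exprn_ge0.
rewrite (le_trans (hdot_CS _ _)) // expr2 mulrA ler_wpM2r //.
by have [/(_ (lexx _)) h1 _] := @mt_norm _ _ _ Z x _ n0; exact: h1.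
Qed.

Lemma slice_tensors_cat L L' : slice_tensors M (L ++ L') = slice_tensors M L + slice_tensors M L'.
Proof. exact: big_cat. Qed.

Lemma slice_tensors_scale (k : C) L : exists L', slice_tensors M L' = k *: slice_tensors M L.
Proof.
exists [seq ((q.1.1, k *: q.1.2), q.2) | q <- L].
rewrite /slice_tensors big_map scaler_sumr; apply: eq_bigr => q _ /=.
have s0 : slice q.1.1 0 = 0.
  have := slice_phi_linear (M := M) q.1.1 (-1) 0 0.
  by rewrite scaler0 addr0 scaleN1r addNr.
have := slice_phi_linear (M := M) q.1.1 k q.1.2 0; rewrite s0 !addr0 => ->.
exact: linearZl_LR.
Qed.

Local Notation tstar := (@os_tstar C M M S S).

Lemma os_tstar_pair a b : tstar (a \ot b) = os_star a \ot os_star b.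
Proof. exact: (@tlift_pair _ _ _ (conjmod SS) (@os_tstar_fun C M M S S) a b). Qed.

Lemma os_tstarD : {morph tstar : x y / x + y}.
Proof. by move=> x y; exact: (linearD (tlift (@os_tstar_fun C M M S S))). Qed.

Lemma os_tstar0 : tstar 0 = 0.
Proof. exact: (linear0 (tlift (@os_tstar_fun C M M S S))). Qed.

Lemma os_tstarK : involutive tstar.
Proof.
apply: tensor_ind => [|a b|x y hx hy].
- by rewrite !os_tstar0.
- by rewrite !os_tstar_pair; congr (_ \ot _); apply: val_inj; exact: starK.
- by rewrite !os_tstarD hx hy.
Qed.

Lemma os_tstarZ (k : C) x : tstar (k *: x) = k^* *: tstar x.
Proof.
move: x; apply: tensor_ind => [|a b|x y hx hy].
- by rewrite scaler0 os_tstar0 scaler0.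
- rewrite -linearZl_LR !os_tstar_pair -linearZl_LR; congr (_ \ot _); apply: val_inj.
  exact: starZ.
- by rewrite scalerDr !os_tstarD hx hy scalerDr.
Qed.

Lemma os_incl_star x : incl (tstar x) = star (incl x).
Proof.
move: x; apply: tensor_ind => [|a b|x y hx hy].
- by rewrite os_tstar0 linear0 [RHS]star_zero.
- by rewrite os_tstar_pair !os_inclE [RHS]tensor_star.
- by rewrite os_tstarD linearD /= hx hy -starD -linearD.
Qed.

Lemma slice_star (w : {scalar P}) x : os_star (slice w x) = slice (star_functional w) (star x).
Proof.
apply: val_inj; transitivity (star (slicel w (qm_Phi M x))).
  by rewrite -slicel_slice_phi.
transitivity (slicel (star_functional w) (qm_Phi M (star x))); last exact/esym/slicel_slice_phi.
by have [_ _ ->] := qm_starhom M; exact: star_slicel.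
Qed.

Lemma slice_tensors_star L : exists L', slice_tensors M L' = tstar (slice_tensors M L).
Proof.
exists [seq ((star_functional q.1.1, star q.1.2), (star_functional q.2.1, star q.2.2)) | q <- L].
rewrite /slice_tensors big_map (big_morph _ os_tstarD os_tstar0).
by apply: eq_bigr => q _; rewrite os_tstar_pair !slice_star.
Qed.

Lemma slice_tensors_one : exists L, slice_tensors M L = os_one S \ot os_one S.
Proof.
have [m [j [c jc]]] := findim_coordinates P; have n0 := Ordinal (coord_gt0 jc).
exists [:: ((j n0 n0, uone), (j n0 n0, uone))]; rewrite /slice_tensors big_seq1 /=.
by rewrite !slice_phi_one (coord1 jc) eqxx !scale1r.
Qed.

Lemma form_conj (H : hilbertType C) (pi : {linear A -> bop H}) x h :
  is_starhom pi -> hdot (op (pi (star x)) h) h = (hdot (op (pi x) h) h)^*.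
Proof.
by move=> [_ _ ->]; rewrite op_starE; exact: (semidotC hdot_semidot).
Qed.

Context {sigma : {scalar SS}} (sigma_state : is_commuting_state sigma).

(** The cone controls real parts only, but the forms of a self-adjoint element are real. The square
    root of the resulting positive operator is the factor that [mxpos] requires. *)
Lemma commuting_state_ge0 L : tstar (slice_tensors M L) = slice_tensors M L ->
  max_positive (incl (slice_tensors M L)) -> 0 <= sigma (slice_tensors M L).
Proof.
move=> sa pos; apply: (proj2 sigma_state); split=> [i k|K f g cf cg fg]; first by rewrite !mxE sa.
have fp := slice_tensors_positive (L := L) cf cg fg.
rewrite map_const_mx; apply/mxpos1.
have {}fp k : 0 <= hdot (op (os_mul f g (slice_tensors M L)) k) k.
  apply: fp => H pi Spi h; apply: nneg_of_Re; last exact: pos.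
  by rewrite -form_conj // -os_incl_star sa.
have [Y [sY YY _]] := bop_sqrt (form_selfadjoint fp) fp.
by exists Y; rewrite sY YY.
Qed.

(** A large real multiple of the unit minus the element is positive, so [sigma] of it is nonnegative
    and in particular real. *)
Lemma commuting_state_real L : tstar (slice_tensors M L) = slice_tensors M L ->
  complex.Im (sigma (slice_tensors M L)) = 0.
Proof.
move=> sa; have [r r0 hr] := max_positive_unit (incl (slice_tensors M L)).
have [L1 L1E] := slice_tensors_one.
have [L2 L2E] := slice_tensors_scale (r%:C)%C L1; have [L3 L3E] := slice_tensors_scale (-1) L.
have LE : slice_tensors M (L2 ++ L3) = r%:C%C *: (os_one S \ot os_one S) - slice_tensors M L.
  by rewrite slice_tensors_cat L2E L3E L1E scaleN1r.
have sE : sigma (slice_tensors M (L2 ++ L3)) = r%:C%C - sigma (slice_tensors M L).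
  by rewrite LE linearB linearZ /= (proj1 sigma_state) mulr1.
have : 0 <= r%:C%C - sigma (slice_tensors M L).
  rewrite -sE; apply: commuting_state_ge0; last by rewrite LE linearB linearZ /= os_inclE.
  have rr : (r%:C%C : C)^* = r%:C%C by exact: conjc_real.
  rewrite LE -scaleN1r os_tstarD !os_tstarZ rmorphN1 sa os_tstar_pair rr.
  by congr (_ *: (_ \ot _) + _); apply: val_inj; exact: star_one.
by case: (sigma _) => a b; rewrite lecE /= sub0r oppr_eq0 => /andP[/eqP].
Qed.

(** The sum of the element and its adjoint is self-adjoint and positive. Its two terms have values
    with the same real part, because ['i] times their difference is self-adjoint and has a real
    value. *)
Lemma commuting_state_Re L : max_positive (incl (slice_tensors M L)) ->
  0 <= complex.Re (sigma (slice_tensors M L)).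
Proof.
move=> pos; have [L' L'E] := slice_tensors_star L.
have Re_eq : complex.Re (sigma (slice_tensors M L')) = complex.Re (sigma (slice_tensors M L)).
  have [L1 L1E] := slice_tensors_scale 'i L; have [L2 L2E] := slice_tensors_scale (- 'i) L'.
  have c2 : (- 'i : C)^* = 'i by rewrite -conjCi conjCK.
  have := @commuting_state_real (L1 ++ L2); rewrite slice_tensors_cat L1E L2E L'E.
  rewrite os_tstarD !os_tstarZ os_tstarK conjCi c2 addrC => /(_ erefl).
  rewrite linearD !linearZ /= mulNr raddfB /= !Im_mulI => /eqP.
  by rewrite subr_eq0 => /eqP.
have : 0 <= sigma (slice_tensors M (L ++ L')).
  apply: commuting_state_ge0; rewrite slice_tensors_cat L'E.
    by rewrite os_tstarD os_tstarK addrC.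
  move=> H pi Spi h; rewrite linearD os_incl_star linearD /= (semidotDl hdot_semidot) form_conj //.
  have := pos H pi Spi h; set z := hdot _ _; case: z => a b /= a0.
  by rewrite addr_ge0.
move: Re_eq; rewrite slice_tensors_cat linearD /=.
case: (sigma (slice_tensors M L)) => a b; case: (sigma (slice_tensors M L')) => a' b' /= ->.
by rewrite lecE /= -mulr2n pmulrn_lge0 // => /andP[].
Qed.

Lemma state_extension : exists s : {scalar A},
  (forall L, s (incl (slice_tensors M L)) = sigma (slice_tensors M L)) /\
  forall x, (forall (H : hilbertType C) (pi : {linear A -> bop H}), is_starhom pi ->
    forall h, 0 <= hdot (op (pi x) h) h) -> 0 <= s x.
Proof.
pose G0 : set (A * R) := [set p | exists L,
  p = (incl (slice_tensors M L), complex.Re (sigma (slice_tensors M L)))].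
have [||f [fP fG0 f0]] := @riesz_extension R A max_positive (uone \ot uone) G0
    max_positiveD max_positiveZ max_positive_unit.
- split=> [r _ _ [L ->] [L' ->]|_ [L ->]] /=; last exact: commuting_state_Re.
  have [L1 L1E] := slice_tensors_scale (r%:C)%C L; exists (L1 ++ L').
  by rewrite slice_tensors_cat L1E !linearP /= raddfD /= Re_scale.
- have [L LE] := slice_tensors_one; exists L.
  by rewrite LE os_inclE (proj1 sigma_state).
have [s sE] := complexification fP.
exists s; split=> [L|x xpos].
  have fL L' : f (incl (slice_tensors M L')) = complex.Re (sigma (slice_tensors M L')).
    by apply: (fG0 (_, _)); exists L'.
  (* The imaginary part of [s] is read off from [f] at ['i] times the element, which is again a sum
     of tensors of slices. *)
  have [L' L'E] := slice_tensors_scale 'i L.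
  rewrite sE fL -linearZ -L'E fL L'E linearZ /=.
  by rewrite -complexiE; case: (sigma _) => a b /=; rewrite mul0r mul1r sub0r opprK.
rewrite sE lecE /= oppr_eq0 f0 ?andbT; last first.
  by move=> H pi Spi h; have := xpos H pi Spi h; rewrite lecE => /andP[].
have f00 : f 0 = 0 by have := fP (-1) 0 0; rewrite scaler0 addr0 mulN1r addNr.
(* Every real multiple of ['i *: x] has forms with zero real part and so lies in the cone; hence the
   imaginary part of [s x] vanishes. *)
have fi0 e : 0 <= e * f ('i *: x).
  have -> : e * f ('i *: x) = f (e%:C%C *: ('i *: x)).
    by have := fP e ('i *: x) 0; rewrite addr0 f00 addr0.
  apply: f0 => H pi Spi h; rewrite scalerA linearZ /= (semidotZl hdot_semidot) -mulrA Re_scale.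
  have := xpos H pi Spi h; rewrite -complexiE; case: (hdot _ _) => a b.
  by rewrite lecE /= => /andP[/eqP -> _]; rewrite mul0r mul1r subr0 mulr0.
apply/eqP/le_anti.
by have := fi0 1; have := fi0 (-1); rewrite mul1r mulN1r oppr_ge0 => -> ->.
Qed.

Lemma commuting_to_starhom_correlation (T : {linear tensor O O -> tensor P P}) :
  (forall x y, T (x \ot y) = slicer sigma (tinter (slice_phi M x) (slice_phi M y))) ->
  starhom_correlation T.
Proof.
move=> hT; have [s [sE s0]] := state_extension.
have sE1 w x w' y : s (os_val (slice w x) \ot os_val (slice w' y)) = sigma (slice w x \ot slice w' y).
  have := sE [:: ((w, x), (w', y))].
  by rewrite /slice_tensors big_seq1 os_inclE.
have s0' x : 0 <= s (star x ** x).
  apply: s0 => H pi [_ piM pis] h; rewrite piM pis opMx op_starE -hnorm_sq.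
  exact: exprn_ge0.
have [a|H [pi [xi [Spi piE]]]] := gns_representation s0'.
  (* In every representation the norm of [pi a] is at most [|mt_in Z a|], so the difference of the
     two sides is [s] at an element with nonnegative forms. *)
  exists (`|mt_in Z a| ^+ 2) => [|x]; first exact: exprn_ge0.
  rewrite -subr_ge0.
  have -> : `|mt_in Z a| ^+ 2 * s (star x ** x) - s (star (a ** x) ** (a ** x)) =
      s (`|mt_in Z a| ^+ 2 *: (star x ** x) - star (a ** x) ** (a ** x)).
    by rewrite linearB linearZ.
  apply: s0 => H pi Spi h; have [_ piM pis] := Spi.
  have -> : pi (`|mt_in Z a| ^+ 2 *: (star x ** x) - star (a ** x) ** (a ** x)) =
      `|mt_in Z a| ^+ 2 *: (star (pi x) ** pi x) - star (pi a ** pi x) ** (pi a ** pi x).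
    by rewrite linearB linearZ /= !piM !pis !piM.
  rewrite opBx opZx (semidotBl hdot_semidot) (semidotZl hdot_semidot) !opMx !op_starE -!hnorm_sq.
  rewrite subr_ge0 -exprMn ler_pXn2r ?nnegrE ?mulr_ge0 //.
  have [/(_ (lexx _)) h1 _] := @mt_norm _ _ _ Z a _ (normr_ge0 (mt_in Z a)).
  exact: h1.
have [F [G [SF SG FGcomm FG]]] := starhom_legs (qm_starhom M) (qm_starhom M) Spi.
exists H, F, G, xi; split=> //.
- apply/eqP; rewrite -(@eqrXn2 _ 2) // expr1n -vector_state_one.
  have [<- _ _] := Spi; rewrite piE; have [L LE] := slice_tensors_one.
  have := sE L; rewrite LE os_inclE (proj1 sigma_state) => <-.
  by apply/eqP.
- move=> x y; rewrite FG hT; have [m [jP [cP hP]]] := findim_coordinates P.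
  rewrite !(slicer_tinter hP); do 4!(apply: eq_bigr => ? _).
  by rewrite -sE1 -piE !slicel_slice_phi.
Qed.

End CommutingState.

Theorem theorem5p8 (R : realType) (P O : finQSpace R[i])
    (T : {linear tensor O O -> tensor P P}) (T_ucp : is_ucp T)
    (M : quantum_maps P O) (Z : max_tensor M M) :
  [<->
   exists (H : hilbertType R[i]) (phi1 phi2 : {linear O -> tensor P (bop H)})
     (xi : H),
     [/\ is_ucp phi1, is_ucp phi2,
         forall x y : O,
           leg13 (phi1 x) ** leg23 (phi2 y) = leg23 (phi2 y) ** leg13 (phi1 x),
         `|xi| = 1
       & forall x y : O,
           T (x \ot y) =
           slicer (vector_state xi) (leg13 (phi1 x) ** leg23 (phi2 y))];
   exists (H : hilbertType R[i]) (Phi1 Phi2 : {linear O -> tensor P (bop H)})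
     (xi : H),
     [/\ is_starhom Phi1, is_starhom Phi2,
         forall x y : O,
           leg13 (Phi1 x) ** leg23 (Phi2 y) = leg23 (Phi2 y) ** leg13 (Phi1 x),
         `|xi| = 1
       & forall x y : O,
           T (x \ot y) =
           slicer (vector_state xi) (leg13 (Phi1 x) ** leg23 (Phi2 y))];
   exists sigma : {scalar Z},
     is_state sigma /\
     forall x y : O,
       T (x \ot y) =
       slicer (sigma \o mt_in Z) (tinter (qm_Phi M x) (qm_Phi M y));
   exists sigma : {scalar tensor (os_space (slice_system M))
                                 (os_space (slice_system M))},
     is_commuting_state sigma /\
     forall x y : O,
       T (x \ot y) = slicer sigma (tinter (slice_phi M x) (slice_phi M y))].

Proof.
tfae.
- exact: ucp_to_starhom_correlation.
- exact: starhom_to_maximal_correlation.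
- exact: maximal_to_commuting_correlation.
- move=> [sigma [sigma_state hT]]; apply: starhom_to_ucp_correlation.
  exact: (commuting_to_starhom_correlation Z sigma_state hT).
Qed.
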